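(* Let $(\Sigma,\sigma)$ be a non-trivial topologically transitive one-sided (respectively, two-sided) countable Markov shift. Then for any $m,k\in\mathbb N^+$, any $\{\mu_i\}_{i=1}^m\subset\mathcal M(\sigma,\Sigma)$ with finite entropy, any $x\in\Sigma$, any bounded uniformly continuous functions $\varphi_1,\dots,\varphi_k:\Sigma\to\mathbb R$ and any $\varepsilon>0$, there exist $n\in\mathbb N^+$ and compact $\sigma^n$-invariant subsets $\Delta_i\subseteq\Delta\subseteq\Sigma$ ($1\le i\le m$) such that, writing $\Lambda_i=\bigcup_{j=0}^{n-1}\sigma^j(\Delta_i)$ and $\Lambda=\bigcup_{j=0}^{n-1}\sigma^j(\Delta)$, for each $1\le i\le m$: 1. $(\Delta_i,\sigma^n|_{\Delta_i})$ and $(\Delta,\sigma^n|_\Delta)$ are each topologically conjugate to a one-sided (respectively, two-sided) full shift; 2. $h_{\mathrm{top}}(\sigma,\Lambda_i)\ge h_{\mathrm{top}}(\sigma^n,\Delta_i)/n>h_{\mu_i}(\sigma)-\varepsilon$; 3. for any $\nu_i\in\mathcal M(\sigma,\Lambda_i)$ and any $1\le j\le k$, $\left|\int\varphi_j\,d\mu_i-\int\varphi_j\,d\nu_i\right|<\varepsilon$; and for any $\nu\in\mathcal M(\sigma,\Lambda)$ there exists $\mu$ in the convex hull of $\{\mu_i\}_{i=1}^m$ such that $\left|\int\varphi_j\,d\mu-\int\varphi_j\,d\nu\right|<\varepsilon$ for all $1\le j\le k$; 4. for any $z\in\Lambda_i$ or $z\in\Lambda$ there exists $1\le j\le n$ such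 that $\sigma^{j+tn}z\in B(x,\varepsilon)$ for every $t\in\mathbb N$.
   Context: $\mathbb N=\{0,1,2,\dots\}$, $\mathbb N^+=\{1,2,\dots\}$. Let $M$ be an $\mathbb N\times\mathbb N$ matrix with entries in $\{0,1\}$. The one-sided countable Markov shift is $\Sigma=\{(x_0x_1\dots)\in\mathbb N^{\mathbb N}:M(x_i,x_{i+1})=1\ \forall i\in\mathbb N\}$ with the shift $(\sigma x)_i=x_{i+1}$ and metric $d(x,y)=2^{-\min\{i:x_i\ne y_i\}}$ for $x\ne y$; the two-sided one is defined analogously in $\mathbb N^{\mathbb Z}$ with $d(x,y)=2^{-\min\{|i|:x_i\ne y_i\}}$. A word $w_0\dots w_{N-1}$ is admissible if $M(w_i,w_{i+1})=1$ for $0\le i\le N-2$. $(\Sigma,\sigma)$ is *topologically transitive* if for all $a,b\in\mathbb N$ there is an admissible word with first letter $a$ and last letter $b$; it is *non-trivial* if $\Sigma$ is not a single periodic orbit. $\mathcal M(\sigma,Y)$ is the set of $\sigma$-invariant Borel probability measures supported on $Y$. $h_\mu(\sigma)$ is the metric entropy (supremum of $h_\mu(\sigma,\xi)$ over countable measurable partitions $\xi$ with $H_\mu(\xi)<\infty$); $h_{\mathrm{top}}$ of a compact invariant set is the usual topological entropy. A full shift is the shift on all (one- or two-sided) sequences over a finite nonempty alphabet. *)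

(* Defs.v *)
From HB Require Import structures.
From mathcomp Require Import all_boot all_order all_algebra finmap.
From mathcomp Require Import all_classical all_reals all_analysis.

Set Implicit Arguments.
Unset Strict Implicit.
Unset Printing Implicit Defensive.

Import Order.TTheory GRing.Theory Num.Theory.
Import numFieldNormedType.Exports.

Local Open Scope classical_set_scope.
Local Open Scope ring_scope.

Variant sidedness := OneSided | TwoSided.

Definition site (s : sidedness) : Type :=
  match s with OneSided => nat | TwoSided => int end.

Definition site_succ (s : sidedness) : site s -> site s :=
  match s with
  | OneSided => fun i : nat => i.+1
  | TwoSided => fun i : int => i + 1
  end.

Definition site_abs (s : sidedness) : site s -> nat :=
  match s with
  | OneSided => fun i : nat => i
  | TwoSided => fun i : int => `|i|%N
  end.

(* The real field R is only there to type the metric. *)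
Definition sequence_space (R : realType) (s : sidedness) (T : Type) : Type :=
  site s -> T.

Section sequences_metric.
Context {R : realType} {s : sidedness} {T : Type}.
Local Notation X := (sequence_space R s T).
Implicit Types x y z : X.

Definition differ_at x y (k : nat) : bool :=
  `[< exists2 i : site s, site_abs i = k & x i <> y i >].

(* 2 ^ - min {|i| : x_i <> y_i}, and 0 when x = y *)
Definition seq_dist x y : R :=
  if pselect (exists k, differ_at x y k) is left h then 2 ^- ex_minn h else 0.

Let seq_dist_ge0 x y : 0 <= seq_dist x y.
Proof.
by rewrite /seq_dist; case: pselect => // h; rewrite invr_ge0 exprn_ge0.
Qed.

Let differ_at_dist x y k : differ_at x y k -> 2 ^- k <= seq_dist x y.
Proof.
move=> xyk; rewrite /seq_dist; case: pselect => [h|h]; last first.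
  by exfalso; apply: h; exists k.
case: ex_minnP => j _ jmin; have jk := jmin _ xyk.
by rewrite lef_pV2 ?posrE ?exprn_gt0// ler_weXn2l// ler1n.
Qed.

Let differ_at_sym x y k : differ_at x y k = differ_at y x k.
Proof. by apply/asboolP/asboolP => -[i ik xyi]; exists i => // /esym. Qed.

Let seq_dist_xx x : seq_dist x x = 0.
Proof.
rewrite /seq_dist; case: pselect => // h; exfalso.
by case: h => k /asboolP[i _].
Qed.

Let seq_dist_eq0 x y : seq_dist x y = 0 -> x = y.
Proof.
move=> xy0; apply: contrapT => xy.
have [i xyi] : exists i, x i <> y i.
  by apply/existsNP => xy'; apply: xy; exact/funext.
have /differ_at_dist : differ_at x y (site_abs i) by apply/asboolP; exists i.
by rewrite xy0 leNgt invr_gt0 exprn_gt0.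
Qed.

Let seq_dist_sym x y : seq_dist x y = seq_dist y x.
Proof.
rewrite /seq_dist (_ : differ_at x y = differ_at y x)//.
by apply/funext => k; exact: differ_at_sym.
Qed.

Let seq_dist_triangle y x z : seq_dist x z <= seq_dist x y + seq_dist y z.
Proof.
rewrite {1}/seq_dist; case: pselect => [h|_]; last by rewrite addr_ge0.
case: ex_minnP => k /asboolP[i ik xzi] _.
have [xyi|xyi] := pselect (x i = y i).
  rewrite (le_trans (differ_at_dist (x := y) (y := z) (k := k) _)) ?lerDr//.
  by apply/asboolP; exists i => //; rewrite -xyi.
rewrite (le_trans (differ_at_dist (x := x) (y := y) (k := k) _)) ?lerDl//.
by apply/asboolP; exists i.
Qed.

HB.instance Definition _ := gen_eqMixin X.
HB.instance Definition _ := gen_choiceMixin X.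
HB.instance Definition _ := isMetric.Build R X
  seq_dist_xx seq_dist_eq0 seq_dist_sym seq_dist_triangle.

Definition shift_map x : X := fun i => x (site_succ i).

End sequences_metric.

HB.instance Definition _ (R : realType) (s : sidedness) (T : pointedType) :=
  isPointed.Build (sequence_space R s T) (fun=> point).

HB.instance Definition _ (R : realType) (s : sidedness) (T : pointedType) :=
  Measurable.copy (sequence_space R s T)
    (g_sigma_algebraType (@open (sequence_space R s T))).

Section markov_shift.
Context (R : realType) (s : sidedness).

(* A 0-1 matrix is a boolean relation; Sigma is kept as a subset of the space
   of all sequences of natural numbers, on which shift_map is total. Borel
   probability measures on a Borel subset Y are accordingly those on the whole
   space that give Y mass 1. *)
Definition markov_shift (M : rel nat) : set (sequence_space R s nat) :=
  [set x | forall i, M (x i) (x (site_succ i))].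

Definition admissible (M : rel nat) (w : seq nat) : bool := sorted M w.

Definition topologically_transitive (M : rel nat) : Prop :=
  forall a b : nat, exists w : seq nat, admissible M (a :: w) /\ last a w = b.

Definition periodic_orbit (O : set (sequence_space R s nat)) : Prop :=
  exists x, exists2 p : nat, (0 < p)%N &
    iter p shift_map x = x /\ O = [set iter j shift_map x | j in [set: nat]].

Definition nontrivial_shift (M : rel nat) : Prop :=
  ~ periodic_orbit (markov_shift M).

End markov_shift.

Arguments markov_shift R s M : clear implicits.

Section measure_dynamics.
Context d (T : measurableType d) (R : realType).
Implicit Types (f : T -> T) (mu : probability T R).
Local Open Scope ereal_scope.

Definition invariant_probabilities f (Y : set T) : set (probability T R) :=
  [set mu | mu Y = 1 /\
    forall A, measurable A -> mu (f @^-1` A) = mu A].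

Definition measure_convex_hull (m : nat) (mu : 'I_m -> probability T R) :
    set (probability T R) :=
  [set nu | exists p : 'I_m -> R,
    [/\ forall i, (0 <= p i)%R, (\sum_(i < m) p i = 1)%R &
        forall A, measurable A -> nu A = \sum_(i < m) (p i)%:E * mu i A]].

(* Cells may be empty, so finite partitions are covered as well. *)
Definition measurable_partition (xi : nat -> set T) : Prop :=
  [/\ forall i, measurable (xi i), trivIset setT xi & \bigcup_i xi i = setT].

(* ln 0 = 0, hence null cells do not contribute. *)
Definition partition_entropy mu (I : choiceType) (xi : I -> set T) : \bar R :=
  \esum_(i in [set: I]) (- (fine (mu (xi i)) * ln (fine (mu (xi i)))))%:E.

(* The cells of the join of f^-i xi for 0 <= i < n, indexed by their words. *)
Definition join_partition f (xi : nat -> set T) (n : nat)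
    (w : {ffun 'I_n -> nat}) : set T :=
  [set y | forall i : 'I_n, xi (w i) (iter i f y)].

Definition entropy_wrt f mu (xi : nat -> set T) : \bar R :=
  limn (fun n =>
    (n%:R^-1)%:E * partition_entropy mu (join_partition f xi (n := n))).

Definition metric_entropy f mu : \bar R :=
  ereal_sup [set entropy_wrt f mu xi | xi in
    [set xi | measurable_partition xi /\ partition_entropy mu xi < +oo]].

End measure_dynamics.

Section topological_dynamics.
Context (R : realType).

Definition bowen_separated (X : metricType R) (f : X -> X) (n : nat) (e : R)
    (E : {fset X}) : Prop :=
  forall y z, y \in E -> z \in E -> y != z ->
    exists2 i : nat, (i < n)%N & e < mdist (iter i f y) (iter i f z).

Definition max_separated (X : metricType R) (f : X -> X) (K : set X)
    (n : nat) (e : R) : \bar R :=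
  ereal_sup [set (#|` E|%:R)%:E | E in
    [set E : {fset X} | [set` E] `<=` K /\ bowen_separated f n e E]].

(* Bowen's formula; the limit in e is monotone. An empty K has entropy -oo. *)
Definition top_entropy (X : metricType R) (f : X -> X) (K : set X) : \bar R :=
  lim (limn_esup (fun n => (n%:R^-1)%:E * lne (max_separated f K n e))%E
    @[e --> 0^'+]).

Definition topologically_conjugate (X Y : topologicalType)
    (A : set X) (f : X -> X) (B : set Y) (g : Y -> Y) : Prop :=
  exists (h : X -> Y) (h' : Y -> X),
    [/\ {within A, continuous h}, {within B, continuous h'},
        forall y, A y -> B (h y) /\ h' (h y) = y,
        forall z, B z -> A (h' z) /\ h (h' z) = z &
        forall y, A y -> h (f y) = g (h y)].

Definition conjugate_to_full_shift (s : sidedness) (X : topologicalType)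
    (A : set X) (f : X -> X) : Prop :=
  exists2 Q : finType, (0 < #|Q|)%N &
    topologically_conjugate A f [set: sequence_space R s Q] shift_map.

(* If (A, f) is conjugate to a full shift, which is onto, then f @` A = A. *)
Definition forward_invariant (X : Type) (f : X -> X) (A : set X) : Prop :=
  f @` A `<=` A.

Definition orbit_union (X : Type) (f : X -> X) (n : nat) (A : set X) : set X :=
  \bigcup_(j < n) (iter j f @` A).

End topological_dynamics.

(* Main.v *)
Require Import Defs.
From HB Require Import structures.
From mathcomp Require Import all_boot all_order all_algebra finmap.
From mathcomp Require Import all_classical all_reals all_analysis.
From mathcomp Require Import measurable_realfun zify ring lra.

Set Implicit Arguments.
Unset Strict Implicit.
Unset Printing Implicit Defensive.

Import Order.TTheory GRing.Theory Num.Theory.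
Import numFieldNormedType.Exports.

Local Open Scope classical_set_scope.
Local Open Scope ring_scope.

(* Proof idea. A partition of finite entropy nearly realising h_mu is read off,
   up to small probability, from finitely many coordinates. A Gibbs (coding)
   estimate then produces, for large L, a finite family of blocks of length L
   starting and ending with letters below a bound A that does not depend on L,
   with a probability law q of entropy at least about L * h_mu and with
   q-averaged Birkhoff sums about L times the integrals. By Chebyshev's
   inequality most sequences of N independent blocks have Birkhoff sums close
   to the expected value, and there are about exp (N * H q) of them. Surrounding
   each block by bridges to and from a fixed letter b turns it into a loop at b;
   by pigeonhole, sufficiently many sequences share their end letters blockwise,
   hence give loops of equal length that determine the blocks. Free
   concatenations of such loops, of a common length n and all starting with a
   marker that spells x near the origin, are the alphabets of the full shifts.
   Ergodicity is not needed: the non-ergodic behaviour of mu is recreated inside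
   every single word by the independent concatenation. *)

(** * Sites, windows and the topology of sequence spaces *)

(** The infinite alphabet shapes the argument in two ways. There are infinitely many words of each
    length, so the entropy of a partition is not compared with a count of words but with the length
    of a code, where rare events may be expensive as long as the total stays summable. Moreover the
    end letters of a block are unbounded, hence so are the bridges. Bounding the two end letters by
    [A] before [L] is chosen keeps the bridge lengths and the pigeonhole factor (A + 1) ^ 2 per
    block independent of [L]; inner letters only have to stay below some [B] that may grow with [L].
    Every loss is then either a small multiple of [L] or a constant per block, and constants vanish
    against large [L]. Birkhoff sums become functions of words because uniform continuity gives one
    window radius [r] for the whole shift: only times within [r] of the ends of a word see letters
    outside it. For a measure on the orbit of the large horseshoe, the expected proportions of
    blocks of each kind in a long orbit segment are the coefficients of the convex combination. *)

Definition site_of_nat (s : sidedness) : nat -> site s :=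
  match s with OneSided => id | TwoSided => Posz end.

Definition site_add (s : sidedness) (p : site s) (t : nat) : site s :=
  iter t (@site_succ s) p.

Lemma site_of_nat_add s (j t : nat) :
  site_add (site_of_nat s j) t = site_of_nat s (j + t)%N.
Proof.
elim: t => [|t IH]; first by rewrite addn0.
rewrite /site_add iterS -/(site_add _ _) IH addnS.
by case: s {IH} => //=; lia.
Qed.

Lemma site_addE_one (p : site OneSided) t : site_add p t = (p + t)%N.
Proof.
elim: t => [|t IH]; first by rewrite addn0.
by rewrite /site_add iterS -/(site_add _ _) IH addnS.
Qed.

Lemma site_addE_two (p : site TwoSided) t : site_add p t = p + t%:Z.
Proof.
elim: t => [|t IH]; first by rewrite addr0.
by rewrite /site_add iterS -/(site_add _ _) IH /=; lia.
Qed.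

(** A shift by at least its radius moves a window around the origin to nonnegative sites. Words are
    read only there, so one argument serves both kinds of shift. *)
Lemma site_add_window s (i : site s) (r t : nat) :
  (site_abs i <= r)%N -> (r <= t)%N ->
  exists2 j, (j <= t + r)%N & site_add i t = site_of_nat s j.
Proof.
case: s i => /= i ir rt.
  by exists (i + t)%N; [lia | rewrite site_addE_one].
by exists (absz (i + t%:Z)); [lia | rewrite site_addE_two /=; lia].
Qed.

Lemma site_window_finite s (k : nat) :
  exists (g : nat -> site s) (n : nat), forall i : site s, (site_abs i <= k)%N ->
    exists2 j, (j < n)%N & g j = i.
Proof.
case: s; first by exists id, k.+1 => i ik; exists i.
exists (fun j => j%:Z - k%:Z : site TwoSided), (k + k).+1 => /= i ik.
by exists (absz (i + k%:Z)); lia.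
Qed.

Section sequence_topology.
Context {R : realType} {s : sidedness} {T : Type}.
Local Notation X := (sequence_space R s T).
Implicit Types x y z : X.

(** These relations are the open balls of radius 2 ^- k, see [agree_dist]; topological arguments
    below are made with windows instead of distances. *)
Definition agree (k : nat) (y z : X) : Prop :=
  forall i : site s, (site_abs i <= k)%N -> y i = z i.

Lemma agree_refl k y : agree k y y. Proof. by []. Qed.

Lemma agree_sym k y z : agree k y z -> agree k z y.
Proof. by move=> yz i /yz. Qed.

Lemma agree_trans k y x z : agree k x y -> agree k y z -> agree k x z.
Proof. by move=> xy yz i ik; rewrite xy// yz. Qed.

Lemma agree_le k l y z : (l <= k)%N -> agree k y z -> agree l y z.
Proof. by move=> lk yz i il; apply: yz; exact: leq_trans lk. Qed.

Lemma iter_shiftE t y : iter t shift_map y = fun p => y (site_add p t).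
Proof.
elim: t => [//|t IH]; apply/funext => p.
by rewrite iterS IH /shift_map /site_add iterSr.
Qed.

Lemma agree_dist k y z : agree k y z <-> mdist y z < 2 ^- k.
Proof.
have E j l : (l < j)%N = (2 ^- j < 2 ^- l :> R).
  by rewrite ltf_pV2 ?posrE ?exprn_gt0// ltr_eXn2l// ltr1n.
change (agree k y z <-> seq_dist y z < 2 ^- k).
rewrite /seq_dist; case: pselect => [h|h]; last first.
  split=> [_|_ i ik]; first by rewrite invr_gt0 exprn_gt0.
  apply: contrapT => yzi; apply: h; exists (site_abs i).
  by apply/asboolP; exists i.
case: ex_minnP => j /asboolP[i ij yzi] jmin; rewrite -E; split.
  by move=> yz; rewrite ltnNge; apply/negP => jk; apply: yzi; apply: yz; rewrite ij.
move=> kj l lk; apply: contrapT => yzl.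
have : differ_at y z (site_abs l) by apply/asboolP; exists l.
by move=> /jmin; lia.
Qed.

Lemma mdist_ge_disagree (i : site s) y z : y i <> z i -> 2 ^- (site_abs i) <= mdist y z.
Proof. by move=> yzi; rewrite leNgt; apply/negP => /agree_dist/(_ i (leqnn _)). Qed.

Lemma exp2_small (e : R) : 0 < e -> exists k : nat, 2 ^- k < e.
Proof.
move=> e0; have [k ke] : exists k : nat, e^-1 < k%:R.
  by exists (Num.truncn e^-1).+1; rewrite truncnS_gt.
exists k; rewrite -[e]invrK ltf_pV2 ?posrE ?exprn_gt0 ?invr_gt0//.
by rewrite (lt_trans ke)// -natrX ltr_nat ltn_expl.
Qed.

Lemma nbhs_agreeP y (U : set X) : nbhs y U <-> exists k, agree k y `<=` U.
Proof.
split=> [/nbhs_ballP[e /= /exp2_small[k ke] yU]|[k yU]].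
  exists k => z /agree_dist yz; apply: yU; rewrite ballEmdist/=.
  exact: lt_trans ke.
apply/nbhs_ballP; exists (2 ^- k) => /=; first by rewrite invr_gt0 exprn_gt0.
by move=> z; rewrite ballEmdist/= => /agree_dist; exact: yU.
Qed.

Lemma open_agreeP (U : set X) :
  open U <-> forall y, U y -> exists k, agree k y `<=` U.
Proof.
rewrite openE; split => [Uo y /Uo/nbhs_agreeP//|Uo y Uy].
by apply/nbhs_agreeP; exact: Uo.
Qed.

Lemma open_finite_window k (U : set X) :
  (forall y z, agree k y z -> U y -> U z) -> open U.
Proof. by move=> h; apply/open_agreeP => y Uy; exists k => z yz; apply: h Uy. Qed.

Lemma ball_agree y (e : R) : 0 < e -> exists k, agree k y `<=` ball y e.
Proof. by move=> e0; apply/nbhs_agreeP; exact: nbhsx_ballx. Qed.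

Lemma continuous_shift_map : continuous (@shift_map R s T).
Proof.
move=> y U /nbhs_agreeP[k kU]; apply/nbhs_agreeP; exists k.+1 => z yz.
apply: kU => i ik; apply: yz.
by case: s i ik => /= i; lia.
Qed.

Lemma continuous_iter_shift t : continuous (iter t (@shift_map R s T)).
Proof.
elim: t => [|t IH] y; first exact: cvg_id.
exact: (continuous_comp (IH y) (@continuous_shift_map _)).
Qed.

End sequence_topology.

(** Tychonoff by hand: at each site the letters come from a finite list, so an ultrafilter on [A]
    selects one of them, and the selected letters form its limit. *)
Lemma compact_finite_letters (R : realType) (s : sidedness) (T : eqType)
    (A : set (sequence_space R s T)) :
  closed A -> (forall i, exists l : seq T, forall y, A y -> y i \in l) ->
  compact A.
Proof.
move=> Acl fin; rewrite compact_ultra => F UF FA.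
have /choice[v vP] : forall i, exists a, F [set y : sequence_space R s T | y i = a].
  move=> i.
  have [l lP] := fin i.
  apply: contrapT => nF.
  have : F [set y : sequence_space R s T | y i \in l] by apply: filterS FA => y; exact: lP.
  elim: l {lP} => [|a l IH] Fl.
    by apply: (@filter_not_empty _ F _); apply: filterS Fl => y.
  have [//|Fna] := in_ultra_setVsetC [set y : sequence_space R s T | y i = a] UF.
    by move=> Fa; apply: nF; exists a.
  apply: IH; apply: filterS (filterI Fl Fna) => y /= [].
  by rewrite inE => /orP[/eqP ->|].
pose v' : sequence_space R s T := v.
have Fv : F --> v'.
  move=> U /nbhs_agreeP[k kU].
  have [g [n gP]] := site_window_finite s k.
  have : F [set y | forall j, (j < n)%N -> y (g j) = v (g j)].
    elim: n {gP} => [|n IH]; first exact: filterS filterT.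
    apply: filterS (filterI IH (vP (g n))) => y [yn yv] j.
    by rewrite ltnS leq_eqVlt => /predU1P[->//|]; exact: yn.
  apply: filterS => y yP; apply: kU => i /gP[j jn <-].
  by rewrite yP.
exists v'; split => //; apply: Acl => U /Fv FU.
exact: filter_ex (filterI FA FU).
Qed.

(** * Means of bounded measurable functions and finite cells *)

Section bounded_measurable.
Context d (T : measurableType d) (R : realType).
Implicit Types (P : probability T R) (A B : set T) (f g : T -> R).

Definition bounded_measurable f : Prop :=
  measurable_fun setT f /\ exists C, forall y, `|f y| <= C.

Lemma bounded_measurable_cst (c : R) : bounded_measurable (cst c).
Proof. by split; [exact: measurable_cst | exists `|c|]. Qed.

Lemma bounded_measurable_indic A : measurable A -> bounded_measurable (\1_A).
Proof.
move=> mA; split; first exact: measurable_indic.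
by exists 1 => y; rewrite indicE; case: (_ \in _); rewrite ?normr1 ?normr0.
Qed.

Lemma bounded_measurableD f g : bounded_measurable f -> bounded_measurable g ->
  bounded_measurable (fun y => f y + g y).
Proof.
move=> [mf [C fC]] [mg [D gD]]; split; first exact: measurable_funD.
by exists (C + D) => y; rewrite (le_trans (ler_normD _ _))// lerD.
Qed.

Lemma bounded_measurableZ (c : R) f : bounded_measurable f ->
  bounded_measurable (fun y => c * f y).
Proof.
move=> [mf [C fC]]; split; first exact: measurable_funM.
by exists (`|c| * C) => y; rewrite normrM ler_wpM2l.
Qed.

Lemma bounded_measurable_sum (I : Type) (r : seq I) (h : I -> T -> R) :
  (forall i, bounded_measurable (h i)) ->
  bounded_measurable (fun y => \sum_(i <- r) h i y).
Proof.
move=> hb; elim: r => [|i r IH].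
  by under eq_fun do rewrite big_nil; exact: bounded_measurable_cst.
by under eq_fun do rewrite big_cons; exact: bounded_measurableD.
Qed.

Lemma bounded_measurable_comp (t : T -> T) f : measurable_fun setT t ->
  bounded_measurable f -> bounded_measurable (f \o t).
Proof.
move=> mt [mf [C fC]]; split; first exact: measurableT_comp.
by exists C => y; exact: fC.
Qed.

Variable P : probability T R.

Definition mean f : R := Rintegral P setT f.

Definition pr A : R := fine (P A).

Lemma bounded_measurable_integrable f : bounded_measurable f ->
  P.-integrable setT (EFin \o f).
Proof.
move=> [mf [C fC]]; apply: measurable_bounded_integrable => //.
  exact: le_lt_trans (probability_le1 P measurableT) (ltry _).
exists C; split; first exact: num_real.
by move=> M CM y _; exact: le_trans (fC y) (ltW CM).
Qed.

Lemma meanD f g : bounded_measurable f -> bounded_measurable g ->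
  mean (fun y => f y + g y) = mean f + mean g.
Proof.
by move=> bf bg; rewrite /mean RintegralD//; exact: bounded_measurable_integrable.
Qed.

Lemma meanZ (c : R) f : bounded_measurable f -> mean (fun y => c * f y) = c * mean f.
Proof.
by move=> bf; rewrite /mean RintegralZl//; exact: bounded_measurable_integrable.
Qed.

Lemma mean_cst (c : R) : mean (fun=> c) = c.
Proof.
rewrite /mean Rintegral_cst// -[RHS]mulr1; congr *%R.
exact: (congr1 fine (probability_setT P)).
Qed.

Lemma mean_sum (I : Type) (r : seq I) (h : I -> T -> R) :
  (forall i, bounded_measurable (h i)) ->
  mean (fun y => \sum_(i <- r) h i y) = \sum_(i <- r) mean (h i).
Proof.
move=> hb; elim: r => [|i r IH].
  by under eq_fun do rewrite big_nil; rewrite mean_cst big_nil.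
under eq_fun do rewrite big_cons.
by rewrite meanD ?IH ?big_cons//; exact: bounded_measurable_sum.
Qed.

Lemma le_mean f g : bounded_measurable f -> bounded_measurable g ->
  (forall y, f y <= g y) -> mean f <= mean g.
Proof.
move=> bf bg fg; apply: le_Rintegral => //; exact: bounded_measurable_integrable.
Qed.

Lemma mean_norm_le f (C : R) : bounded_measurable f -> (forall y, `|f y| <= C) ->
  `|mean f| <= C.
Proof.
move=> bf fC; rewrite ler_norml; apply/andP; split.
  rewrite -[leLHS]mean_cst; apply: le_mean => //; first exact: bounded_measurable_cst.
  by move=> y; have := fC y; rewrite ler_norml => /andP[].
rewrite -[leRHS]mean_cst; apply: le_mean => //; first exact: bounded_measurable_cst.
by move=> y; have := fC y; rewrite ler_norml => /andP[].
Qed.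

Lemma mean_indic A : measurable A -> mean (\1_A) = pr A.
Proof. by move=> mA; rewrite /mean /Rintegral integral_indic// setIT. Qed.

Lemma prE A : measurable A -> P A = (pr A)%:E.
Proof. by move=> mA; rewrite /pr fineK// fin_num_measure. Qed.

Lemma pr_ge0 A : 0 <= pr A.
Proof. by rewrite /pr fine_ge0. Qed.

Lemma pr_le A B : measurable A -> measurable B -> A `<=` B -> pr A <= pr B.
Proof.
by move=> mA mB AB; rewrite -lee_fin -!prE// le_measure// inE.
Qed.

Lemma pr_setT : pr setT = 1.
Proof. exact: (congr1 fine (probability_setT P)). Qed.

Lemma pr_le1 A : measurable A -> pr A <= 1.
Proof. by move=> mA; rewrite -pr_setT pr_le. Qed.

Lemma pr_setC A : measurable A -> pr (~` A) = 1 - pr A.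
Proof.
move=> mA; apply: EFin_inj; rewrite -prE; last exact: measurableC.
by rewrite probability_setC// prE.
Qed.

Lemma pr_le_sum (I : finType) (A : I -> set T) B : measurable B ->
  (forall i, measurable (A i)) -> (forall y, B y -> exists i, A i y) ->
  pr B <= \sum_i pr (A i).
Proof.
move=> mB mA BA; rewrite -mean_indic//.
under eq_bigr do rewrite -mean_indic//.
have bA i : bounded_measurable (\1_(A i)) by exact: bounded_measurable_indic.
rewrite -mean_sum//; apply: le_mean => //; first exact: bounded_measurable_indic.
  exact: bounded_measurable_sum.
move=> y; rewrite indicE; have [|_] := boolP (y \in B); last first.
  by apply: sumr_ge0 => i _; rewrite indicE.
rewrite inE => /BA[i Ai]; rewrite (bigD1 i)//= indicE mem_set// lerDl.
by apply: sumr_ge0 => j _; rewrite indicE.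
Qed.

Section cells.
Variables (V : finType) (cell : T -> V).
Hypothesis mcell : forall v, measurable (cell @^-1` [set v]).

Lemma pr_cells A : measurable A -> pr A = \sum_v pr (A `&` cell @^-1` [set v]).
Proof.
move=> mA; have mAv v : measurable (A `&` cell @^-1` [set v]) by exact: measurableI.
rewrite -mean_indic//.
under eq_bigr do rewrite -mean_indic//.
rewrite -mean_sum; last by move=> v; exact: bounded_measurable_indic.
congr mean; apply/funext => y; rewrite (bigD1 (cell y))//= big1 ?addr0.
  by rewrite !indicE in_setI [X in _ && X]mem_set ?andbT.
move=> v vy; rewrite indicE in_setI [X in _ && X]memNset ?andbF//=.
by move=> /eqP; rewrite eq_sym; exact/negP.
Qed.

Lemma mean_cell (c : V -> R) :
  bounded_measurable (c \o cell) /\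
  mean (c \o cell) = \sum_v pr (cell @^-1` [set v]) * c v.
Proof.
have E : c \o cell = fun y => \sum_v c v * \1_(cell @^-1` [set v]) y.
  apply/funext => y /=; rewrite (bigD1 (cell y))//= big1 ?addr0.
    by rewrite indicE mem_set ?mulr1.
  move=> v vy; rewrite indicE memNset ?mulr0//=.
  by move=> /eqP; rewrite eq_sym; exact/negP.
have h v : bounded_measurable (\1_(cell @^-1` [set v])) by exact: bounded_measurable_indic.
rewrite E; split.
  by apply: bounded_measurable_sum => v; exact: bounded_measurableZ.
rewrite mean_sum => [|v]; last exact: bounded_measurableZ.
by apply: eq_bigr => v _; rewrite meanZ// mean_indic// mulrC.
Qed.

(** The error [tau] varies with the cell, so that cells of small probability may carry a crude
    bound. *)
Lemma mean_cell_approx f (g tau : V -> R) : bounded_measurable f ->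
  (forall y, `|f y - g (cell y)| <= tau (cell y)) ->
  `|mean f - \sum_v pr (cell @^-1` [set v]) * g v|
    <= \sum_v pr (cell @^-1` [set v]) * tau v.
Proof.
move=> bf fg.
have [bg <-] := mean_cell g; have [bt <-] := mean_cell tau.
have bng : bounded_measurable (fun y => -1 * (g \o cell) y) by exact: bounded_measurableZ.
have -> : mean f - mean (g \o cell) = mean (fun y => f y + -1 * (g \o cell) y).
  by rewrite meanD// meanZ// mulN1r.
have bd := bounded_measurableD bf bng.
rewrite ler_norml; apply/andP; split.
  have -> : - mean (tau \o cell) = mean (fun y => -1 * (tau \o cell) y).
    by rewrite meanZ// mulN1r.
  apply: le_mean => //; first exact: bounded_measurableZ.
  by move=> y /=; have := fg y; rewrite ler_norml mulN1r mulN1r => /andP[].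
apply: le_mean => // y /=.
by have := fg y; rewrite ler_norml mulN1r => /andP[].
Qed.

End cells.

(** Overlapping sets are made disjoint by taking the first index in the enumeration of [I]. The last
    clause transfers locality: if the sets depend on a window, so does [cell]. *)
Lemma finite_cells (I : finType) (G : I -> set T) : (forall i, measurable (G i)) ->
  exists cell : T -> option I,
  [/\ forall v, measurable (cell @^-1` [set v]),
      forall y i, cell y = Some i -> G i y,
      forall y i, cell y = None -> ~ G i y &
      forall y z, (forall i, G i y <-> G i z) -> cell y = cell z].
Proof.
move=> mG; pose gb i y := `[< G i y >].
pose first i y := gb i y && [forall j : I, (enum_rank j < enum_rank i)%N ==> ~~ gb j y].
exists (fun y => [pick i | first i y]); split.
- have mD i : measurable [set y | first i y].
    rewrite (_ : [set y | first i y] = G i `&`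
        \bigcap_(j in [set j | (enum_rank j < enum_rank i)%N]) ~` G j).
      apply: measurableI => //; apply: fin_bigcap_measurable => [|j _].
        exact: finite_finset.
      exact: measurableC.
    apply/seteqP; split => [y /andP[/asboolP Gi /forallP no]|y [Gi no]] /=.
      split=> // j /= ji Gj; have := no j; rewrite ji/=.
      by move=> /asboolP.
    apply/andP; split; first exact/asboolP.
    by apply/forallP => j; apply/implyP => /no; move/asboolPn.
  move=> [i|].
    rewrite (_ : _ @^-1` _ = [set y | first i y])//.
    apply/seteqP; split=> y /=; first by case: pickP => // j fj [<-].
    case: pickP => [j /andP[gj /forallP jmin] /andP[gi /forallP imin]|->//].
    congr Some; apply: enum_rank_inj; apply: val_inj; apply/eqP.
    have := jmin i; have := imin j; rewrite gi gj /= !implybF -!leqNgt eqn_leq.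
    by move=> -> ->.
  rewrite (_ : _ @^-1` _ = \bigcap_i ~` [set y | first i y]).
    by apply: fin_bigcap_measurable => [|i _]; [exact: finite_finset|exact: measurableC].
  apply/seteqP; split=> y /=.
    by case: pickP => // no _ i _; rewrite /= no.
  by move=> no; case: pickP => // i fi; have := no i Logic.I; rewrite /= fi.
- by move=> y i; case: pickP => // j /andP[/asboolP Gj _] [<-].
- move=> y i; case: pickP => // no _ Gi.
  have gi : gb i y by apply/asboolP.
  have [j gj jmin] := @arg_minnP I i (gb^~ y) (fun i => nat_of_ord (enum_rank i)) gi.
  have := no j; rewrite /first gj/= => /negbT/negP; apply.
  apply/forallP => l; apply/implyP => lj; apply/negP => gl.
  by have := jmin _ gl; rewrite leqNgt lj.
- move=> y z yz; have gyz i : gb i y = gb i z by apply/asboolP/asboolP => /yz.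
  apply: eq_pick => i; rewrite /first gyz; congr andb.
  by apply: eq_forallb => j; rewrite gyz.
Qed.

End bounded_measurable.

(** * Typical sequences of independent blocks *)

Section typical_sequences.
Context (R : realType) (F : finType) (q : F -> R).
Hypotheses (q_ge0 : forall u, 0 <= q u) (q_sum1 : \sum_u q u = 1).

Let Q N (w : {ffun 'I_N -> F}) : R := \prod_i q (w i).

Let Q_ge0 N (w : {ffun 'I_N -> F}) : 0 <= Q w.
Proof. exact: prodr_ge0. Qed.

Let Q_sum1 N : \sum_(w : {ffun 'I_N -> F}) Q w = 1.
Proof.
rewrite -(bigA_distr_bigA (fun _ : 'I_N => q)) big1// => i _.
Qed.

Lemma second_moment (N : nat) (f : F -> R) : \sum_u q u * f u = 0 ->
  \sum_(w : {ffun 'I_N -> F}) Q w * (\sum_i f (w i)) ^+ 2 =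
  N%:R * \sum_u q u * f u ^+ 2.
Proof.
move=> f0.
have E (a b : 'I_N) : \sum_(w : {ffun 'I_N -> F}) Q w * (f (w a) * f (w b)) =
    if a == b then \sum_u q u * f u ^+ 2 else 0.
  (* The product of two values of [f] is spread over all coordinates, so that the sum over [w]
     factors; off the diagonal the factor at [a] is the mean of [f], which is 0. *)
  pose h (i : 'I_N) u := q u * ((if i == a then f u else 1) * (if i == b then f u else 1)).
  transitivity (\sum_(w : {ffun 'I_N -> F}) \prod_i h i (w i)).
    apply: eq_bigr => w _; rewrite !big_split/=; congr (_ * (_ * _)).
      by rewrite -big_mkcond/= big_pred1_eq.
    by rewrite -big_mkcond/= big_pred1_eq.
  rewrite -(bigA_distr_bigA h) (bigD1 a)//=.
  have [eab|ab] := eqVneq a b.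
    rewrite /h -eab.
    rewrite [X in _ * X]big1 ?mulr1 => [|i /negPf ia].
      by apply: eq_bigr => u _; rewrite /h eqxx expr2.
    by under eq_bigr do rewrite /h ia !mulr1.
  rewrite (eq_bigr (fun u => q u * f u)) ?f0 ?mul0r// => u _.
  by rewrite /h eqxx (negPf ab) mulr1.
transitivity (\sum_(w : {ffun 'I_N -> F}) \sum_a \sum_b Q w * (f (w a) * f (w b))).
  apply: eq_bigr => w _; rewrite expr2 mulr_suml mulr_sumr.
  apply: eq_bigr => a _.
  by rewrite mulr_sumr mulr_sumr; apply: eq_bigr => b _.
rewrite exchange_big/=; under eq_bigr => a _ do rewrite exchange_big/=.
rewrite (eq_bigr (fun=> \sum_u q u * f u ^+ 2)) => [|a _]; last first.
  under eq_bigr => b _ do rewrite E.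
  by rewrite -big_mkcond/= (big_pred1 a)// => b; rewrite /= eq_sym.
by rewrite sumr_const card_ord mulr_natl.
Qed.

Let avg (f : F -> R) := \sum_u q u * f u.

(** Cleared of denominators, so that N = 0 is covered. *)
Lemma chebyshev_ffun (N : nat) (f : F -> R) (e : R) : 0 < e ->
  (\sum_(w : {ffun 'I_N -> F} | N%:R * e < `|\sum_i f (w i) - N%:R * avg f|) Q w)
    * (N%:R * e ^+ 2) <= \sum_u q u * (f u - avg f) ^+ 2.
Proof.
move=> e0; case: N => [|N].
  by rewrite !(mul0r, mulr0) sumr_ge0// => u _; rewrite mulr_ge0// sqr_ge0.
set g := fun u => f u - avg f.
have g0 : \sum_u q u * g u = 0.
  under eq_bigr do rewrite mulrBr; rewrite big_split/= -/(avg f) sumrN -mulr_suml q_sum1.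
  by rewrite mul1r subrr.
have N0 : 0 < N.+1%:R :> R by [].
rewrite -(ler_pM2l N0) -(second_moment N.+1 g0) mulrC -mulrA mulr_suml.
rewrite [leRHS](bigID (fun w : {ffun 'I_N.+1 -> F} =>
  N.+1%:R * e < `|\sum_i f (w i) - N.+1%:R * avg f|))/=.
rewrite -[leLHS]addr0 lerD//; last by apply: sumr_ge0 => w _; rewrite mulr_ge0// sqr_ge0.
apply: ler_sum => w wbad; rewrite ler_wpM2l//.
have -> : \sum_i g (w i) = \sum_i f (w i) - N.+1%:R * avg f.
  by rewrite /g big_split/= sumrN sumr_const card_ord mulr_natl.
rewrite -[leRHS]real_normK ?num_real//.
have -> : N.+1%:R * e ^+ 2 * N.+1%:R = (N.+1%:R * e) ^+ 2 by ring.
by rewrite ler_pXn2r ?nnegrE ?(ltW wbad)// mulr_ge0// ltW.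
Qed.

(** Asymptotic equipartition for a product law: the information - ln q is one more observable, with
    index [None]. Where it is typical, a sequence has mass at most exp (- N (H - e)); as the typical
    sequences carry at least half of the mass, there are at least exp (N (H - e)) / 2 of them. *)
Lemma typical_sequences (J : finType) (g : J -> F -> R) (e : R) : 0 < e ->
  exists N0, forall N, (N0 <= N)%N ->
    expR (N%:R * (\sum_u q u * - ln (q u) - e)) / 2 <=
    #|[pred w : {ffun 'I_N -> F} | [forall i, 0 < q (w i)] &&
        [forall j, `|\sum_i g j (w i) - N%:R * \sum_u q u * g j u| <= N%:R * e]]|%:R.
Proof.
move=> e0.
pose g' (o : option J) := if o is Some j then g j else fun u => - ln (q u).
pose V := \sum_o \sum_u q u * (g' o u - avg (g' o)) ^+ 2.
have V0 : 0 <= V.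
  by apply: sumr_ge0 => o _; apply: sumr_ge0 => u _; rewrite mulr_ge0// sqr_ge0.
(* [V] is the sum of all variances; beyond this threshold Chebyshev leaves at most half of the mass
   to the bad sequences. *)
exists (Num.truncn (2 * V / e ^+ 2)).+1 => N NN.
have NV : 2 * V / e ^+ 2 < N%:R.
  by rewrite (lt_le_trans (truncnS_gt _))// ler_nat.
have N0 : 0 < N%:R :> R.
  by apply: le_lt_trans NV; rewrite divr_ge0 ?sqr_ge0// mulr_ge0.
pose bad o (w : {ffun 'I_N -> F}) :=
  N%:R * e < `|\sum_i g' o (w i) - N%:R * avg (g' o)|.
have badV : \sum_o \sum_(w | bad o w) Q w <= 2^-1.
  rewrite -(@ler_pM2r _ (N%:R * e ^+ 2)) ?mulr_gt0 ?exprn_gt0// mulr_suml.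
  apply: (@le_trans _ _ V); first by apply: ler_sum => o _; exact: chebyshev_ffun.
  by move: NV; rewrite ltr_pdivrMr ?exprn_gt0// => NV; lra.
pose A := [pred w : {ffun 'I_N -> F} | [forall i, 0 < q (w i)] &&
  [forall o, ~~ bad o w]].
have HA w : w \in A -> Q w <= expR (- (N%:R * (\sum_u q u * - ln (q u) - e))).
  rewrite /A inE => /andP[/forallP qw /forallP/(_ None)].
  rewrite /bad/= -leNgt ler_norml => /andP[lb _].
  have -> : Q w = expR (- \sum_i - ln (q (w i))).
    by rewrite sumrN opprK expR_sum; apply: eq_bigr => i _; rewrite lnK// posrE.
  by rewrite ler_expR lerN2 mulrBr; move: lb; rewrite lerBrDr addrC.
have QA : 2^-1 <= \sum_(w in A) Q w.
  have : 1 <= \sum_(w in A) Q w + \sum_o \sum_(w | bad o w) Q w.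
    rewrite -(Q_sum1 N) (bigID (fun w => w \in A))/= lerD2l.
    under [leRHS]eq_bigr do rewrite big_mkcond/=.
    rewrite exchange_big/= big_mkcond/=; apply: ler_sum => w _.
    have s0 : 0 <= \sum_o (if bad o w then Q w else 0).
      by apply: sumr_ge0 => o _; case: ifP.
    (* Outside [A], a sequence either uses a letter of probability 0 and has no mass, or is bad for
       some observable and is counted in the second sum. *)
    case: ifPn => //; rewrite /A inE negb_and => /orP[|] /forallPn[/= i].
      rewrite lt_neqAle q_ge0 andbT negbK => /eqP qi.
      have Qw0 : Q w = 0 by rewrite /Q (bigD1 i)//= -qi mul0r.
      by rewrite {1}Qw0.
    rewrite negbK => bi; rewrite (bigD1 i)//= bi lerDl.
    by apply: sumr_ge0 => o _; case: ifP.
  by move: badV; lra.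
set H := N%:R * _ in HA *.
have AA : #|A|%:R <= #|[pred w : {ffun 'I_N -> F} | [forall i, 0 < q (w i)] &&
        [forall j, `|\sum_i g j (w i) - N%:R * avg (g j)| <= N%:R * e]]|%:R :> R.
  rewrite ler_nat subset_leq_card//; apply/fintype.subsetP => w; rewrite /A !inE.
  case/andP => -> /forallP gb /=; apply/forallP => j.
  by have := gb (Some j); rewrite /bad -leNgt.
apply: le_trans AA.
rewrite -(@ler_pM2r _ (expR (- H))) ?expR_gt0// mulrAC -expRD subrr expR0 mul1r.
apply: (le_trans QA); rewrite (le_trans (ler_sum _ HA))//.
by rewrite sumr_const mulr_natl.
Qed.

End typical_sequences.

(** * Bounding partition entropy by a code *)

(** A finite partial sum involves finitely many words, hence only letters up to some [B]; a bound
    uniform in [B] therefore bounds the infinite sum. *)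
Lemma esum_ffun_le (R : realType) (n : nat) (g : {ffun 'I_n -> nat} -> R) (C : R) :
  (forall w, 0 <= g w) ->
  (forall B, \sum_(u : {ffun 'I_n -> 'I_B.+1}) g [ffun i => val (u i)] <= C) ->
  (\esum_(w in [set: {ffun 'I_n -> nat}]) (g w)%:E <= C%:E)%E.
Proof.
move=> g0 gC; apply: ge_ereal_sup => _ [A [finA _] <-].
rewrite fsbig_finite// sumEFin lee_fin.
pose B := (\max_(w <- fset_set A) \max_i w i)%N.
pose up (u : {ffun 'I_n -> 'I_B.+1}) := [ffun i => val (u i)] : {ffun 'I_n -> nat}.
pose down (w : {ffun 'I_n -> nat}) := [ffun i => inord (w i)] : {ffun 'I_n -> 'I_B.+1}.
have downK : {in fset_set A, cancel down up}.
  move=> w wA; apply/ffunP => i; rewrite !ffunE /= inordK// ltnS.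
  rewrite (leq_trans (leq_bigmax i))// /B.
  by rewrite (leq_bigmax_seq (F := fun w : {ffun 'I_n -> nat} => \max_i w i)%N _ wA).
apply: le_trans (gC B).
rewrite (eq_big_seq (fun w => g (up (down w)))) => [|w wA]; last by rewrite downK.
rewrite -(big_map down xpredT (fun u => g (up u))) big_uniq/=; last first.
  by rewrite map_inj_in_uniq ?fset_uniq//; exact: can_in_inj downK.
by rewrite big_mkcond/=; apply: ler_sum => u _; case: ifP.
Qed.

Lemma ln_le_sub1 (R : realType) (x : R) : 0 < x -> ln x <= x - 1.
Proof.
by move=> x0; have := expR_ge1Dx (ln x); rewrite lnK ?posrE// => h; lra.
Qed.

(* [ln (r / p) <= r / p - 1], multiplied by [p]; the junk value [ln 0 = 0] covers
   the case [p = 0]. *)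
Lemma gibbs_term (R : realType) (p r : R) : 0 <= p -> 0 <= r -> (0 < p -> 0 < r) ->
  p * - ln p <= p * - ln r + r - p.
Proof.
move=> p0 r0 pr; have [pgt|] := ltP 0 p; last first.
  by move=> ple; have -> : p = 0 by [lra]; rewrite !mul0r; lra.
have rgt := pr pgt.
have := ln_le_sub1 (divr_gt0 rgt pgt).
rewrite ln_div ?posrE// -(ler_pM2l pgt) mulrBr mulrBr mulrCA divff ?gt_eqF//.
by rewrite !mulr1 => h; lra.
Qed.

Lemma entropy_term_ge0 (R : realType) (x : R) : 0 <= x <= 1 -> 0 <= - (x * ln x).
Proof.
by move=> /andP[x0 x1]; rewrite -mulrN mulr_ge0// oppr_ge0 ln_le0.
Qed.

Section pr_disjoint.
Context d (T : measurableType d) (R : realType) (P : probability T R).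

Lemma pr_sum_le (I : finType) (Q : pred I) (A : I -> set T) (B : set T) :
  measurable B -> (forall i, measurable (A i)) ->
  (forall i, Q i -> A i `<=` B) ->
  (forall i j y, A i y -> A j y -> i = j) ->
  \sum_(i | Q i) pr P (A i) <= pr P B.
Proof.
move=> mB mA AB dA.
have bA i : bounded_measurable (\1_(A i) : T -> R) by exact: bounded_measurable_indic.
rewrite big_mkcond -mean_indic//.
have -> : \sum_i (if Q i then pr P (A i) else 0) =
    \sum_i mean P (fun y => (Q i)%:R * \1_(A i) y).
  by apply: eq_bigr => i _; rewrite meanZ// mean_indic//; case: (Q i); rewrite ?mul1r ?mul0r.
rewrite -mean_sum; last by move=> i; exact: bounded_measurableZ.
apply: le_mean; first by apply: bounded_measurable_sum => i; exact: bounded_measurableZ.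
  exact: bounded_measurable_indic.
move=> y; have [[i [Qi Ai]]|no] := pselect (exists i, Q i /\ A i y).
  rewrite (bigD1 i)//= big1 => [|j ji].
    by rewrite Qi mul1r addr0 !indicE !mem_set//; exact: AB Ai.
  rewrite indicE memNset ?mulr0// => Aj; move/eqP: ji; apply; exact: dA Aj Ai.
rewrite big1 => [|i _]; first by rewrite indicE.
case: (boolP (Q i)) => Qi; last by rewrite mul0r.
by rewrite indicE memNset ?mulr0// => Ai; apply: no; exists i.
Qed.

End pr_disjoint.

Section measure_preserving.
Context d (T : measurableType d) (R : realType) (P : probability T R) (f : T -> T).
Hypotheses (mf : measurable_fun setT f)
  (fP : forall A, measurable A -> P (f @^-1` A) = P A).

Lemma measurable_iter t : measurable_fun setT (iter t f).
Proof.
elim: t => [|t IH]; first exact: measurable_id.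
exact: (measurableT_comp mf IH).
Qed.

Lemma measurable_iter_preimage t A : measurable A -> measurable (iter t f @^-1` A).
Proof. by move=> mA; rewrite -[X in measurable X]setTI; exact: measurable_iter. Qed.

Lemma measure_iter_preimage t A : measurable A -> P (iter t f @^-1` A) = P A.
Proof.
move=> mA; elim: t => [//|t IH].
have -> : iter t.+1 f @^-1` A = f @^-1` (iter t f @^-1` A).
  by apply/seteqP; split=> y /=; rewrite -iterS iterSr.
by rewrite fP//; exact: measurable_iter_preimage.
Qed.

Lemma pr_iter_preimage t A : measurable A -> pr P (iter t f @^-1` A) = pr P A.
Proof. by move=> mA; rewrite /pr measure_iter_preimage. Qed.

Lemma measurable_join (xi : nat -> set T) n (w : {ffun 'I_n -> nat}) :
  (forall i, measurable (xi i)) -> measurable (join_partition f xi w).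
Proof.
move=> mxi; rewrite (_ : join_partition f xi w =
    \bigcap_(t in [set: 'I_n]) (iter t f @^-1` xi (w t))).
  apply: fin_bigcap_measurable => [|t _]; first exact: finite_finset.
  exact: measurable_iter_preimage.
by apply/seteqP; split=> [y yJ t _|y yJ t]; [exact: yJ|exact: (yJ t Logic.I)].
Qed.

Section entropy_code.
Variables (xi : nat -> set T) (mxi : measurable_partition xi).
Variables (n a : nat) (V W : finType) (cell : T -> V) (eta : T -> W).
Hypotheses (mcell : forall v, measurable (cell @^-1` [set v]))
  (meta : forall v, measurable (eta @^-1` [set v])).
Variable word : V -> 'I_n -> W.
Hypothesis word_cell : forall y t, word (cell y) t = eta (iter (t + a) f y).
Variables (s : V -> R) (kap : nat -> W -> R) (c0 : R).
Hypotheses (s_ge0 : forall v, 0 <= s v) (s_sum : \sum_v s v <= 1)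
  (s_gt0 : forall v, 0 < pr P (cell @^-1` [set v]) -> 0 < s v).
Hypotheses (kap_ge0 : forall b e, 0 <= kap b e)
  (kap_sum : forall B e, \sum_(b < B) kap b e <= 1)
  (kap_gt0 : forall b e, 0 < pr P (xi b `&` eta @^-1` [set e]) -> 0 < kap b e).
Hypothesis kap_cost : forall B,
  \sum_(b < B) \sum_e pr P (xi b `&` eta @^-1` [set e]) * - ln (kap b e) <= c0.

(* If [W] is told through [cell], at cost [- ln s], a guess [eta] of every letter,
   the letters themselves cost [- ln kap]. Summing [gibbs_term] over finitely many
   words against [s v * \prod_t kap (w t) (word v t)] loses at most 1. *)
Lemma entropy_code_le :
  (partition_entropy P (join_partition f xi (n := n)) <=
   (1 + \sum_v pr P (cell @^-1` [set v]) * - ln (s v) + n%:R * c0)%:E)%E.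
Proof.
have [mx tx _] := mxi.
apply: esum_ffun_le => [w|B].
  by apply: entropy_term_ge0; rewrite pr_ge0 pr_le1//; exact: measurable_join.
pose Ix : finType := ({ffun 'I_n -> 'I_B.+1} * V)%type.
(* The join is read from time [a] on, which by invariance does not change its law. The guess at time
   [t + a] may then depend on a window of radius [a] without reaching negative sites. *)
pose J (w : {ffun 'I_n -> 'I_B.+1}) := [set y | forall t, xi (w t) (iter (t + a) f y)].
pose D (i : Ix) := J i.1 `&` cell @^-1` [set i.2].
pose p i := pr P (D i).
have JE w : J w = iter a f @^-1` join_partition f xi [ffun i => val (w i)].
  by apply/seteqP; split=> y yJ t; have := yJ t; rewrite ffunE -iterD.
have mJ w : measurable (J w).
  by rewrite JE; apply: measurable_iter_preimage; exact: measurable_join.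
have mD i : measurable (D i) by exact: measurableI.
have p_ge0 i : 0 <= p i by exact: pr_ge0.
have xi_inj b c y : xi b y -> xi c y -> b = c.
  move=> yb yc; apply: (tx b c) => //; by exists y.
have D_inj i j y : D i y -> D j y -> i = j.
  case: i j => [w v] [w' v'] [yw /= <-] [yw' /= <-]; congr pair.
  apply/ffunP => t; apply: val_inj; exact: xi_inj (yw t) (yw' t).
pose r (i : Ix) := s i.2 * \prod_t kap (i.1 t) (word i.2 t).
have r_ge0 i : 0 <= r i by rewrite mulr_ge0// prodr_ge0.
have D_eta i (t : 'I_n) : D i `<=` iter (t + a) f @^-1` (xi (i.1 t) `&` eta @^-1` [set word i.2 t]).
  by move=> y [yJ /= <-]; split; [exact: yJ|rewrite /= word_cell].
have mxe b e : measurable (xi b `&` eta @^-1` [set e]) by exact: measurableI.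
have s_pos i : 0 < p i -> 0 < s i.2.
  move=> pi; apply: s_gt0; apply: (lt_le_trans pi); apply: pr_le => //.
  exact: subIsetr.
have kap_pos i (t : 'I_n) : 0 < p i -> 0 < kap (i.1 t) (word i.2 t).
  move=> pi; apply: kap_gt0; apply: (lt_le_trans pi).
  rewrite -(pr_iter_preimage (t + a))//; apply: pr_le => //.
  exact: measurable_iter_preimage.
have r_pos i : 0 < p i -> 0 < r i.
  move=> pi; rewrite mulr_gt0 ?s_pos// prodr_gt0// => t _.
  by apply: kap_pos.
have r_sum : \sum_i r i <= 1.
  rewrite -(pair_big xpredT xpredT (fun w v => r (w, v)))/= exchange_big/=.
  apply: le_trans s_sum; apply: ler_sum => v _.
  rewrite /r/= -mulr_sumr -[leRHS]mulr1 ler_wpM2l//.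
  rewrite -(bigA_distr_bigA (fun (t : 'I_n) (b : 'I_B.+1) => kap b (word v t))).
  apply: prodr_ile1 => t _; rewrite kap_sum andbT; exact: sumr_ge0.
(* Refining by [cell] can only increase entropy: each piece is smaller than the whole, so its - ln
   is larger. *)
have step1 : \sum_(u : {ffun 'I_n -> 'I_B.+1})
    - (fine (P (join_partition f xi [ffun i => val (u i)])) *
       ln (fine (P (join_partition f xi [ffun i => val (u i)])))) <=
    \sum_i p i * - ln (p i).
  rewrite -(pair_big xpredT xpredT (fun w v => p (w, v) * - ln (p (w, v))))/=.
  apply: ler_sum => w _.
  have -> : fine (P (join_partition f xi [ffun i => val (w i)])) = pr P (J w).
    by rewrite JE pr_iter_preimage//; exact: measurable_join.
  rewrite -mulrN {1}(pr_cells P mcell (mJ w)) mulr_suml; apply: ler_sum => v _.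
  have [pwv|] := ltP 0 (p (w, v)); last first.
    move=> pw0; have pE : p (w, v) = 0 by apply/eqP; rewrite eq_le pw0 p_ge0.
    by rewrite /p/D/= in pE; rewrite /p/D/= pE !mul0r.
  have pJ : p (w, v) <= pr P (J w) by apply: pr_le => //; exact: subIsetl.
  apply: ler_wpM2l; first exact: pr_ge0.
  by rewrite lerN2 ler_ln ?posrE//; exact: lt_le_trans pJ.
apply: (le_trans step1).
have step2 : \sum_i p i * - ln (p i) <=
    \sum_i (p i * - ln (s i.2) + \sum_t p i * - ln (kap (i.1 t) (word i.2 t))) + 1.
  apply: (@le_trans _ _ (\sum_i (p i * - ln (r i) + r i))).
    apply: ler_sum => i _; have := gibbs_term (p_ge0 i) (r_ge0 i) (r_pos i).
    by have := p_ge0 i; lra.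
  rewrite big_split/= lerD//; apply: ler_sum => i _.
  have [pi|pi] := ltP 0 (p i); last first.
    have -> : p i = 0 by apply/eqP; rewrite eq_le pi p_ge0.
    by rewrite !mul0r big1// ?addr0// => t _; rewrite mul0r.
  rewrite -mulr_sumr -mulrDr ler_wpM2l// /r lnM ?posrE ?s_pos//; last first.
    by rewrite prodr_gt0// => t _; exact: kap_pos.
  have -> : \prod_t kap (i.1 t) (word i.2 t) = expR (\sum_t ln (kap (i.1 t) (word i.2 t))).
    by rewrite expR_sum; apply: eq_bigr => t _; rewrite lnK// posrE kap_pos.
  by rewrite expRK opprD sumrN.
apply: (le_trans step2); rewrite addrC big_split/= -addrA lerD2l lerD//.
  rewrite -(pair_big xpredT xpredT (fun w v => p (w, v) * - ln (s v)))/= exchange_big/=.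
  apply: ler_sum => v _; rewrite -mulr_suml ler_wpM2r//.
    rewrite oppr_ge0 ln_le0//; apply: le_trans s_sum.
    by rewrite (bigD1 v)//= lerDl sumr_ge0.
  apply: (@pr_sum_le _ _ _ P _ xpredT (fun w => D (w, v))) => [//|w|w _|w w' y yw yw'].
  - exact: (mD (w, v)).
  - exact: subIsetr.
  by have [] := D_inj (w, v) (w', v) y yw yw'.
rewrite exchange_big/=.
apply: (@le_trans _ _ (\sum_(t < n) c0)); last by rewrite sumr_const card_ord mulr_natl.
apply: ler_sum => t _; apply: le_trans (kap_cost B.+1).
rewrite pair_big/= (partition_big (fun i : Ix => (i.1 t, word i.2 t)) xpredT)//=.
apply: ler_sum => -[b e] _ /=.
rewrite (eq_bigr (fun i => p i * - ln (kap b e))) => [|i /eqP[-> ->]//].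
rewrite -mulr_suml ler_wpM2r//.
  rewrite oppr_ge0 ln_le0//; apply: le_trans (kap_sum B.+1 e).
  by rewrite (bigD1 b)//= lerDl sumr_ge0.
rewrite -(pr_iter_preimage (t + a))//; apply: pr_sum_le => //.
  exact: measurable_iter_preimage.
by move=> i /eqP[ib ie]; rewrite -ib -ie; exact: D_eta.
Qed.

End entropy_code.
End measure_preserving.

Lemma partial_sums_tail (R : realType) (u : nat -> R) (C e : R) :
  (forall b, 0 <= u b) -> (forall B, \sum_(0 <= b < B) u b <= C) -> 0 < e ->
  exists K, forall B, \sum_(K <= b < B) u b <= e.
Proof.
move=> u0 uC e0; pose E := [set \sum_(0 <= b < B) u b | B in setT].
have Esup : has_sup E.
  by split; [exists (\sum_(0 <= b < 0) u b), 0%N|exists C => _ [B _ <-]].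
have [_ [K _ <-] Klt] := sup_adherent e0 Esup.
exists K => B; have [KB|BK] := leqP K B; last by rewrite big_geq ?ltW// ltnW.
have : \sum_(0 <= b < B) u b <= sup E by apply: ub_le_sup; [exact: Esup.2|exists B].
by rewrite (big_cat_nat (leq0n K) KB)/=; lra.
Qed.

(* No convergence is assumed: the limit of a divergent sequence is [point], i.e. 0. *)
Lemma lim_ereal_gt (R : realType) (u : nat -> \bar R) (c : R) :
  (forall n, (0 <= u n)%E) -> (c%:E < limn u)%E ->
  exists N, forall n, (N <= n)%N -> (c%:E <= u n)%E.
Proof.
move=> u0; have [cu|ncu] := pselect (cvgn u).
  move=> clt; have : \forall n \near \oo, (c%:E < u n)%E.
    apply: (cu [set y | (c%:E < y)%E]).
    by apply: open_nbhs_nbhs; split => //; exact: open_ereal_gt_ereal.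
  by move=> [N _ NP]; exists N => n Nn; apply: ltW; exact: NP.
by rewrite dvgP// => c0; exists 0%N => n _; exact: le_trans (ltW c0) (u0 n).
Qed.

Section entropy_lower_bound.
Context d (T : measurableType d) (R : realType) (P : probability T R) (f : T -> T).
Hypotheses (mf : measurable_fun setT f)
  (fP : forall A, measurable A -> P (f @^-1` A) = P A).

Lemma partition_entropy_ge0 (I : choiceType) (xi : I -> set T) :
  (forall i, measurable (xi i)) -> (0 <= partition_entropy P xi)%E.
Proof.
move=> mxi; apply: esum_ge0 => i _; rewrite lee_fin; apply: entropy_term_ge0.
by rewrite pr_ge0 pr_le1.
Qed.

Lemma entropy_wrt_gt (xi : nat -> set T) (c : R) : measurable_partition xi ->
  (c%:E < entropy_wrt f P xi)%E ->
  exists N, forall n, (N <= n)%N ->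
    ((n%:R * c)%:E <= partition_entropy P (join_partition f xi (n := n)))%E.
Proof.
move=> [mxi _ _] cxi.
have H0 n : (0 <= partition_entropy P (join_partition f xi (n := n)))%E.
  by apply: partition_entropy_ge0 => w; exact: measurable_join.
have u0 n : (0 <= (n%:R^-1)%:E * partition_entropy P (join_partition f xi (n := n)))%E.
  by rewrite mule_ge0// lee_fin invr_ge0.
have [N NP] := lim_ereal_gt u0 cxi.
exists N => -[_|n /NP]; first by rewrite mul0r.
by rewrite EFinM -lee_pdivlMl//.
Qed.

(* The code: mass [1 - th] on the guess [a], mass [th] spread according to the law
   of [xi]. A wrong guess of [b] thus costs [- ln th - ln (P (xi b))], which is
   affordable because [- \sum P (xi b) ln (P (xi b))] has small tails. *)
Lemma coding_cost (xi : nat -> set T) (e : R) : measurable_partition xi ->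
  (partition_entropy P xi < +oo)%E -> 0 < e ->
  exists (K : nat) (kap : nat -> option 'I_K -> R) (rho : R),
  [/\ 0 < rho, forall b a, 0 <= kap b a, forall B a, \sum_(b < B) kap b a <= 1 &
    forall eta : T -> option 'I_K,
    (forall a, measurable (eta @^-1` [set a])) ->
    (forall b : 'I_K, pr P (xi b `&` eta @^-1` (~` [set Some b])) <= rho) ->
    (forall b a, 0 < pr P (xi b `&` eta @^-1` [set a]) -> 0 < kap b a) /\
    forall B, \sum_(b < B) \sum_a pr P (xi b `&` eta @^-1` [set a]) * - ln (kap b a) <= e].
Proof.
move=> [mxi txi _] Hfin e0.
have xi_inj b c y : xi b y -> xi c y -> b = c by move=> yb yc; apply: (txi b c) => //; exists y.
pose p b := pr P (xi b).
have p0 b : 0 <= p b by exact: pr_ge0.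
have p1 b : p b <= 1 by exact: pr_le1.
have pln b : 0 <= - ln (p b) by rewrite oppr_ge0 ln_le0.
have psum B : \sum_(0 <= b < B) p b <= 1.
  rewrite big_mkord -(pr_setT P); apply: pr_sum_le => // i j y yi yj.
  by apply: val_inj; exact: xi_inj yi yj.
pose C := fine (partition_entropy P xi).
have CE : partition_entropy P xi = C%:E.
  by rewrite /C fineK// ge0_fin_numE//; exact: partition_entropy_ge0.
have plnsum B : \sum_(0 <= b < B) p b * - ln (p b) <= C.
  rewrite -lee_fin -CE -sumEFin big_mkord; apply: esum_ge; exists `I_B.
    by split; [exact: finite_II|].
  rewrite -fsbig_ord; apply: lee_sum => b _; by rewrite mulrN.
(* With this [th] a right guess costs at most - ln (1 - th) = e / 3. The other two thirds of [e] pay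
   for wrong guesses of letters below [K] and for the letters from [K] on, which are never
   guessed. *)
pose th := 1 - expR (- (e / 3)).
have th0 : 0 < th by rewrite subr_gt0 expR_lt1; lra.
have th1 : th < 1 by rewrite /th; have := expR_gt0 (- (e / 3)); lra.
have lnth : 0 <= - ln th by rewrite oppr_ge0 ln_le0// ltW.
pose c b := - ln th + - ln (p b).
have c_ge0 b : 0 <= c b by rewrite addr_ge0.
pose u b := p b * c b.
have u0 b : 0 <= u b by rewrite mulr_ge0.
have usum B : \sum_(0 <= b < B) u b <= - ln th + C.
  under eq_bigr do rewrite /u mulrDr; rewrite big_split/= lerD//.
  by rewrite -mulr_suml ler_piMl.
have [K KP] := partial_sums_tail u0 usum (divr_gt0 e0 (ltr0n R 3)).
pose hit b (a : option 'I_K) : bool := if a is Some j then val j == b else false.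
pose kap b a : R := (if hit b a then 1 - th else 0) + th * p b.
pose D := \sum_(0 <= b < K) c b.
have D0 : 0 <= D by exact: sumr_ge0.
have hit0 b a : 0 <= (if hit b a then 1 - th else 0).
  by case: (hit b a); rewrite // subr_ge0 ltW.
(* [D] adds up the costs of wrong guesses of all letters below [K]; if each is wrong with
   probability at most this [rho], together they cost less than e / 3. *)
exists K, kap, (e / 3 / (1 + D)); split.
- by rewrite !divr_gt0// ltr_wpDr.
- by move=> b a; rewrite addr_ge0 ?mulr_ge0// ltW.
- move=> B a; rewrite big_split/=.
  apply: (@le_trans _ _ ((1 - th) + th)); last by rewrite subrK.
  rewrite lerD//.
    rewrite -big_mkcond/= sumr_const -mulr_natl ler_piMl ?subr_ge0 ?(ltW th1)// lern1.
    apply/card_le1_eqP => a1 a2; rewrite !unfold_in /hit; case: a => // j /eqP j1 /eqP j2.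
    by apply: val_inj; rewrite /= -j2 -j1.
  by rewrite -mulr_sumr ger_pMr//; have := psum B; rewrite big_mkord.
move=> eta meta etaP.
have mxe b a : measurable (xi b `&` eta @^-1` [set a]) by exact: measurableI.
have pge b a : pr P (xi b `&` eta @^-1` [set a]) <= p b by apply: pr_le => //; exact: subIsetl.
split=> [b a pba|B].
  apply: ltr_wpDl; first exact: hit0.
  by apply: mulr_gt0 => //; exact: lt_le_trans pba (pge b a).
pose m b := \sum_(a | ~~ hit b a) pr P (xi b `&` eta @^-1` [set a]).
have cellE b : p b = \sum_a pr P (xi b `&` eta @^-1` [set a]) by exact: pr_cells.
have m0 b : 0 <= m b by apply: sumr_ge0 => a _; exact: pr_ge0.
have mp b : m b <= p b.
  by rewrite cellE [leRHS](bigID (hit b))/= lerDr; apply: sumr_ge0 => a _; exact: pr_ge0.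
have mrho b : (b < K)%N -> m b <= e / 3 / (1 + D).
  move=> bK; apply: le_trans (etaP (Ordinal bK)).
  apply: pr_sum_le => [|//|a nhit y [xy /= yb]|a a' y [_ /= <-] [_ /= <-]//].
    by apply: measurableI => //; rewrite -preimage_setC; exact: measurableC.
  split=> //=; rewrite yb => ab; move: nhit; rewrite ab /hit/=.
  by rewrite eqxx.
have term b : \sum_a pr P (xi b `&` eta @^-1` [set a]) * - ln (kap b a) <=
    p b * (e / 3) + m b * c b.
  rewrite (bigID (hit b))/= lerD//.
    apply: (@le_trans _ _ (\sum_(a | hit b a) pr P (xi b `&` eta @^-1` [set a]) * (e / 3))).
      apply: ler_sum => a hba; rewrite ler_wpM2l ?pr_ge0// lerNl -[leLHS]expRK.
      rewrite ler_ln ?posrE ?expR_gt0//; last first.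
        by rewrite /kap hba ltr_wpDr ?mulr_ge0 ?subr_gt0// ltW.
      have E1 : 1 - th = expR (- (e / 3)) by rewrite /th opprB addrC subrK.
      by rewrite /kap hba E1 lerDl mulr_ge0// ltW.
    rewrite -mulr_suml ler_wpM2r//; first by rewrite divr_ge0// ltW.
    rewrite cellE [leRHS](bigID (hit b))/= lerDl.
    by apply: sumr_ge0 => a _; exact: pr_ge0.
  rewrite /m mulr_suml; apply: ler_sum => a /negPf hba.
  rewrite /kap hba add0r; have [pb|pb] := ltP 0 (p b).
    by rewrite lnM ?posrE// opprD.
  have -> : pr P (xi b `&` eta @^-1` [set a]) = 0; last by rewrite !mul0r.
  by apply/eqP; rewrite eq_le pr_ge0 andbT (le_trans (pge b a)).
rewrite -(big_mkord xpredT (fun b => \sum_a pr P (xi b `&` eta @^-1` [set a]) * - ln (kap b a))).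
apply: (@le_trans _ _ (\sum_(0 <= b < B) p b * (e / 3) + \sum_(0 <= b < B) m b * c b)).
  by rewrite -big_split/=; apply: ler_sum => b _; exact: term.
apply: (@le_trans _ _ (e / 3 + (e / 3 + e / 3))); last by lra.
apply: lerD; first by rewrite -mulr_suml ler_piMl// divr_ge0// ltW.
(* Enlarging the range to [K + B] allows a split at [K] whether or not [K] exceeds [B]. *)
apply: (@le_trans _ _ (\sum_(0 <= b < K + B) m b * c b)).
  rewrite (@big_cat_nat _ _ _ B 0 (K + B))//=; last exact: leq_addl.
  by rewrite lerDl; apply: sumr_ge0 => b _; rewrite mulr_ge0.
rewrite (@big_cat_nat _ _ _ K 0 (K + B))//=; last exact: leq_addr.
apply: lerD; last first.
  by apply: le_trans (KP (K + B)%N); apply: ler_sum => b _; rewrite ler_wpM2r.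
apply: (@le_trans _ _ (\sum_(0 <= b < K) e / 3 / (1 + D) * c b)).
  by rewrite !big_mkord; apply: ler_sum => b _; rewrite ler_wpM2r// mrho.
rewrite -mulr_sumr -/D mulrAC ler_pdivrMr ?ltr_wpDr//.
by rewrite ler_wpM2l ?divr_ge0 ?ltW// ltrDr.
Qed.

End entropy_lower_bound.

(** * Borel sets and probabilities on sequence spaces *)

Lemma pr_bigcup_approx d (T : measurableType d) (R : realType) (P : probability T R)
    (A : nat -> set T) (e : R) : (forall k, measurable (A k)) ->
  (forall k l, (k <= l)%N -> A k `<=` A l) -> 0 < e ->
  exists k, pr P ((\bigcup_k A k) `\` A k) <= e.
Proof.
move=> mA ndA e0; have mU : measurable (\bigcup_k A k) by exact: bigcupT_measurable.
have cA : P \o A @ \oo --> P (\bigcup_k A k).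
  by apply: nondecreasing_cvg_mu => // k l kl; apply/subsetPset; exact: ndA.
have : \forall k \near \oo, ((pr P (\bigcup_k A k) - e)%:E < P (A k))%E.
  apply: (cA [set y | ((pr P (\bigcup_k A k) - e)%:E < y)%E]).
  apply: open_nbhs_nbhs; split; first exact: open_ereal_gt_ereal.
  by rewrite /= prE// lte_fin ltrBlDr ltrDl.
move=> [k _ /(_ k (leqnn k))]; rewrite /= prE// lte_fin => kP; exists k.
have : pr P (\bigcup_k A k) = pr P (A k) + pr P (\bigcup_k A k `\` A k).
  apply: EFin_inj; rewrite EFinD -!prE//; last exact: measurableD.
  rewrite -measureU//; last 2 first.
  - exact: measurableD.
  - by apply/seteqP; split=> y // -[? []].
  by rewrite setDUK//; exact: bigcup_sup.
by move: kP; lra.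
Qed.

Lemma site_abs_of_nat s j : site_abs (site_of_nat s j) = j.
Proof. by case: s. Qed.

Section borel.
Context {R : realType} {s : sidedness}.
Local Notation X := (sequence_space R s nat).
Implicit Types (y z : X) (A U : set X).

Definition letter y (j : nat) : nat := y (site_of_nat s j).

Lemma agree_letter k y z j : (j <= k)%N -> agree k y z -> letter y j = letter z j.
Proof. by move=> jk yz; apply: yz; rewrite site_abs_of_nat. Qed.

Lemma letter_iter_shift t y j : letter (iter t shift_map y) j = letter y (j + t).
Proof. by rewrite /letter iter_shiftE site_of_nat_add. Qed.

Lemma agree_iter_shift k t y z (L : nat) : (k <= t)%N -> (t + k < L)%N ->
  (forall j, (j < L)%N -> letter y j = letter z j) ->
  agree k (iter t shift_map y) (iter t shift_map z).
Proof.
move=> kt tk yz i ik; rewrite !iter_shiftE.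
have [j jt ->] := site_add_window ik kt.
by apply: yz; exact: leq_ltn_trans tk.
Qed.

Lemma open_measurable_sequence U : open U -> measurable U.
Proof. exact: sub_sigma_algebra. Qed.

Lemma closed_measurable_sequence U : closed U -> measurable U.
Proof.
move=> Uc; rewrite -[U]setCK; apply: measurableC; apply: open_measurable_sequence.
exact: closed_openC.
Qed.

Lemma measurable_shift : measurable_fun setT (@shift_map R s nat).
Proof.
apply: (@measurability _ _ X X _ _ open); first by [].
move=> _ [U Uo <-]; rewrite setTI; apply: open_measurable_sequence.
by have /continuousP := @continuous_shift_map R s nat; apply.
Qed.

(** A map that depends on a window is locally constant, so all its preimages are open, for any
    [Q]. *)
Lemma measurable_window_cell k (V : Type) (cell : X -> V) (Q : set V) :
  (forall y z, agree k y z -> cell y = cell z) -> measurable (cell @^-1` Q).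
Proof.
move=> cellP; apply: open_measurable_sequence; apply: (@open_finite_window _ _ _ k).
by move=> y z yz; rewrite /preimage/= (cellP _ _ yz).
Qed.

Lemma closed_markov_shift M : closed (markov_shift R s M).
Proof.
rewrite -[markov_shift R s M]setCK; apply: open_closedC; apply/open_agreeP => y /existsNP[i yi].
exists (maxn (site_abs i) (site_abs (site_succ i))) => z yz zM; apply: yi.
by rewrite (yz i) ?leq_maxl// (yz (site_succ i)) ?leq_maxr//; exact: zM.
Qed.

Lemma measurable_markov_shift M : measurable (markov_shift R s M).
Proof. by apply: closed_measurable_sequence; exact: closed_markov_shift. Qed.

Lemma markov_shift_iter M t y : markov_shift R s M y ->
  markov_shift R s M (iter t shift_map y).
Proof. by move=> yM; elim: t => [//|t IH] i; exact: IH. Qed.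

Section approximation.
Variable P : probability X R.

Lemma letter_bounded (e : R) : 0 < e ->
  exists b, pr P [set y | (b < letter y 0%N)%N] <= e.
Proof.
move=> e0; pose A b := [set y : X | (letter y 0%N <= b)%N].
have mA b : measurable (A b).
  apply: (@measurable_window_cell 0 _ (fun y => letter y 0%N) [set a | (a <= b)%N]).
  by move=> y z; exact: agree_letter.
have [b bP] : exists b, pr P ((\bigcup_b A b) `\` A b) <= e.
  by apply: pr_bigcup_approx => // b c bc y /= yb; exact: leq_trans bc.
exists b; rewrite (_ : [set y | _] = (\bigcup_b A b) `\` A b)//.
apply/seteqP; split=> y /=; last by move=> [_ /negP]; rewrite -ltnNge.
move=> yb; split; last by apply/negP; rewrite -ltnNge.
by exists (letter y 0%N) => //; exact: leqnn.
Qed.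

(** A union of cylinders over one window, possibly infinitely many since the alphabet is
    infinite. *)
Definition windowed k (C : set X) := forall y z, agree k y z -> C y -> C z.

Lemma windowed_measurable k (C : set X) : windowed k C -> measurable C.
Proof.
by move=> Cw; apply: open_measurable_sequence; apply: (@open_finite_window _ _ _ k).
Qed.

Lemma windowed_le k l (C : set X) : (k <= l)%N -> windowed k C -> windowed l C.
Proof. by move=> kl Cw y z /(agree_le kl); exact: Cw. Qed.

Let approximable A := measurable A /\ forall e : R, 0 < e ->
  exists k C, windowed k C /\ pr P ((A `\` C) `|` (C `\` A)) <= e.

(** The approximable sets form a sigma-algebra containing the open sets. For a countable union, half
    of [e] pays for cutting it down to [n] sets and the other half is shared among their
    approximations. *)
Lemma window_approx A (e : R) : measurable A -> 0 < e ->
  exists k C, windowed k C /\ pr P ((A `\` C) `|` (C `\` A)) <= e.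
Proof.
move=> mA e0; suff : approximable A by move=> [_]; exact.
move: A mA {e e0}; apply: smallest_sub; last first.
  move=> U Uo; split; first exact: open_measurable_sequence.
  (* The points whose window of radius [k] already forces membership in [U]; these windowed sets
     increase to [U]. *)
  move=> e e0; pose A k := [set y : X | agree k y `<=` U].
  have Aw k : windowed k (A k).
    by move=> y z yz yU u zu; apply: yU; exact: agree_trans zu.
  have UE : \bigcup_k A k = U.
    apply/seteqP; split=> [y [k _]|y Uy]; first exact.
    by have [k kP] := (open_agreeP U).1 Uo y Uy; exists k.
  have [k kP] : exists k, pr P ((\bigcup_b A b) `\` A k) <= e.
    apply: pr_bigcup_approx => // [k|k l kl y yU z yz]; first exact: windowed_measurable.
    by apply: yU; exact: agree_le yz.
  exists k, (A k); split => //; rewrite -UE [X in _ `|` X](_ : _ = set0) ?setU0//.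
  rewrite UE.
  by apply/seteqP; split=> y // -[/(_ y (@agree_refl _ _ _ k y))].
split.
- split=> // e e0; exists 0%N, set0; split; first by [].
  by rewrite !setD0 setU0 /pr measure0 ltW.
- move=> A [mA Ap]; rewrite setTD; split; first exact: measurableC.
  move=> e /Ap[k [C [Cw Ce]]]; exists k, (~` C); split.
    by move=> y z /agree_sym yz nCy Cz; apply: nCy; exact: Cw Cz.
  by move: Ce; rewrite !setDE !setCK setUC [C `&` _]setIC [A `&` _]setIC.
move=> A Ap; have mA i : measurable (A i) by have [] := Ap i.
split=> [|e e0]; first exact: bigcupT_measurable.
pose B k := \bigcup_(i < k) A i.
have mB k : measurable (B k) by apply: bigcup_measurable.
have BU : \bigcup_k B k = \bigcup_k A k.
  apply/seteqP; split=> [y [k _ [i _ Ai]]|y [i _ Ai]]; first by exists i.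
  by exists i.+1 => //; exists i => //=.
have [n nP] : exists n, pr P ((\bigcup_k B k) `\` B n) <= e / 2.
  apply: pr_bigcup_approx => // [k l kl y [i /= ik Ai]|]; last by rewrite divr_gt0.
  by exists i => //=; exact: leq_trans kl.
have en0 : 0 < e / 2 / n.+1%:R by rewrite !divr_gt0.
have /choice[kC kCP] : forall i, exists kC : nat * set X,
    windowed kC.1 kC.2 /\ pr P ((A i `\` kC.2) `|` (kC.2 `\` A i)) <= e / 2 / n.+1%:R.
  by move=> i; have [k [C CP]] := (Ap i).2 _ en0; exists (k, C).
pose k := (\max_(i < n) (kC i).1)%N.
pose C := \bigcup_(i < n) (kC i).2.
have Cw : windowed k C.
  move=> y z yz [i /= ik Ci]; exists i => //=; apply: (kCP i).1 Ci.
  apply: agree_le yz.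
  exact: (leq_bigmax (F := fun i : 'I_n => (kC i).1) (Ordinal ik)).
exists k, C; split=> //.
have mC := windowed_measurable Cw.
have mCi i : measurable (kC i).2 by exact: windowed_measurable (kCP i).1.
pose D i := (A i `\` (kC i).2) `|` ((kC i).2 `\` A i).
have mD i : measurable (D i) by apply: measurableU; exact: measurableD.
have mU : measurable (\bigcup_i A i) by exact: bigcupT_measurable.
have -> : e = e / 2 + e / 2 by field.
pose E (o : option 'I_n) := if o is Some i then D i else (\bigcup_k B k) `\` B n.
have mE o : measurable (E o).
  by case: o => [i|] /=; [exact: mD|rewrite BU; apply: measurableD => //; exact: mB].
apply: (@le_trans _ _ (\sum_o pr P (E o))).
  apply: pr_le_sum => //; first by apply: measurableU; exact: measurableD.
  move=> y [[[i _ Ai] nC]|[[i /= ik Ci] nA]].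
    have [[j /= jn Aj]|nB] := pselect (B n y); last first.
      by exists None; rewrite /E BU; split=> //; exists i.
    by exists (Some (Ordinal jn)); left; split => //= Cj; apply: nC; exists j.
  by exists (Some (Ordinal ik)); right; split => //= Ai; apply: nA; exists i.
rewrite (bigD1 None)//= lerD//.
apply: (@le_trans _ _ (\sum_(o : option 'I_n | o != None) e / 2 / n.+1%:R)).
  by apply: ler_sum => -[i|//] _; exact: (kCP i).2.
rewrite sumr_const -[leLHS]mulr_natr mulrAC ler_pdivrMr// ler_wpM2l ?divr_ge0 ?(ltW e0)//.
by rewrite ler_nat (leq_trans (max_card _))// card_option card_ord.
Qed.

End approximation.
End borel.

(** * Coding by words on a good set and by guesses off it *)

Section two_level_code.
Context d (T : measurableType d) (R : realType) (P : probability T R).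
Variables (F E : finType) (G : set T) (word : T -> F) (eword : T -> E).
Hypotheses (mG : measurable G) (mword : forall u, measurable (word @^-1` [set u]))
  (meword : forall w, measurable (eword @^-1` [set w])).
Hypothesis prG : 0 < pr P G.

(** Off [G] the word may contain arbitrarily large letters, so it is replaced there by an element of
    the finite set [E]. *)
Definition good_cell y : F + E :=
  if `[< G y >] then inl (word y) else inr (eword y).

(** The conditional law of the word given [G]; it becomes the law [q] of the blocks. *)
Definition word_law u : R := pr P (G `&` word @^-1` [set u]) / pr P G.

(* The factor 2 pays for telling whether the point is in [G]. *)
Definition good_code (v : F + E) : R :=
  match v with inl u => word_law u / 2 | inr _ => #|E|%:R^-1 / 2 end.

Lemma good_cell_inl u : good_cell @^-1` [set inl u] = G `&` word @^-1` [set u].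
Proof.
rewrite /good_cell; apply/seteqP; split=> y /=.
  by case: asboolP => // Gy [<-].
by move=> [Gy <-]; case: asboolP.
Qed.

Lemma good_cell_inr w : good_cell @^-1` [set inr w] = ~` G `&` eword @^-1` [set w].
Proof.
rewrite /good_cell; apply/seteqP; split=> y /=.
  by case: asboolP => // Gy [<-].
by move=> [Gy <-]; case: asboolP.
Qed.

Lemma measurable_good_cell v : measurable (good_cell @^-1` [set v]).
Proof.
case: v => [u|w]; first by rewrite good_cell_inl; exact: measurableI.
by rewrite good_cell_inr; apply: measurableI => //; exact: measurableC.
Qed.

Lemma word_law_ge0 u : 0 <= word_law u.
Proof. by rewrite divr_ge0// pr_ge0. Qed.

Lemma word_law_sum1 : \sum_u word_law u = 1.
Proof. by rewrite -mulr_suml -(pr_cells P mword mG) divff// gt_eqF. Qed.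

Lemma good_code_ge0 v : 0 <= good_code v.
Proof. by case: v => [u|w] /=; rewrite divr_ge0// ?word_law_ge0// invr_ge0. Qed.

Lemma good_code_sum : \sum_v good_code v <= 1.
Proof.
rewrite big_sumType/= -mulr_suml word_law_sum1.
have -> : \sum_(w : E) #|E|%:R^-1 / 2 = #|E|%:R * #|E|%:R^-1 / 2 :> R.
  by rewrite sumr_const -[LHS]mulr_natl mulrA.
have [->|E0] := eqVneq (#|E|%:R : R) 0; first by rewrite mul0r mul0r addr0; lra.
by rewrite divff//; lra.
Qed.

Lemma good_code_gt0 v : 0 < pr P (good_cell @^-1` [set v]) -> 0 < good_code v.
Proof.
case: v => [u|w] /=; first by rewrite good_cell_inl => pu; rewrite !divr_gt0.
by move=> _; rewrite divr_gt0// invr_gt0 ltr0n; apply/card_gt0P; exists w.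
Qed.

(** On [G] the ideal code length of the conditional law is paid, off [G] that of the uniform law on
    [E]; the factor 1 / 2 in the code adds ln 2 in both cases. *)
Lemma good_code_cost :
  \sum_v pr P (good_cell @^-1` [set v]) * - ln (good_code v) <=
  ln 2 + pr P G * (\sum_u word_law u * - ln (word_law u))
    + (1 - pr P G) * ln #|E|%:R.
Proof.
rewrite big_sumType/=.
have -> : \sum_u pr P (good_cell @^-1` [set inl u]) * - ln (word_law u / 2) =
    pr P G * (\sum_u word_law u * - ln (word_law u)) + pr P G * ln 2.
  have -> : pr P G * ln 2 = \sum_u pr P G * (word_law u * ln 2).
    by rewrite -mulr_sumr -mulr_suml word_law_sum1 mul1r.
  rewrite mulr_sumr -big_split/=; apply: eq_bigr => u _; rewrite good_cell_inl.
  have -> : pr P (G `&` word @^-1` [set u]) = pr P G * word_law u.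
    by rewrite /word_law mulrC divfK// gt_eqF.
  have := word_law_ge0 u; rewrite le_eqVlt => /predU1P[<-|u0].
    by rewrite !(mul0r, mulr0, addr0).
  by rewrite ln_div ?posrE//; ring.
have EC : \sum_w pr P (good_cell @^-1` [set inr w]) = 1 - pr P G.
  rewrite -pr_setC// (pr_cells P meword (measurableC mG)).
  by apply: eq_bigr => w _; rewrite good_cell_inr.
have -> : \sum_(w : E) pr P (good_cell @^-1` [set inr w]) * - ln (#|E|%:R^-1 / 2) =
   (1 - pr P G) * ln #|E|%:R + (1 - pr P G) * ln 2.
  rewrite -mulr_suml EC -mulrDr.
  (* If [E] is empty there are no cells off [G], so the complement of [G] is null and the junk value
     of the logarithm is multiplied by 0. *)
  have [E0|E0] := posnP #|E|.
    have -> : 1 - pr P G = 0 by rewrite -EC big1// => w; have := fintype0 w E0.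
    by rewrite !mul0r.
  by rewrite ln_div ?posrE ?invr_gt0 ?ltr0n// lnV ?posrE ?ltr0n//; ring.
lra.
Qed.

End two_level_code.

(** * Birkhoff sums *)

Section observables.
Context {R : realType} {s : sidedness} (Y : set (sequence_space R s nat)).
Local Notation X := (sequence_space R s nat).
Implicit Types (y z : X) (psi : X -> R).

Lemma unif_continuous_agree psi : unif_continuous (psi : subspace Y -> R) ->
  forall e : R, 0 < e -> exists r, forall y z, Y y -> Y z -> agree r y z ->
  `|psi y - psi z| < e.
Proof.
move=> uc e e0.
have : entourage [set xy : R * R | `|xy.1 - xy.2| < e].
  by apply: (@entourage_ball R R (PosNum e0)).
move=> /uc [E entE EP]; have := entE.
rewrite -entourage_ballE => -[/= e' e'0 EE].
have [r rP] := exp2_small e'0.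
exists r => y z Yy Yz yz; apply: (EP (y, z)); right; split => //; split => //.
apply: EE => /=; rewrite ballEmdist/=.
by apply: lt_trans rP; apply/agree_dist.
Qed.

(** Regularity is known only on [Y]; extension by 0 gives a function on the whole space with the
    same integral over [Y]. *)
Lemma restrict_bounded_measurable psi : measurable Y ->
  unif_continuous (psi : subspace Y -> R) -> [bounded psi y | y in Y] ->
  bounded_measurable (psi \_ Y).
Proof.
move=> mY /unif_continuous_agree uc [C [_ /(_ (C + 1))]]; rewrite ltrDl ltr01 => /(_ isT) bC.
split; last first.
  exists (Num.max 0 (C + 1)) => y; rewrite patchE; case: ifPn.
    by rewrite inE => Yy; rewrite le_max (bC y Yy) orbT.
  by rewrite normr0 le_max lexx.
apply: (measurable_restrictT psi mY).1; apply: (measurability _ (RGenOpens.measurableE R)).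
move=> _ [_ [a [b ->] <-]].
(* An open set of the whole space whose trace on [Y] is the preimage of the interval; uniform
   continuity provides the required window at each point of that preimage. *)
pose O := [set y : X | exists k, forall z, agree k y z -> Y z -> `]a, b[%classic (psi z)].
rewrite [X in measurable X](_ : _ = Y `&` O).
  apply: measurableI => //; apply: open_measurable_sequence; apply/open_agreeP => y [k kP].
  by exists k => z yz; exists k => u zu; apply: kP; exact: agree_trans zu.
apply/seteqP; split=> y [Yy yO]; split => //; last first.
  by case: yO => k kP; exact: (kP y (@agree_refl _ _ _ k y) Yy).
have [e e0 eP] : exists2 e, 0 < e & forall v, `|psi y - v| < e -> `]a, b[%classic v.
  move: yO; rewrite /= in_itv/= => /andP[ay yb].
  exists (Num.min (psi y - a) (b - psi y)); first by rewrite lt_min !subr_gt0 ay.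
  move=> v; rewrite lt_min ltr_norml ltr_norml in_itv/= => /andP[/andP[_ h1] /andP[h2 _]].
  by lra.
by have [r rP] := uc e e0; exists r => z yz Yz; apply: eP; exact: rP.
Qed.

Definition birkhoff psi (n : nat) y : R := \sum_(t < n) psi (iter t shift_map y).

Lemma birkhoffD psi m n y :
  birkhoff psi (m + n) y = birkhoff psi m y + birkhoff psi n (iter m shift_map y).
Proof.
rewrite /birkhoff big_split_ord/=; congr (_ + _).
by apply: eq_bigr => t _; rewrite addnC iterD.
Qed.

Lemma birkhoff_le psi (C : R) n y : (forall z, `|psi z| <= C) ->
  `|birkhoff psi n y| <= n%:R * C.
Proof.
move=> psiC; apply: le_trans (ler_norm_sum _ _ _) _.
apply: (@le_trans _ _ (\sum_(t < n) C)); first by apply: ler_sum.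
by rewrite sumr_const card_ord mulr_natl.
Qed.

(** At the at most 2 r times within [r] of an end of the word, the values are bounded by [C] and
    differ by at most 2 C; at all other times the window lies inside the word and the difference is
    below [e]. *)
Lemma birkhoff_window psi (C e : R) (r L : nat) y z :
  (forall z, `|psi z| <= C) -> 0 <= e ->
  (forall y z, Y y -> Y z -> agree r y z -> `|psi y - psi z| < e) ->
  (forall y t, Y y -> Y (iter t shift_map y)) ->
  Y y -> Y z -> (forall j, (j < L)%N -> letter y j = letter z j) ->
  `|birkhoff psi L y - birkhoff psi L z| <= L%:R * e + 4 * r%:R * C.
Proof.
move=> psiC e0 rP Yshift Yy Yz yz.
have C0 : 0 <= C by apply: le_trans (psiC y).
rewrite /birkhoff -sumrB; apply: le_trans (ler_norm_sum _ _ _) _.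
apply: (@le_trans _ _ (\sum_(t < L) (e + 2 * C * ((t < r)%N%:R + (L <= t + r)%N%:R)))).
  apply: ler_sum => t _; have [tr|rt] := ltnP t r.
    apply: (le_trans (ler_normB _ _)).
    have := psiC (iter t shift_map y); have := psiC (iter t shift_map z).
    have : 0 <= 2 * C * (L <= t + r)%N%:R by rewrite !mulr_ge0.
    rewrite mulrDr mulr1; lra.
  have [Lt|tL] := leqP L (t + r).
    apply: (le_trans (ler_normB _ _)); rewrite add0r mulr1.
    by have := psiC (iter t shift_map y); have := psiC (iter t shift_map z); lra.
  rewrite addr0 mulr0 addr0 ltW// rP//; try exact: Yshift.
  exact: agree_iter_shift rt tL yz.
rewrite big_split/= sumr_const card_ord -[e *+ L]mulr_natl lerD2l -mulr_sumr big_split/=.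
have count1 n : (\sum_(t < n) (t < r)%N <= minn n r)%N.
  elim: n => [|n IH]; first by rewrite big_ord0.
  rewrite big_ord_recr/=; apply: leq_trans (leq_add IH (leqnn _)) _.
  by case: (ltnP n r) => ?; lia.
have count2 n : (\sum_(t < n) (L <= t + r)%N <= n + r - L)%N.
  elim: n => [|n IH]; first by rewrite big_ord0.
  rewrite big_ord_recr/=; apply: leq_trans (leq_add IH (leqnn _)) _.
  by case: (leqP L (n + r)) => ?; lia.
have h1 : \sum_(t < L) (t < r)%N%:R <= r%:R :> R.
  by rewrite -natr_sum ler_nat (leq_trans (count1 L))// geq_minr.
have h2 : \sum_(t < L) (L <= t + r)%N%:R <= r%:R :> R.
  by rewrite -natr_sum ler_nat (leq_trans (count2 L))// addKn.
apply: (@le_trans _ _ (2 * C * (r%:R + r%:R))); last by lra.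
by rewrite ler_wpM2l ?mulr_ge0// lerD.
Qed.

Section invariant.
Variable P : probability X R.
Hypothesis P_inv : forall A, measurable A -> P (shift_map @^-1` A) = P A.

Lemma mean_iter_shift psi t : bounded_measurable psi ->
  mean P (psi \o iter t shift_map) = mean P psi.
Proof.
move=> bpsi; have mt : measurable_fun setT (iter t (@shift_map R s nat)).
  refine (measurable_iter (@measurable_shift R s) t).
rewrite /mean /Rintegral; congr fine.
rewrite -[LHS](@integral_pushforward _ _ _ _ R (iter t shift_map) mt P setT (EFin \o psi))//.
- apply: eq_measure_integral => A mA _; rewrite /pushforward.
  exact: (measure_iter_preimage (@measurable_shift R s) P_inv).
- by apply/measurable_EFinP; case: bpsi.
- exact: (bounded_measurable_integrable P (bounded_measurable_comp mt bpsi)).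
Qed.

Lemma bounded_measurable_birkhoff psi n : bounded_measurable psi ->
  bounded_measurable (birkhoff psi n).
Proof.
move=> bpsi; apply: bounded_measurable_sum => t.
exact: (bounded_measurable_comp (measurable_iter (@measurable_shift R s) t) bpsi).
Qed.

Lemma mean_birkhoff psi n : bounded_measurable psi ->
  mean P (birkhoff psi n) = n%:R * mean P psi.
Proof.
move=> bpsi; rewrite mean_sum => [|t]; last first.
  exact: (bounded_measurable_comp (measurable_iter (@measurable_shift R s) t) bpsi).
rewrite (eq_bigr (fun=> mean P psi)) => [|t _]; last exact: mean_iter_shift.
by rewrite sumr_const card_ord mulr_natl.
Qed.

End invariant.
End observables.

(** * From entropy to finitely many blocks *)

Section good_blocks.
Context {R : realType} {s : sidedness} (Y : set (sequence_space R s nat)).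
Local Notation X := (sequence_space R s nat).
Local Notation sigma := (@shift_map R s nat).
Implicit Types (y z : X) (psi : X -> R).

Hypotheses (mY : measurable Y) (Y_shift : forall y t, Y y -> Y (iter t sigma y)).
Variable P : probability X R.
Hypotheses (P_inv : forall A, measurable A -> P (sigma @^-1` A) = P A) (PY : P Y = 1%E).

(** Letters above [B] are turned into 0 by [inord], so this is the true word only where the letters
    are bounded by [B]. *)
Definition letters_of (L B : nat) y : {ffun 'I_L -> 'I_B.+1} :=
  [ffun t : 'I_L => inord (letter y t)].

Lemma measurable_letters_of L B u : measurable (letters_of L B @^-1` [set u]).
Proof.
have wl y z : agree L y z -> letters_of L B y = letters_of L B z.
  by move=> yz; apply/ffunP => t; rewrite !ffunE (agree_letter _ yz)// ltnW.
exact: (measurable_window_cell [set u] wl).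
Qed.

(** The first [K] cells are approximated by windowed sets, which are then made disjoint. A wrong
    guess puts the point in one of the [K] symmetric differences; dividing [rho] by [K.+1] avoids
    the division by 0 when [K] is 0. *)
Lemma windowed_coding (xi : nat -> set X) (K : nat) (rho : R) :
  (forall b, measurable (xi b)) -> (forall b c y, xi b y -> xi c y -> b = c) ->
  0 < rho ->
  exists (a : nat) (eta : X -> option 'I_K),
    (forall y z, agree a y z -> eta y = eta z) /\
    forall b : 'I_K, pr P (xi b `&` eta @^-1` (~` [set Some b])) <= rho.
Proof.
move=> mxi xi_inj rho0.
have rho'0 : 0 < rho / K.+1%:R by rewrite divr_gt0.
have /choice[kC kCP] : forall b : 'I_K, exists kC : nat * set X,
    windowed kC.1 kC.2 /\
    pr P ((xi b `\` kC.2) `|` (kC.2 `\` xi b)) <= rho / K.+1%:R.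
  by move=> b; have [k [C CP]] := window_approx P (mxi b) rho'0; exists (k, C).
pose a := (\max_(b < K) (kC b).1)%N.
have Cw b : windowed a (kC b).2.
  apply: windowed_le (kCP b).1.
  exact: (leq_bigmax (F := fun i : 'I_K => (kC i).1)).
have mC b := windowed_measurable (Cw b).
have [eta [meta etaC etaN eta_ext]] := finite_cells mC.
exists a, eta; split.
  move=> y z yz; apply: eta_ext => b; split; first exact: Cw.
  exact: Cw (agree_sym yz).
move=> b; pose D (c : 'I_K) := (xi c `\` (kC c).2) `|` ((kC c).2 `\` xi c).
have mD c : measurable (D c) by apply: measurableU; exact: measurableD.
apply: (@le_trans _ _ (\sum_(c < K) pr P (D c))).
  apply: pr_le_sum => //.
    by apply: measurableI => //; rewrite -preimage_setC; exact: measurableC.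
  move=> y [yb /= etab]; case E : (eta y) => [c|].
    have Cc := etaC _ _ E; exists c; right; split => // yc.
    by apply: etab; rewrite E; congr Some; apply: val_inj; exact: xi_inj yc yb.
  by exists b; left; split => //; exact: etaN.
apply: (@le_trans _ _ (\sum_(c < K) rho / K.+1%:R)).
  by apply: ler_sum => c _; exact: (kCP c).2.
rewrite sumr_const card_ord -[leLHS]mulr_natl mulrA ler_pdivrMr// mulrC.
by apply: ler_wpM2l; [exact: ltW|rewrite ler_nat].
Qed.

(** Of the 3 e, two parts go to the first and last letters exceeding [A], a bound given before [L].
    The third is shared as e / L among all letters exceeding [B], which is chosen after [L]. The
    complement of [Y] is null. *)
Lemma good_set (e : R) (A L : nat) : 0 < e ->
  pr P [set y | (A < letter y 0)%N] <= e -> (0 < L)%N ->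
  exists (B : nat) (G : set X), [/\ measurable G, 1 - 3 * e <= pr P G, G `<=` Y,
    forall y j, G y -> (j < L)%N -> (letter y j <= B)%N &
    forall y, G y -> (letter y 0 <= A)%N /\ (letter y L.-1 <= A)%N].
Proof.
move=> e0 PA L0.
have eL : 0 < e / L%:R by rewrite divr_gt0// ltr0n.
have [B PB] := letter_bounded P eL.
have mlet j b : measurable [set y : X | (b < letter y j)%N].
  apply: (@measurable_window_cell R s j _ (fun y => letter y j) [set a | (b < a)%N]).
  by move=> y z; exact: agree_letter.
have plet j b : pr P [set y : X | (b < letter y j)%N] = pr P [set y | (b < letter y 0)%N].
  rewrite -(pr_iter_preimage (@measurable_shift R s) P_inv j (mlet 0%N b)).
  by congr pr; apply/seteqP; split=> y; rewrite /preimage/= letter_iter_shift add0n.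
pose E (o : 'I_3 + 'I_L) : set X := match o with
  | inl i => nth set0
      [:: ~` Y; [set y | (A < letter y 0)%N]; [set y | (A < letter y L.-1)%N]] i
  | inr j => [set y | (B < letter y j)%N] end.
have mE o : measurable (E o).
  by case: o => [[[|[|[|i]]] ilt]|j] //=; try exact: mlet; exact: measurableC.
pose bad := \bigcup_o E o.
have mbad : measurable bad by apply: fin_bigcup_measurable => //; exact: finite_finset.
exists B, (~` bad); split.
- exact: measurableC.
- rewrite pr_setC// lerD2l lerN2.
  apply: (@le_trans _ _ (\sum_o pr P (E o))).
    by apply: pr_le_sum => // y [v _ Ev]; exists v.
  rewrite big_sumType/= !big_ord_recl big_ord0/= addr0.
  have -> : pr P (~` Y) = 0 by rewrite pr_setC// /pr PY subrr.
  have : \sum_(j < L) pr P [set y : X | (B < letter y j)%N] <= e.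
    under eq_bigr do rewrite plet.
    apply: (@le_trans _ _ (\sum_(j < L) e / L%:R)); first exact: ler_sum.
    by rewrite sumr_const card_ord -[leLHS]mulr_natl mulrC divfK// gt_eqF// ltr0n.
  by rewrite (plet L.-1); move: PA; lra.
- by move=> y yG; apply: contrapT => nY; apply: yG; exists (inl ord0).
- move=> y j yG jL; rewrite leqNgt; apply/negP => By; apply: yG.
  by exists (inr (Ordinal jL)).
- move=> y yG; split; rewrite leqNgt; apply/negP => Ay; apply: yG.
    by exists (inl (@Ordinal 3 1 isT)).
  by exists (inl (@Ordinal 3 2 isT)).
Qed.

End good_blocks.

Section good_blocks_main.
Context {R : realType} {s : sidedness} (Y : set (sequence_space R s nat)).
Local Notation X := (sequence_space R s nat).
Local Notation sigma := (@shift_map R s nat).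
Implicit Types (y z : X).

Hypotheses (mY : measurable Y) (Y_shift : forall y t, Y y -> Y (iter t sigma y)).
Variable P : probability X R.
Hypotheses (P_inv : forall A, measurable A -> P (sigma @^-1` A) = P A) (PY : P Y = 1%E).

(* [l] is the cost per letter off [G], where only the guesses are encoded; it does
   not depend on [L], so that [G] can be chosen after it. *)
Lemma entropy_blocks (e c : R) : 0 < e -> (c%:E < metric_entropy sigma P)%E ->
  exists a (l : R), 0 <= l /\ exists N, forall (L n B : nat) (G : set X),
    (N <= n)%N -> L = (n + 2 * a).+1 -> measurable G -> 0 < pr P G ->
    (forall y j, G y -> (j < L)%N -> (letter y j <= B)%N) ->
    n%:R * c <= 2 + n%:R * e + (1 - pr P G) * n%:R * l +
      pr P G * \sum_u word_law P G (letters_of L B) u * - ln (word_law P G (letters_of L B) u).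
Proof.
move=> e0 /ereal_sup_gt[_ [xi [pxi Hxi] <-] cxi].
have [mxi txi _] := pxi.
have xi_inj b d y : xi b y -> xi d y -> b = d.
  by move=> yb yd; apply: (txi b d) => //; exists y.
have mf := @measurable_shift R s.
have [N NP] := entropy_wrt_gt mf pxi cxi.
have [K [kap [rho [rho0 kap0 kap1 kapP]]]] := coding_cost pxi Hxi e0.
have [a [eta [etaw etaP]]] := windowed_coding P K mxi xi_inj rho0.
have meta v : measurable (eta @^-1` [set v]).
  exact: (@measurable_window_cell R s a _ eta [set v]).
have [kap_gt0 kap_cost] := kapP eta meta etaP.
(* Each guess has [K.+1] values, so the uniform code on words of [n] guesses costs n ln (K + 1). *)
exists a, (ln K.+1%:R); split; first by rewrite ln_ge0// ler1n.
exists N => L n B G Nn LE mG G0 GB.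
have mword := @measurable_letters_of R s L B.
pose eword y : {ffun 'I_n -> option 'I_K} := [ffun t : 'I_n => eta (iter (t + a) sigma y)].
have meword w : measurable (eword @^-1` [set w]).
  rewrite (_ : eword @^-1` _ = \bigcap_(t in [set: 'I_n])
      (iter (t + a) sigma @^-1` (eta @^-1` [set w t]))).
    apply: fin_bigcap_measurable => [|t _]; first exact: finite_finset.
    exact: measurable_iter_preimage.
  apply/seteqP; split=> [y /= <- t _|y yw] /=; first by rewrite ffunE.
  by apply/ffunP => t; rewrite ffunE; exact: (yw t Logic.I).
(* Some point spelling [u], not necessarily in the shift. For t < n the guess at time [t + a] sees
   only sites from 0 to n + 2 a - 1, all inside the word, so on [G] it is a function of the word. *)
pose pt (u : {ffun 'I_L -> 'I_B.+1}) : X := fun i =>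
  if insub (site_abs i) is Some t then nat_of_ord (u t) else 0%N.
have ptP u (t : 'I_L) : letter (pt u) t = u t.
  by rewrite /letter /pt site_abs_of_nat valK.
pose code (v : {ffun 'I_L -> 'I_B.+1} + {ffun 'I_n -> option 'I_K}) (t : 'I_n) :=
  match v with inl u => eta (iter (t + a) sigma (pt u)) | inr w => w t end.
have codeP y t : code (good_cell G (letters_of L B) eword y) t = eta (iter (t + a) sigma y).
  rewrite /good_cell; case: asboolP => Gy /=; last by rewrite ffunE.
  have ag : agree a (iter (t + a) sigma (pt (letters_of L B y))) (iter (t + a) sigma y).
    apply: (@agree_iter_shift R s a (t + a) (pt (letters_of L B y)) y L).
    - exact: leq_addl.
    - by have := ltn_ord t; lia.
    - move=> j jL; rewrite (ptP _ (Ordinal jL)) ffunE/= inordK// ltnS.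
      exact: GB.
  exact: etaw ag.
have := entropy_code_le mf P_inv pxi (measurable_good_cell mG mword meword) meta codeP
  (good_code_ge0 P G _) (good_code_sum _ mG mword G0) (good_code_gt0 G0) kap0 kap1 kap_gt0 kap_cost.
move=> /(le_trans (NP n Nn)); rewrite lee_fin => /le_trans; apply.
have := good_code_cost mG mword meword G0.
have -> : ln #|{ffun 'I_n -> option 'I_K}|%:R = n%:R * ln K.+1%:R :> R.
  by rewrite card_ffun card_option !card_ord natrX lnXn// mulr_natl.
have : ln 2 <= 1 :> R by apply: le_trans (ln_le_sub1 _) _ => //; lra.
lra.
Qed.

(** [q] is the conditional law of the words of length [L] on the good set. The last clause lets [z]
    be any choice of points spelling the words, so that each word can later be given one
    representative whose Birkhoff sum stands for it. *)
Lemma good_blocks (J : finType) (psi : J -> X -> R) (C e c : R) :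
  (forall j, bounded_measurable (psi j)) -> (forall j y, `|psi j y| <= C) ->
  (forall j (d : R), 0 < d -> exists r, forall y z, Y y -> Y z -> agree r y z ->
    `|psi j y - psi j z| < d) ->
  0 < e -> (c%:E < metric_entropy sigma P)%E ->
  exists A, forall L0, exists L B (q : {ffun 'I_L -> 'I_B.+1} -> R),
  [/\ (L0 <= L)%N, (0 < L)%N, forall u, 0 <= q u & \sum_u q u = 1] /\
  [/\ forall u, 0 < q u -> exists y, [/\ Y y, forall t : 'I_L, letter y t = u t,
        (letter y 0 <= A)%N & (letter y L.-1 <= A)%N],
      L%:R * (c - e) <= \sum_u q u * - ln (q u) &
      forall (z : {ffun 'I_L -> 'I_B.+1} -> X),
        (forall u, 0 < q u -> Y (z u) /\ forall t : 'I_L, letter (z u) t = u t) ->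
        forall j, `|\sum_u q u * birkhoff (psi j) L (z u) - L%:R * mean P (psi j)|
          <= L%:R * e].
Proof.
move=> bpsi psiC uc e0 clt.
have e80 : 0 < e / 8 by rewrite divr_gt0.
have [a [l [l0 [N NP]]]] := entropy_blocks e80 clt.
have C0 : 0 <= Num.max 0 C by rewrite le_max lexx.
set C' := Num.max 0 C in C0.
have psiC' j y : `|psi j y| <= C' by rewrite le_max psiC orbT.
(* Chosen so that the mass 3 e1 lost off [G] is at most 1 / 2, and costs at most e / 8 per site both
   in entropy (rate [l]) and in Birkhoff sums (rate [C']). *)
pose D := 1 + 4 / e * (l + C').
have D0 : 0 < D by rewrite ltr_wpDr// mulr_ge0 ?addr_ge0// divr_ge0// ltW.
pose e1 := 6^-1 / D.
have e10 : 0 < e1 by rewrite divr_gt0.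
have e1D : 3 * e1 * D = 2^-1 by rewrite /e1; field; rewrite gt_eqF.
have e1l : 3 * e1 * (l + C') <= e / 8.
  have : 3 * e1 * D = 3 * e1 + 4 / e * (3 * e1 * (l + C')) by rewrite /D; ring.
  rewrite e1D => E; have : 4 / e * (3 * e1 * (l + C')) <= 2^-1 by lra.
  by rewrite -ler_pdivlMl ?divr_gt0// invf_div => /le_trans; apply; lra.
have [A PA] := letter_bounded P e10; exists A => L0.
have /choice[rj rjP] := fun j => uc j _ e80.
pose r := (\max_j rj j)%N.
have [t1 t1P] : exists t : nat, ((2 * a%:R + 1) * `|c| + 2) / (e / 2) < t%:R.
  by eexists; exact: truncnS_gt.
have [t2 t2P] : exists t : nat, 8 * r%:R * C' / e < t%:R.
  by eexists; exact: truncnS_gt.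
(* [t1] absorbs the additive constant 2 and the 2 a + 1 letters by which [L] exceeds [n]; [t2]
   absorbs the edge errors 4 r C'. *)
pose n := (L0 + N + t1 + t2)%N.
have n1 : (2 * a%:R + 1) * `|c| + 2 <= n%:R * (e / 2).
  rewrite -ler_pdivrMr ?divr_gt0// ltW// (lt_le_trans t1P)// ler_nat.
  exact: leq_trans (leq_addl _ _) (leq_addr _ _).
have n2 : 8 * r%:R * C' <= n%:R * e.
  rewrite -ler_pdivrMr// ltW// (lt_le_trans t2P)// ler_nat; exact: leq_addl.
pose L := (n + 2 * a).+1.
have LR : L%:R = n%:R + 2 * a%:R + 1 :> R by rewrite /L -natr1 natrD natrM.
have [B [G [mG G1 GY GB GA]]] := good_set mY P_inv PY e10 PA (ltn0Sn (n + 2 * a)).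
have D1 : 1 <= D by rewrite lerDl mulr_ge0 ?addr_ge0// divr_ge0// ltW.
have e1half : 3 * e1 <= 2^-1.
  by rewrite -e1D ler_peMr// mulr_ge0// ltW.
have G0 : 0 < pr P G by lra.
have Gle1 : pr P G <= 1 by exact: pr_le1.
have mword := @measurable_letters_of R s L B.
have Gword y (t : 'I_L) : G y -> letter y t = letters_of L B y t.
  by move=> Gy; rewrite ffunE inordK// ltnS GB.
set q := word_law P G (letters_of L B).
have q0 u : 0 <= q u by exact: word_law_ge0.
have q1 : \sum_u q u = 1 by exact: word_law_sum1.
have qle1 u : q u <= 1 by rewrite -q1 (bigD1 u)//= lerDl sumr_ge0.
have prq u : pr P (G `&` letters_of L B @^-1` [set u]) = pr P G * q u.
  by rewrite /q /word_law mulrC divfK// gt_eqF.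
exists L, B, q; split.
  split=> //; rewrite /L ltnW// ltnS.
  have h := leq_trans (leq_addr N L0) (leq_addr t1 _).
  exact: leq_trans (leq_trans h (leq_addr t2 _)) (leq_addr _ _).
have badl : (1 - pr P G) * l <= e / 8.
  apply: le_trans e1l; apply: (@le_trans _ _ (3 * e1 * l)); first by rewrite ler_wpM2r//; lra.
  by rewrite ler_wpM2l ?lerDl// mulr_ge0// ltW.
have badC : (1 - pr P G) * C' <= e / 8.
  apply: le_trans e1l; apply: (@le_trans _ _ (3 * e1 * C')); first by rewrite ler_wpM2r//; lra.
  by rewrite ler_wpM2l ?lerDr// mulr_ge0// ltW.
split.
- move=> u qu; have : pr P (G `&` letters_of L B @^-1` [set u]) != 0.
    by rewrite prq mulf_neq0// gt_eqF.
  have [->|/set0P[y [Gy /= yu]] _] := eqVneq (G `&` letters_of L B @^-1` [set u]) set0.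
    by rewrite /pr measure0 eqxx.
  exists y; split=> [|t||]; [exact: GY|by rewrite Gword// yu|exact: (GA y Gy).1|].
  exact: (GA y Gy).2.
- have Nn : (N <= n)%N.
    exact: leq_trans (leq_trans (leq_addl L0 N) (leq_addr t1 _)) (leq_addr t2 _).
  have := NP L n B G Nn erefl mG G0 GB; rewrite -/q.
  set H := \sum_u _ * - ln _.
  have H0 : 0 <= H.
    by apply: sumr_ge0 => u _; rewrite mulr_ge0// oppr_ge0 ln_le0.
  have GH : pr P G * H <= H by rewrite ler_piMl.
  have : (1 - pr P G) * n%:R * l <= n%:R * (e / 8).
    by rewrite mulrAC mulrC ler_wpM2l.
  have : 0 <= (2 * a%:R + 1) * (`|c| - c) :> R.
    by rewrite mulr_ge0 ?subr_ge0 ?ler_norm// addr_ge0// mulr_ge0.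
  have : 0 <= (2 * a%:R + 1) * e :> R by rewrite mulr_ge0 ?ltW// addr_ge0// mulr_ge0.
  have : 0 <= n%:R * e by rewrite mulr_ge0// ltW.
  rewrite LR; move: n1; lra.
move=> z zP j.
pose g (v : {ffun 'I_L -> 'I_B.+1} + unit) :=
  if v is inl u then birkhoff (psi j) L (z u) else 0.
(* Where [q u] is 0 the point [z u] is arbitrary and only the trivial bound holds, but such cells
   have probability 0. Off [G] the trivial bound is weighted by the small mass 1 - pr P G. *)
pose tau (v : {ffun 'I_L -> 'I_B.+1} + unit) :=
  if v is inl u then (if 0 < q u then L%:R * (e / 8) + 4 * r%:R * C' else 2 * (L%:R * C'))
  else L%:R * C'.
have munit w : measurable ((fun _ : X => tt) @^-1` [set w]).
  by rewrite (_ : _ @^-1` _ = setT)//; apply/seteqP; split=> // y _; case: w.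
pose cell := good_cell G (letters_of L B) (fun=> tt).
have mcell v : measurable (cell @^-1` [set v]) by exact: measurable_good_cell.
have close y : `|birkhoff (psi j) L y - g (cell y)| <= tau (cell y).
  rewrite /cell /good_cell; case: asboolP => Gy /=; last first.
    by rewrite subr0; exact: birkhoff_le.
  case: ifPn => [qu|_].
    have [zY zu] := zP _ qu.
    apply: (birkhoff_window (psiC' j) (ltW e80)) Y_shift (GY _ Gy) zY _.
      move=> y1 y2 Y1 Y2 y12; apply: (rjP j) => //; apply: agree_le y12.
      exact: (leq_bigmax (F := rj)).
    by move=> i iL; rewrite (Gword y (Ordinal iL))// -zu.
  rewrite mulr2n mulrDl mul1r (le_trans (ler_normB _ _))// lerD//; exact: birkhoff_le.
have := mean_cell_approx P mcell (bounded_measurable_birkhoff L (bpsi j)) close.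
rewrite mean_birkhoff// !big_sumType/=.
have prl u : pr P (cell @^-1` [set inl u]) = pr P G * q u.
  by rewrite /cell good_cell_inl prq.
have prr : \sum_(w : unit) pr P (cell @^-1` [set inr w]) = 1 - pr P G.
  rewrite -pr_setC// (pr_cells P munit (measurableC mG)).
  by apply: eq_bigr => w _; rewrite /cell good_cell_inr.
rewrite [X in _ - (_ + X)]big1 ?addr0 => [|w _]; last by rewrite mulr0.
rewrite -[X in _ <= _ + X]mulr_suml prr.
set S := \sum_u q u * _.
have -> : \sum_u pr P (cell @^-1` [set inl u]) * birkhoff (psi j) L (z u) = pr P G * S.
  by rewrite mulr_sumr; apply: eq_bigr => u _; rewrite prl mulrA.
have h2 : \sum_u pr P (cell @^-1` [set inl u]) *
    (if 0 < q u then L%:R * (e / 8) + 4 * r%:R * C' else 2 * (L%:R * C')) <=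
    L%:R * (e / 8) + 4 * r%:R * C'.
  apply: (@le_trans _ _ (\sum_u q u * (L%:R * (e / 8) + 4 * r%:R * C'))).
    apply: ler_sum => u _; rewrite prl; case: ifPn => [qu|].
      rewrite ler_wpM2r//; last by rewrite ler_piMl.
      by rewrite addr_ge0// mulr_ge0// ltW.
    rewrite -leNgt => qu; have -> : q u = 0 by apply/eqP; rewrite eq_le qu q0.
    by rewrite mulr0 !mul0r.
  by rewrite -mulr_suml q1 mul1r.
have h3 : `|S| <= L%:R * C'.
  apply: le_trans (ler_norm_sum _ _ _) _.
  apply: (@le_trans _ _ (\sum_u q u * (L%:R * C'))); last by rewrite -mulr_suml q1 mul1r.
  by apply: ler_sum => u _; rewrite normrM (ger0_norm (q0 u)) ler_wpM2l// birkhoff_le.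
have h4 : (1 - pr P G) * (L%:R * C') <= L%:R * (e / 8).
  by rewrite mulrCA ler_wpM2l.
have h5 : `|(1 - pr P G) * S| <= (1 - pr P G) * (L%:R * C').
  by rewrite normrM ger0_norm ?subr_ge0// ler_wpM2l// subr_ge0.
have h6 : 4 * r%:R * C' <= L%:R * (e / 2).
  have : n%:R * e <= L%:R * e.
    by rewrite ler_wpM2r ?ler_nat ?(ltW e0)// /L ltnW// ltnS leq_addr.
  by move: n2; lra.
have Le : 0 <= L%:R * e by rewrite mulr_ge0// ltW.
rewrite distrC => h1.
have -> : S - L%:R * mean P (psi j) = (pr P G * S - L%:R * mean P (psi j)) + (1 - pr P G) * S.
  by ring.
apply: (le_trans (ler_normD _ _)).
by clear -h1 h2 h4 h5 h6 Le; lra.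
Qed.

End good_blocks_main.

(** * Words, loops and Birkhoff sums along words *)

Section words.
Context {R : realType} {s : sidedness} (M : rel nat).
Local Notation X := (sequence_space R s nat).
Local Notation sigma := (@shift_map R s nat).
Local Notation Sigma := (markov_shift R s M).
Implicit Types (y z : X) (v w : seq nat) (psi : X -> R).

Definition spells v y := forall l, (l < size v)%N -> letter y l = nth 0%N v l.

Lemma spells_cat v w y :
  spells (v ++ w) y <-> spells v y /\ spells w (iter (size v) sigma y).
Proof.
split=> [vw|[vy wy] l]; first split=> l lv.
- by rewrite vw ?size_cat ?ltn_addr// nth_cat lv.
- rewrite letter_iter_shift vw ?size_cat ?[(l + _)%N]addnC ?ltn_add2l// nth_cat.
  by rewrite ltnNge leq_addr/= addKn.
rewrite size_cat nth_cat => lvw; have [lv|vl] := ltnP l (size v); first exact: vy.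
rewrite -wy; last by rewrite ltn_subLR.
by rewrite letter_iter_shift subnK.
Qed.

Lemma spells_sorted v y : Sigma y -> spells v y -> sorted M v.
Proof.
move=> yM; case: v => [//|a v] vy; apply/(pathP 0%N) => i iv.
rewrite -[nth _ v i]/(nth 0%N (a :: v) i.+1) -(vy i.+1)// -(vy i)/=; last exact: ltnW.
by have := yM (site_of_nat s i); rewrite /letter -addn1 -site_of_nat_add.
Qed.

(** Quantifying over all points that spell [v] makes this a property of the word, so that centres
    and errors add up under concatenation. *)
Definition birkhoff_near psi v (c t : R) := forall y, Sigma y -> spells v y ->
  `|birkhoff psi (size v) y - c| <= t.

Lemma birkhoff_near_cat psi v w c c' t t' : birkhoff_near psi v c t ->
  birkhoff_near psi w c' t' -> birkhoff_near psi (v ++ w) (c + c') (t + t').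
Proof.
move=> vc wc y yM /spells_cat[vy wy]; rewrite size_cat birkhoffD opprD addrACA.
apply: le_trans (ler_normD _ _) _; apply: lerD; first exact: vc.
by apply: wc => //; exact: markov_shift_iter.
Qed.

Lemma birkhoff_near_nil psi : birkhoff_near psi [::] 0 0.
Proof. by move=> y _ _; rewrite /birkhoff big_ord0 subrr normr0. Qed.

Lemma birkhoff_near_flatten psi (I : Type) (r : seq I) (wd : I -> seq nat) (c t : I -> R) :
  (forall i, birkhoff_near psi (wd i) (c i) (t i)) ->
  birkhoff_near psi (flatten [seq wd i | i <- r]) (\sum_(i <- r) c i) (\sum_(i <- r) t i).
Proof.
move=> h; elim: r => [|i r IH]; first by rewrite !big_nil; exact: birkhoff_near_nil.
by rewrite /= !big_cons; apply: birkhoff_near_cat.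
Qed.

Lemma birkhoff_near_trivial psi v C : (forall y, `|psi y| <= C) ->
  birkhoff_near psi v 0 ((size v)%:R * C).
Proof. by move=> psiC y _ _; rewrite subr0; exact: birkhoff_le. Qed.

Lemma birkhoff_near_le psi v c t c' t' : birkhoff_near psi v c t ->
  `|c - c'| + t <= t' -> birkhoff_near psi v c' t'.
Proof.
move=> vc tt' y yM vy; apply: le_trans tt'; rewrite -(subrKA c) addrC.
by apply: le_trans (ler_normD _ _) _; rewrite lerD2l; exact: vc.
Qed.

(* The default value [b.+1] excludes the empty word. *)
Definition loop_at b w := (head b.+1 w == b) && cycle M w.

Lemma loop_at_cons b p : loop_at b (b :: p) = path M b (rcons p b).
Proof. by rewrite /loop_at/= eqxx. Qed.

Lemma loop_atP b w : loop_at b w -> exists2 p, w = b :: p & path M b (rcons p b).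
Proof.
case: w => [|a p]; first by rewrite /loop_at/=; have := ltnSn b; lia.
by rewrite /loop_at/= => /andP[/eqP -> ?]; exists p.
Qed.

Lemma loop_at_cat b v w : loop_at b v -> loop_at b w -> loop_at b (v ++ w).
Proof.
move=> /loop_atP[p -> bp] /loop_atP[q -> bq].
by rewrite cat_cons loop_at_cons rcons_cat cat_path rcons_cons/=;
   move: bp; rewrite rcons_path => /andP[-> ->] /=.
Qed.

Lemma loop_at_flatten b (r : seq (seq nat)) : (0 < size r)%N ->
  (forall w, w \in r -> loop_at b w) -> loop_at b (flatten r).
Proof.
case: r => [//|w r] _; elim: r w => [|v r IH] w h /=.
  by rewrite cats0 h// mem_head.
apply: loop_at_cat; first by rewrite h// mem_head.
by apply: (IH v) => u ur; apply: h; rewrite inE ur orbT.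
Qed.

(** Transitivity admits the one-letter word when [a] equals [b], whereas a bridge must make at least
    one transition. The detour through a letter [c] different from [a] forces one. *)
Lemma bridge (M_transitive : topologically_transitive M) a b :
  exists w, path M a (rcons w b).
Proof.
pose c := if a == 0%N then 1%N else 0%N.
have ca : c != a by rewrite /c; case: (a =P 0%N) => [->|/eqP]; rewrite // eq_sym.
have [w1 [w1M w1c]] := M_transitive a c; have [w2 [w2M w2b]] := M_transitive c b.
case/lastP: w1 w1M w1c => [|w1 c'] w1M w1c; first by rewrite -w1c eqxx in ca.
rewrite last_rcons in w1c; rewrite {c'}w1c in w1M.
case/lastP: w2 w2M w2b => [|w2 b'] w2M w2b.
  by exists w1; rewrite -w2b.
rewrite last_rcons in w2b; rewrite {b'}w2b in w2M.
exists (rcons w1 c ++ w2); rewrite rcons_cat cat_path last_rcons.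
exact/andP.
Qed.

Lemma loop_through (br : nat -> nat -> seq nat) b v :
  (forall a c, path M a (rcons (br a c) c)) -> (0 < size v)%N -> sorted M v ->
  loop_at b (b :: br b (head 0%N v) ++ v ++ br (last 0%N v) b).
Proof.
move=> brM; case: v => [//|a v] _ /= av; rewrite loop_at_cons.
rewrite -cat_rcons rcons_cat cat_path brM last_rcons/= rcons_cat cat_path av/=.
exact: brM.
Qed.

End words.

Lemma pigeonhole_fiber (T U : finType) (A : pred T) (f : T -> U) : (0 < #|A|)%N ->
  exists u, (#|A| <= #|U| * #|[pred t | A t & f t == u]|)%N.
Proof.
move=> /card_gt0P[t0 _].
have [u _ uP] := @arg_maxnP U (f t0) xpredT (fun u => #|[pred t | A t & f t == u]|) isT.
exists u; rewrite -sum1_card (partition_big f xpredT)//=.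
apply: (@leq_trans (\sum_(v : U) #|[pred t | A t & f t == u]|)); last by rewrite sum_nat_const.
by apply: leq_sum => v _; rewrite sum1_card; exact: uP.
Qed.

Section loop_words.
Context {R : realType} {s : sidedness} (M : rel nat).
Local Notation X := (sequence_space R s nat).
Local Notation sigma := (@shift_map R s nat).
Local Notation Sigma := (markov_shift R s M).
Hypothesis M_transitive : topologically_transitive M.
Variable P : probability X R.
Hypotheses (P_inv : forall A, measurable A -> P (sigma @^-1` A) = P A)
  (PSigma : P Sigma = 1%E).
Variables (J : finType) (psi : J -> X -> R) (C : R).
Hypotheses (bpsi : forall j, bounded_measurable (psi j)) (psiC : forall j y, `|psi j y| <= C)
  (uc : forall j (d : R), 0 < d -> exists r, forall y z, Sigma y -> Sigma z ->
    agree r y z -> `|psi j y - psi j z| < d).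

(** The parameters are fixed in the order [A], bridge bound [T], [L], [N], so that [L] can be made
    large against everything that is paid once per block. *)
Lemma loop_words (b N0 : nat) (e c : R) : 0 < e -> (c%:E < metric_entropy sigma P)%E ->
  exists m (W : seq (seq nat)),
  [/\ (N0 <= m)%N, (0 < m)%N, uniq W & expR (m%:R * (c - e)) <= (size W)%:R] /\
  forall w, w \in W -> [/\ size w = m, loop_at M b w &
    forall j, birkhoff_near M (psi j) w (m%:R * mean P (psi j)) (m%:R * e)].
Proof.
move=> e0 clt; pose e' := e / 8.
have e'0 : 0 < e' by rewrite divr_gt0.
have C0 : 0 <= Num.max 0 C by rewrite le_max lexx.
set C' := Num.max 0 C in C0.
have psiC' j y : `|psi j y| <= C' by rewrite le_max psiC orbT.
have /choice[rj rjP] := fun j => uc j e'0.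
pose r := (\max_j rj j)%N.
have rP j y z : Sigma y -> Sigma z -> agree r y z -> `|psi j y - psi j z| < e'.
  move=> yM zM yz; apply: rjP => //; apply: agree_le yz.
  exact: (leq_bigmax (F := rj)).
have /choice[br0 br0P] : forall ab : nat * nat, exists w, path M ab.1 (rcons w ab.2).
  by move=> [a a']; exact: bridge.
pose br a a' := br0 (a, a').
have brP a a' : path M a (rcons (br a a') a') by exact: (br0P (a, a')).
have [A AP] := good_blocks (@measurable_markov_shift R s M)
  (fun y t => @markov_shift_iter R s M t y)
  P_inv PSigma bpsi psiC uc e'0 clt.
pose T := (\max_(a < A.+1) maxn (size (br b a)) (size (br a b)))%N.
have Tl (a : nat) : (a <= A)%N -> (size (br b a) <= T)%N /\ (size (br a b) <= T)%N.
  move=> aA; have := leq_bigmax (F := fun a : 'I_A.+1 => maxn (size (br b a)) (size (br a b)))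
    (Ordinal (aA : (a < A.+1)%N)).
  by rewrite /= geq_max => /andP.
pose T2 : R := (2 * T + 1)%N%:R.
(* The losses per block: typicality, the pigeonhole over pairs of end letters, the factor 1 / 2 in
   the count, the growth of the exponent by the added letters, the edge error of the word, and the
   Birkhoff sums over added letters. [L0] makes their sum at most L e'. *)
pose K1 := e' + 2 * ln A.+1%:R + ln 2 + T2 * `|c - e| + 4 * r%:R * C' + 2 * T2 * C'.
have [L0 L0P] : exists L0 : nat, K1 / e' < L0%:R by eexists; exact: truncnS_gt.
have [L [B [q [[L0L Lpos q0 q1] [qP qH qavg]]]]] := AP L0.
have K1L : K1 <= L%:R * e'.
  by rewrite -ler_pdivrMr// (le_trans (ltW L0P))// ler_nat.
pose F := {ffun 'I_L -> 'I_B.+1}.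
have /choice[z zP] : forall u : F, exists y, 0 < q u -> [/\ Sigma y,
    forall t : 'I_L, letter y t = u t, (letter y 0 <= A)%N & (letter y L.-1 <= A)%N].
  move=> u; have [qu|_] := boolP (0 < q u); last by exists (fun=> 0%N).
  by have [y yP] := qP u qu; exists y.
have {}qavg := qavg z (fun u qu => let: And4 h1 h2 _ _ := zP u qu in conj h1 h2).
pose wd (u : F) : seq nat := [seq val (u t) | t <- enum 'I_L].
have wd_size u : size (wd u) = L by rewrite size_map size_enum_ord.
have wd_nth u (t : 'I_L) : nth 0%N (wd u) t = u t.
  by rewrite (nth_map t) ?size_enum_ord// nth_ord_enum.
have spells_wd u y : spells (wd u) y <-> forall t : 'I_L, letter y t = u t.
  rewrite /spells wd_size; split=> [h t|h l lL]; first by rewrite h.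
  by rewrite (h (Ordinal lL)) -wd_nth.
have wd_inj : injective wd.
  by move=> u v uv; apply/ffunP => t; apply: val_inj; rewrite /= -!wd_nth uv.
pose fst_ u := head 0%N (wd u).
pose lst_ u := last 0%N (wd u).
have fst_le u : 0 < q u -> (fst_ u <= A)%N.
  move=> /zP[_ zu zA _]; rewrite /fst_ -nth0 -[0%N]/(val (Ordinal Lpos)) wd_nth -zu.
  exact: zA.
have lst_le u : 0 < q u -> (lst_ u <= A)%N.
  have Llt : (L.-1 < L)%N by rewrite prednK.
  move=> /zP[_ zu _ zA]; rewrite /lst_ -nth_last wd_size -[L.-1]/(val (Ordinal Llt)) wd_nth -zu.
  exact: zA.
pose ell u := b :: br b (fst_ u) ++ wd u ++ br (lst_ u) b.
have ell_loop u : 0 < q u -> loop_at M b (ell u).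
  move=> qu; apply: loop_through => //; first by rewrite wd_size.
  have [zM zu _ _] := zP u qu; apply: (spells_sorted zM).
  exact/spells_wd.
have ell_size u : size (ell u) = (L + (size (br b (fst_ u)) + size (br (lst_ u) b)).+1)%N.
  by rewrite /= !size_cat wd_size; lia.
have Tell u : 0 < q u -> (size (br b (fst_ u)) + size (br (lst_ u) b) <= 2 * T)%N.
  move=> qu; rewrite mul2n -addnn leq_add//.
    exact: (Tl _ (fst_le u qu)).1.
  exact: (Tl _ (lst_le u qu)).2.
pose g j u := birkhoff (psi j) L (z u).
pose tl : R := T2 * C' + (L%:R * e' + 4 * r%:R * C').
have ell_near j u : 0 < q u -> birkhoff_near M (psi j) (ell u) (g j u) tl.
  move=> qu; have [zM zu _ _] := zP u qu.
  have wd_near : birkhoff_near M (psi j) (wd u) (g j u) (L%:R * e' + 4 * r%:R * C').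
    move=> y yM; rewrite wd_size => /spells_wd yu.
    apply: (birkhoff_window (psiC' j) (ltW e'0) (rP j)) => //.
      by move=> y' t; exact: markov_shift_iter.
    by move=> l lL; rewrite (yu (Ordinal lL)) -zu.
  rewrite /ell -cat_cons.
  have nb v := @birkhoff_near_trivial R s M (psi j) v C' (psiC' j).
  apply: (birkhoff_near_le (birkhoff_near_cat (nb (b :: br b (fst_ u)))
    (birkhoff_near_cat wd_near (nb (br (lst_ u) b))))).
  have hs : (size (b :: br b (fst_ u)))%:R * C' + (size (br (lst_ u) b))%:R * C' <= T2 * C'.
    by rewrite -mulrDl ler_wpM2r// -natrD ler_nat /= addSn addn1 ltnS Tell.
  rewrite add0r addr0 subrr normr0 add0r /tl addrCA [leRHS]addrC lerD2l.
  exact: hs.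
have [N1 N1P] := typical_sequences q0 q1 g e'0.
pose N := (N0 + N1).+1.
pose H := \sum_u q u * - ln (q u).
pose Typ := [pred w : {ffun 'I_N -> F} | [forall i, 0 < q (w i)] &&
  [forall j, `|\sum_i g j (w i) - N%:R * \sum_u q u * g j u| <= N%:R * e']].
have typN : expR (N%:R * (H - e')) / 2 <= #|Typ|%:R.
  exact: N1P N (leq_trans (leq_addl N0 N1) (leqnSn _)).
have Typ_gt0 : (0 < #|Typ|)%N.
  by rewrite -(ltr0n R); apply: lt_le_trans typN; rewrite divr_gt0// expR_gt0.
(* The end letters of a block determine its two bridges, hence the length of its loop; sequences
   with a common profile give words that are cut at the same places. *)
pose prof (w : {ffun 'I_N -> F}) : {ffun 'I_N -> 'I_A.+1 * 'I_A.+1} :=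
  [ffun i => (inord (fst_ (w i)), inord (lst_ (w i)))].
have [p pP] := pigeonhole_fiber prof Typ_gt0.
pose S := [pred w | Typ w & prof w == p].
have S_gt0 : (0 < #|S|)%N.
  by rewrite lt0n; apply: contraTneq pP => S0; rewrite -ltnNge S0 muln0.
pose concat (w : {ffun 'I_N -> F}) := flatten [seq ell (w i) | i <- enum 'I_N].
have Typ_q w i : Typ w -> 0 < q (w i) by move=> /andP[/forallP].
have S_fst w w' i : S w -> S w' -> fst_ (w i) = fst_ (w' i) /\ lst_ (w i) = lst_ (w' i).
  move=> /andP[Tw /eqP wp] /andP[Tw' /eqP w'p].
  have : prof w i = prof w' i by rewrite wp w'p.
  rewrite !ffunE => -[/(congr1 val) /= E1 /(congr1 val) /= E2]; move: E1 E2.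
  by rewrite !inordK ?ltnS ?fst_le ?lst_le ?Typ_q.
have shape_eq w w' : S w -> S w' ->
    shape [seq ell (w i) | i <- enum 'I_N] = shape [seq ell (w' i) | i <- enum 'I_N].
  move=> Sw Sw'; rewrite /shape -!map_comp; apply: eq_map => i.
  have [E1 E2] := S_fst w w' i Sw Sw'.
  by rewrite -[LHS]/(size (ell (w i))) -[RHS]/(size (ell (w' i))) !ell_size E1 E2.
(* Equal shapes allow the concatenation to be cut back into loops, and equal bridges allow each loop
   to be stripped down to its block. *)
have concat_inj : {in S &, injective concat}.
  move=> w w' Sw Sw' /eq_from_flatten_shape/(_ (shape_eq _ _ Sw Sw')) /eq_in_map E.
  apply/ffunP => i; have := E i; rewrite mem_enum => /(_ isT).
  have [E1 E2] := S_fst w w' i Sw Sw'.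
  rewrite /ell E1 => -[] /eqP; rewrite eqseq_cat// eqxx/= eqseq_cat ?wd_size// => /andP[/eqP].
  by move=> /wd_inj.
have /card_gt0P[w0 Sw0] := S_gt0.
pose m := size (concat w0).
have concat_size w : S w -> size (concat w) = m.
  by move=> Sw; rewrite /m /concat !size_flatten (shape_eq w w0).
have mE : m = (\sum_i size (ell (w0 i)))%N.
  rewrite /m /concat size_flatten /shape -map_comp sumnE big_map big_enum/=.
  by [].
have Sw0q i : 0 < q (w0 i) by apply: Typ_q; case/andP: Sw0.
have mlow : (N * L <= m)%N.
  rewrite mE -[N in (N * _)%N]card_ord -sum_nat_const; apply: leq_sum => i _.
  by rewrite ell_size leq_addr.
have mupp : (m <= N * (L + (2 * T + 1)))%N.
  rewrite mE -[N in leqRHS]card_ord -sum_nat_const; apply: leq_sum => i _.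
  by rewrite ell_size leq_add2l addn1 ltnS Tell.
pose W := [seq concat w | w <- enum S].
exists m, W; split; first split.
- apply: leq_trans mlow; apply: leq_trans (leq_pmulr _ Lpos).
  exact: leq_trans (leq_addr N1 N0) (leqnSn _).
- by apply: leq_trans mlow; rewrite muln_gt0.
- rewrite map_inj_in_uniq ?enum_uniq// => w w'; rewrite !mem_enum; exact: concat_inj.
- rewrite size_map -cardE.
  have Scard : #|Typ|%:R <= (A.+1%:R ^+ 2) ^+ N * #|S|%:R :> R.
    apply: (@le_trans _ _ (#|{ffun 'I_N -> 'I_A.+1 * 'I_A.+1}| * #|S|)%N%:R).
      by rewrite ler_nat.
    by rewrite card_ffun card_prod !card_ord natrM natrX natrM expr2.
  have mlowR : N%:R * L%:R <= m%:R :> R by rewrite -natrM ler_nat.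
  have muppR : m%:R <= N%:R * (L%:R + T2) :> R by rewrite -natrD -natrM ler_nat.
  have A0 : 0 < A.+1%:R :> R by [].
  (* The length [m] exceeds N L by at most N T2, and c - e may have either sign; hence the absolute
     value in [K1]. *)
  have expo : m%:R * (c - e) + ln A.+1%:R * (2 * N)%:R + ln 2 <= N%:R * (H - e').
    have g1 : (m%:R - N%:R * L%:R) * (c - e) <= N%:R * (T2 * `|c - e|).
      apply: (@le_trans _ _ ((m%:R - N%:R * L%:R) * `|c - e|)).
        by rewrite ler_wpM2l ?ler_norm// subr_ge0.
      by rewrite mulrA ler_wpM2r//; clear -muppR; lra.
    have g2 : N%:R * K1 <= N%:R * (L%:R * e') by rewrite ler_wpM2l.
    have g3 : N%:R * (L%:R * (c - e')) <= N%:R * H by rewrite ler_wpM2l.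
    have g4 : ln 2 <= N%:R * ln 2 :> R by rewrite ler_peMl ?ln_ge0 ?ler1n.
    have g5 : 0 <= N%:R * (4 * r%:R * C' + 2 * T2 * C').
      by rewrite mulr_ge0// addr_ge0// !mulr_ge0.
    have g6 : 0 <= N%:R * (L%:R * e) by rewrite !mulr_ge0// ltW.
    have e'E : e' = e / 8 by [].
    rewrite natrM /K1 e'E in g1 g2 g3 g4 g5 g6 *.
    by clear -g1 g2 g3 g4 g5 g6; lra.
  have e1 : expR (m%:R * (c - e)) * ((A.+1%:R ^+ 2) ^+ N) * 2 <= expR (N%:R * (H - e')).
    rewrite -exprM -[X in _ * X ^+ _ * _]lnK ?posrE// -expRM_natr -[X in _ * X]lnK ?posrE//.
    by rewrite -!expRD ler_expR.
  have p0 : 0 < (A.+1%:R ^+ 2) ^+ N :> R by rewrite !exprn_gt0.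
  rewrite -(ler_pM2l p0); apply: le_trans Scard; apply: le_trans typN.
  by rewrite ler_pdivlMr// [X in X * 2]mulrC.
move=> _ /mapP[w + ->]; rewrite mem_enum => Sw.
have Tw : Typ w by case/andP: Sw.
split=> [||j]; first exact: concat_size.
- apply: loop_at_flatten; first by rewrite size_map size_enum_ord.
  by move=> _ /mapP[i _ ->]; apply: ell_loop; exact: Typ_q.
have nearF := @birkhoff_near_flatten R s M (psi j) _ (enum 'I_N) (fun i => ell (w i))
  (fun i => g j (w i)) (fun=> tl) (fun i => ell_near j (w i) (Typ_q w i Tw)).
apply: (birkhoff_near_le nearF).
rewrite !big_enum/= sumr_const card_ord -[tl *+ N]mulr_natl.
set G := \sum_(i < N) g j (w i); set mu := mean P (psi j).
have h1 : `|G - N%:R * \sum_u q u * g j u| <= N%:R * e'.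
  by case/andP: Tw => _ /forallP/(_ j).
have h2 : N%:R * `|(\sum_u q u * g j u) - L%:R * mu| <= N%:R * (L%:R * e').
  by rewrite ler_wpM2l// qavg.
have h3 : `|N%:R * L%:R * mu - m%:R * mu| <= N%:R * (T2 * C').
  rewrite -mulrBl normrM mulrA; apply: ler_pM => //; last exact: mean_norm_le.
  rewrite distrC ger0_norm ?subr_ge0 -?natrM ?ler_nat// -natrB// ler_nat.
  by rewrite leq_subLR -mulnDr.
have h4 : N%:R * K1 <= N%:R * (L%:R * e') by rewrite ler_wpM2l.
have h5 : N%:R * L%:R * e <= m%:R * e.
  by rewrite -natrM ler_wpM2r ?(ltW e0)// ler_nat.
have -> : G - m%:R * mu = (G - N%:R * \sum_u q u * g j u) +
    N%:R * ((\sum_u q u * g j u) - L%:R * mu) + (N%:R * L%:R * mu - m%:R * mu) by ring.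
have h6 := ler_normD (G - N%:R * \sum_u q u * g j u + N%:R * ((\sum_u q u * g j u) - L%:R * mu))
  (N%:R * L%:R * mu - m%:R * mu).
have h7 := ler_normD (G - N%:R * \sum_u q u * g j u)
   (N%:R * ((\sum_u q u * g j u) - L%:R * mu)).
rewrite [X in _ <= _ + X]normrM ger0_norm// in h7.
have h8 : 0 <= N%:R * (2 * ln A.+1%:R + ln 2 + T2 * `|c - e|).
  rewrite mulr_ge0// !addr_ge0// ?mulr_ge0// ?ln_ge0// ?ler1n//.
have h9 : 0 <= N%:R * (L%:R * e) by rewrite !mulr_ge0// ltW.
have e'E : e' = e / 8 by [].
by rewrite /tl /K1 e'E in h1 h2 h3 h4 h5 h6 h7 h8 h9 *;
   clear -h1 h2 h3 h4 h5 h6 h7 h8 h9; lra.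
Qed.

End loop_words.

(** * Horseshoes *)

Definition site_scale (s : sidedness) (n : nat) : site s -> site s :=
  match s with OneSided => fun i : nat => (i * n)%N | TwoSided => fun i : int => i * n%:Z end.

(* Floor division, so that blocks tile the negative sites as well. *)
Definition site_div (s : sidedness) (n : nat) : site s -> site s :=
  match s with
  | OneSided => fun p : nat => (p %/ n)%N
  | TwoSided => fun p : int => (p %/ n%:Z)%Z
  end.

Definition site_mod (s : sidedness) (n : nat) : site s -> nat :=
  match s with
  | OneSided => fun p : nat => (p %% n)%N
  | TwoSided => fun p : int => absz (p %% n%:Z)%Z
  end.

Lemma site_add_add s (p : site s) t u : site_add (site_add p t) u = site_add p (t + u).
Proof. by rewrite /site_add addnC iterD. Qed.

Section blocks.
Variables (s : sidedness) (n : nat).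
Hypothesis n_gt0 : (0 < n)%N.
Implicit Types p i : site s.

Lemma site_mod_lt p : (site_mod n p < n)%N.
Proof.
case: s p => /= p; first exact: ltn_pmod.
by have := @ltz_pmod p n%:Z; have := @modz_ge0 p n%:Z; lia.
Qed.

Lemma site_divmod p : p = site_add (site_scale n (site_div n p)) (site_mod n p).
Proof.
case: s p => /= p; first by rewrite site_addE_one -divn_eq.
rewrite site_addE_two gez0_abs; first exact: divz_eq.
by apply: modz_ge0; lia.
Qed.

Lemma site_div_add i l : (l < n)%N -> site_div n (site_add (site_scale n i) l) = i.
Proof.
case: s i => /= i ln; first by rewrite site_addE_one divnMDl// divn_small ?addn0.
rewrite site_addE_two divzMDl; last by lia.
by rewrite divz_small ?addr0//; lia.
Qed.

Lemma site_mod_add i l : (l < n)%N -> site_mod n (site_add (site_scale n i) l) = l.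
Proof.
case: s i => /= i ln; first by rewrite site_addE_one modnMDl modn_small.
by rewrite site_addE_two modzMDl modz_small//; lia.
Qed.

Lemma site_scale_succ i : site_scale n (site_succ i) = site_add (site_scale n i) n.
Proof.
case: s i => /= i; first by rewrite site_addE_one mulSn addnC.
by rewrite site_addE_two mulrDl mul1r.
Qed.

Lemma site_scale_nat t : site_scale n (site_of_nat s t) = site_of_nat s (t * n).
Proof. by case: s => //=; lia. Qed.

Lemma site_abs_div p : (site_abs (site_div n p) <= site_abs p)%N.
Proof.
case: s p => /= p; first exact: leq_div.
have := divz_eq p n%:Z; have := @ltz_pmod p n%:Z; have := @modz_ge0 p n%:Z.
set q := (p %/ _)%Z; set r := (p %% _)%Z => r0 rn E; nia.
Qed.

Lemma site_abs_add i l : (site_abs (site_add (site_scale n i) l) <= site_abs i * n + l)%N.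
Proof.
case: s i => /= i; first by rewrite site_addE_one.
by rewrite site_addE_two; nia.
Qed.

End blocks.

Section horseshoe.
Context {R : realType} {s : sidedness}.
Local Notation X := (sequence_space R s nat).
Local Notation sigma := (@shift_map R s nat).
Implicit Types (y z : X) (W : seq (seq nat)).
Variable n : nat.
Hypothesis n_gt0 : (0 < n)%N.

Definition block y (i : site s) : seq nat :=
  [seq y (site_add (site_scale n i) l) | l <- iota 0 n].

(** The blocks sit exactly at the multiples of [n], so they can be read off the point whatever the
    words are, and the coding is injective. *)
Definition horseshoe W : set X := [set y | forall i, block y i \in W].

Lemma size_block y i : size (block y i) = n.
Proof. by rewrite size_map size_iota. Qed.

Lemma nth_block y i l : (l < n)%N -> nth 0%N (block y i) l = y (site_add (site_scale n i) l).
Proof. by move=> ln; rewrite (nth_map 0%N) ?size_iota// nth_iota. Qed.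

Lemma block_eq y z i : (forall l, (l < n)%N ->
  y (site_add (site_scale n i) l) = z (site_add (site_scale n i) l)) -> block y i = block z i.
Proof. by move=> yz; apply/eq_in_map => l; rewrite mem_iota => /yz. Qed.

Lemma agree_block y z i k : (site_abs i * n + n <= k)%N -> agree k y z ->
  block y i = block z i.
Proof.
move=> ik yz; apply: block_eq => l ln; apply: yz.
apply: (leq_trans (site_abs_add n_gt0 i l)); apply: leq_trans ik; by rewrite leq_add2l ltnW.
Qed.

Lemma block_iter_shift y i : block (iter n sigma y) i = block y (site_succ i).
Proof.
apply/eq_map => l; rewrite iter_shiftE site_add_add site_scale_succ site_add_add.
by rewrite addnC.
Qed.

Lemma horseshoe_shift W y : horseshoe W y -> horseshoe W (iter n sigma y).
Proof. by move=> yW i; rewrite block_iter_shift. Qed.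

Lemma horseshoe_iter_shift W y t : horseshoe W y -> horseshoe W (iter (t * n) sigma y).
Proof.
move=> yW; elim: t => [//|t IH]; rewrite mulSn iterD.
exact: horseshoe_shift.
Qed.

Lemma horseshoe_le W W' : {subset W <= W'} -> horseshoe W `<=` horseshoe W'.
Proof. by move=> WW y yW i; exact/WW/yW. Qed.

Lemma horseshoe_closed W : closed (horseshoe W).
Proof.
rewrite -[horseshoe W]setCK; apply: open_closedC; apply/open_agreeP => y /existsNP[i yi].
exists (site_abs i * n + n)%N => z yz zW; apply: yi.
by rewrite (agree_block (leqnn _) yz).
Qed.

Lemma horseshoe_compact W : compact (horseshoe W).
Proof.
apply: compact_finite_letters; first exact: horseshoe_closed.
move=> p; exists (flatten W) => y yW.
apply/flattenP; exists (block y (site_div n p)) => //.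
rewrite [p in y p](site_divmod n_gt0 p) -nth_block ?site_mod_lt//.
by rewrite mem_nth// size_block site_mod_lt.
Qed.

Lemma horseshoe_sub_markov M b W : (forall w, w \in W -> loop_at M b w) ->
  horseshoe W `<=` markov_shift R s M.
Proof.
move=> WM y yW p; pose i := site_div n p; pose l := site_mod n p.
have ln : (l < n)%N by exact: site_mod_lt.
(* Every block starts with [b], so the block followed by [b] spells the sites up to [n] included;
   transitions inside a block and across its end are then steps of the same closed path. *)
have nthb j : (j <= n)%N ->
    nth 0%N (rcons (block y i) b) j = y (site_add (site_scale n i) j).
  rewrite leq_eqVlt => /predU1P[->|jn].
    rewrite nth_rcons size_block ltnn eqxx -site_scale_succ.
    have /WM/loop_atP[q E _] := yW (site_succ i).
    by have := nth_block y (site_succ i) n_gt0; rewrite E.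
  by rewrite nth_rcons size_block jn nth_block.
have pE : p = site_add (site_scale n i) l by exact: site_divmod.
have psE : site_succ p = site_add (site_scale n i) l.+1 by rewrite {1}pE.
rewrite psE {1}pE -nthb ?(ltnW ln)// -nthb//.
have /WM/loop_atP[q E] := yW i; rewrite E rcons_cons => /(pathP 0%N); apply.
by have := size_block y i; rewrite E /= size_rcons => ->.
Qed.

Section coding.
Variable W : seq (seq nat).
Hypotheses (W_size : forall w, w \in W -> size w = n).

Definition point_of (c : site s -> seq nat) : X :=
  fun p => nth 0%N (c (site_div n p)) (site_mod n p).

Lemma block_point_of (c : site s -> seq nat) i : size (c i) = n ->
  block (point_of c) i = c i.
Proof.
move=> cn; apply: (@eq_from_nth _ 0%N); first by rewrite size_block.
move=> l; rewrite size_block => ln.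
by rewrite nth_block// /point_of site_div_add// site_mod_add.
Qed.

Lemma point_of_block y : point_of (block y) = y.
Proof.
apply/funext => p; rewrite /point_of nth_block ?site_mod_lt//.
by rewrite -site_divmod.
Qed.

(** Both directions are local: block [i] is read in a window of radius n |i| + n, and site [p]
    depends only on the block containing it, whose index is at most |p| in absolute value. The
    default [q0] is used only outside the horseshoe. *)
Lemma horseshoe_conjugate : (0 < size W)%N ->
  conjugate_to_full_shift R s (horseshoe W) (iter n sigma).
Proof.
move=> W0; have w0W : nth [::] W 0 \in W by exact: mem_nth.
pose q0 : seq_sub W := SeqSub w0W.
exists (seq_sub W : finType); first by apply/card_gt0P; exists q0.
pose h (y : X) : sequence_space R s (seq_sub W) := fun i => insubd q0 (block y i).
pose h' (z : sequence_space R s (seq_sub W)) : X := point_of (fun i => val (z i)).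
exists h, h'; split.
- apply: continuous_subspaceT => y U /nbhs_agreeP[k kU]; apply/nbhs_agreeP.
  exists (k * n + n)%N => z yz; apply: kU => i ik; congr insubd.
  by apply: agree_block yz; rewrite leq_add2r leq_mul2r ik orbT.
- apply: continuous_subspaceT => y U /nbhs_agreeP[k kU]; apply/nbhs_agreeP.
  exists k => z yz; apply: kU => p pk; rewrite /h' /point_of yz//.
  exact: leq_trans (site_abs_div _ _) pk.
- move=> y yW; split=> //; rewrite -[RHS]point_of_block /h'; congr point_of.
  by apply/funext => i; rewrite /h val_insubd yW.
- move=> z _; have zn i : size (val (z i)) = n by apply: W_size; exact: valP.
  split=> [i|]; first by rewrite block_point_of//; exact: valP.
  by apply/funext => i; rewrite /h /h' block_point_of// valKd.
- by move=> y yW; apply/funext => i; rewrite /h /shift_map block_iter_shift.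
Qed.

End coding.
End horseshoe.

(** * Topological entropy *)

Section top_entropy.
Context {R : realType} (X : metricType R).
Implicit Types (f : X -> X) (K : set X).
Local Open Scope ereal_scope.

Definition growth_rate f K (e : R) : \bar R :=
  limn_esup (fun n => (n%:R^-1)%:E * lne (max_separated f K n e)).

Lemma max_separated_ge0 f K n (e : R) : 0 <= max_separated f K n e.
Proof.
apply: ereal_sup_ubound; exists (finmap.fset0 : {fset X}); last by rewrite cardfs0.
by split=> [y|y z] /=; rewrite in_fset0.
Qed.

Lemma le_lne (x y : \bar R) : 0 <= x -> x <= y -> lne x <= lne y.
Proof.
by move=> x0 xy; rewrite lee_lne// in_itv/= leey andbT//; exact: le_trans xy.
Qed.

Lemma le_ereal_supP (A B : set (\bar R)) :
  (forall x, A x -> exists2 y, B y & x <= y) -> ereal_sup A <= ereal_sup B.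
Proof.
move=> AB; apply: ge_ereal_sup => x /AB[y By xy].
by apply: le_trans xy _; exact: ereal_sup_ubound.
Qed.

Lemma limn_esup_ge (u : nat -> \bar R) (v : \bar R) :
  (forall n, (0 < n)%N -> v <= u n) -> v <= limn_esup u.
Proof.
move=> vu; apply: le_ereal_inf_tmp => _ [B [N _ NB] <-].
apply: le_trans (vu N.+1 (ltn0Sn N)) _; apply: ereal_sup_ubound.
by exists N.+1 => //; apply: NB => /=.
Qed.

Lemma limn_esup_subsequence (u v : nat -> \bar R) (n : nat) : (0 < n)%N ->
  (forall N, (0 < N)%N -> (n%:R^-1)%:E * u N <= v (n * N)%N) ->
  (n%:R^-1)%:E * limn_esup u <= limn_esup v.
Proof.
move=> n0 uv; have nR : (0 < n%:R :> R)%R by rewrite ltr0n.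
apply: le_ereal_inf_tmp => _ [B [K _ KB] <-].
rewrite lee_pdivrMl//.
apply: (@le_trans _ _ (ereal_sup (u @` [set N | (K.+1 <= N)%N]))).
  by apply: ereal_inf_lbound; exists [set N | (K.+1 <= N)%N] => //; exists K.+1.
apply: ge_ereal_sup => _ [N /= KN <-].
rewrite -lee_pdivrMl//; apply: le_trans (uv N (leq_ltn_trans (leq0n K) KN)) _.
apply: ereal_sup_ubound; exists (n * N)%N => //; apply: KB => /=.
by apply: leq_trans (leq_pmull N n0); exact: ltnW.
Qed.

Lemma growth_rate_anti f K (e e' : R) : (e <= e')%R ->
  growth_rate f K e' <= growth_rate f K e.
Proof.
move=> ee'; have := @limn_esup_subsequence
  (fun n => (n%:R^-1)%:E * lne (max_separated f K n e'))
  (fun n => (n%:R^-1)%:E * lne (max_separated f K n e)) 1 isT.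
rewrite invr1 !mul1e; apply => N N0; rewrite mul1e mul1n.
apply: lee_wpmul2l; first by rewrite lee_fin invr_ge0.
apply: le_lne; first exact: max_separated_ge0.
apply: le_ereal_supP => _ [E [EK Esep] <-]; exists (#|` E|%:R)%:E => //.
exists E => //; split=> // y z yE zE yz.
by have [i iN h] := Esep y z yE zE yz; exists i => //; exact: le_lt_trans h.
Qed.

(** By monotonicity in [e] the limit is a supremum, so a lower bound at a single scale is already
    one for the entropy. *)
Lemma top_entropyE f K :
  top_entropy f K = ereal_sup [set growth_rate f K e | e in [set e | (0 < e)%R]].
Proof.
rewrite /top_entropy; apply/cvg_lim => //.
have -> : [set e : R | (0 < e)%R] = [set` Interval (BRight (0%R : R)) (BInfty R false)].
  by apply/seteqP; split=> x /=; rewrite in_itv/= andbT.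
apply: (nonincreasing_at_right_cvge (BInfty R false)) => // e e' _ _.
exact: growth_rate_anti.
Qed.

Lemma top_entropy_ge f K (v : \bar R) (e : R) : (0 < e)%R ->
  v <= growth_rate f K e -> v <= top_entropy f K.
Proof.
move=> e0 ve; rewrite top_entropyE; apply: le_trans ve _.
by apply: ereal_sup_ubound; exists e.
Qed.

(** A set separated by [N] steps of [iter n f] is separated by n N steps of [f] at the same scale;
    the rates are compared along multiples of [n]. *)
Lemma top_entropy_iter f K K' n : (0 < n)%N -> K `<=` K' ->
  (n%:R^-1)%:E * top_entropy (iter n f) K <= top_entropy f K'.
Proof.
move=> n0 KK'; have nR : (0 < n%:R :> R)%R by rewrite ltr0n.
rewrite lee_pdivrMl// [X in X <= _]top_entropyE; apply: ge_ereal_sup => _ [e /= e0 <-].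
rewrite -lee_pdivrMl//; apply: (top_entropy_ge e0).
apply: limn_esup_subsequence => // N N0.
rewrite muleA -EFinM -invfM -natrM.
apply: lee_wpmul2l; first by rewrite lee_fin invr_ge0.
apply: le_lne; first exact: max_separated_ge0.
apply: le_ereal_supP => _ [E [EK Esep] <-]; exists (#|` E|%:R)%:E => //.
exists E => //; split=> [|y z yE zE yz]; first exact: subset_trans KK'.
have [i iN h] := Esep y z yE zE yz; exists (i * n)%N.
  by rewrite mulnC ltn_pmul2l.
by move: h; rewrite -!iterM.
Qed.

End top_entropy.

Section horseshoe_entropy.
Context {R : realType} {s : sidedness}.
Local Notation X := (sequence_space R s nat).
Local Notation sigma := (@shift_map R s nat).
Variable n : nat.
Hypothesis n_gt0 : (0 < n)%N.
Variable W : seq (seq nat).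
Hypotheses (W_size : forall w, w \in W -> size w = n) (W_uniq : uniq W) (W0 : (0 < size W)%N).

(** Each word of [N] blocks is realised by a point. If two of them differ in block [t], then after
    [t] steps they differ at a site below [n], at distance above [e]. *)
Lemma horseshoe_separated (N : nat) (e : R) : e < 2 ^- n ->
  (((size W) ^ N)%N%:R%:E <= max_separated (iter n sigma) (horseshoe n W) N e)%E.
Proof.
move=> en; have w0W : nth [::] W 0 \in W by exact: mem_nth.
pose q0 : seq_sub W := SeqSub w0W.
pose pt (w : {ffun 'I_N -> seq_sub W}) : X := point_of n (fun i : site s =>
  if insub (site_abs i) is Some t then val (w t) else val q0).
have block_pt w i : block n (pt w) i =
    if insub (site_abs i) is Some t then val (w t) else val q0.
  by rewrite /pt block_point_of//; case: insub => [t|]; apply: W_size; exact: valP.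
have block_pt_nat w (t : 'I_N) : block n (pt w) (site_of_nat s t) = val (w t).
  by rewrite block_pt site_abs_of_nat valK.
have pt_inj : injective pt.
  by move=> w w' ww'; apply/ffunP => t; apply: val_inj; rewrite -!block_pt_nat ww'.
apply: ereal_sup_ubound; exists [fset pt w | w in {ffun 'I_N -> seq_sub W}]%fset; last first.
  by rewrite card_imfset//= -cardE card_ffun card_ord card_seq_sub.
split.
  move=> y /= /imfsetP[w _ ->] i; rewrite block_pt.
  by case: insub => [t|]; exact: valP.
move=> y z /imfsetP[w _ ->] /imfsetP[w' _ ->] neq.
have [t wt] : exists t, w t != w' t.
  apply/existsP; apply: contraNT neq => /existsPn h; apply/eqP; congr pt.
  by apply/ffunP => t; apply/eqP/negPn/h.
have [l ln lneq] : exists2 l, (l < n)%N &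
    nth 0%N (val (w t)) l <> nth 0%N (val (w' t)) l.
  apply: contrapT => h; move/negP: wt; apply; apply/eqP/val_inj.
  apply: (@eq_from_nth _ 0%N); first by rewrite !W_size//; exact: valP.
  move=> l; rewrite W_size; last exact: valP.
  by move=> ln; apply: contrapT => ne; apply: h; exists l.
exists t => //; apply: (lt_le_trans en).
apply: (@le_trans _ _ (2 ^- l)).
  by rewrite lef_pV2 ?posrE ?exprn_gt0// ler_weXn2l ?ler1n// ltnW.
rewrite -[l](site_abs_of_nat s); apply: mdist_ge_disagree.
rewrite -!iterM !iter_shiftE site_of_nat_add addnC -site_of_nat_add -site_scale_nat.
by rewrite -!nth_block// !block_pt_nat.
Qed.

Lemma horseshoe_entropy :
  ((ln (size W)%:R)%:E <= top_entropy (iter n sigma) (horseshoe n W) :> \bar R)%E.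
Proof.
have e0 : 0 < 2^-1 * 2 ^- n :> R by rewrite mulr_gt0 ?invr_gt0 ?exprn_gt0.
apply: (top_entropy_ge e0); apply: limn_esup_ge => N N0.
rewrite lee_pdivlMl ?ltr0n//.
apply: le_trans (le_lne _ (horseshoe_separated N _)); last first.
- rewrite -[ltRHS]mul1r ltr_pM2r ?invr_gt0 ?exprn_gt0//; lra.
- by rewrite lee_fin.
by rewrite lne_EFin ?ltr0n ?expn_gt0 ?W0// natrX lnXn ?ltr0n// -EFinM mulr_natl.
Qed.

End horseshoe_entropy.

(** * Invariant measures on the orbit of a horseshoe *)

Section mixture.
Context d (T : measurableType d) (R : realType) (m : nat).
Variables (mu : 'I_m -> probability T R) (p : 'I_m -> R).
Hypotheses (p0 : forall i, 0 <= p i) (p1 : \sum_i p i = 1).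

(** [msum] expects a sequence indexed by [nat], so the family is padded with zero measures. *)
Let part (k : nat) : {measure set T -> \bar R} :=
  if insub k is Some i then mscale (NngNum (p0 i)) (mu i) else mzero.

Let part_ord (i : 'I_m) : part i = mscale (NngNum (p0 i)) (mu i) :> {measure set T -> \bar R}.
Proof. by rewrite /part valK. Qed.

Let mix : set T -> \bar R := msum part m.

HB.instance Definition _ := Measure.on mix.

Let mixE A : mix A = (\sum_(i < m) (p i)%:E * mu i A)%E.
Proof. by rewrite /mix /msum; apply: eq_bigr => i _; rewrite part_ord. Qed.

Let mix_setT : mix setT = 1%E.
Proof.
rewrite mixE; under eq_bigr do rewrite probability_setT mule1.
by rewrite sumEFin p1.
Qed.

HB.instance Definition _ := Measure_isProbability.Build _ _ _ mix mix_setT.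

Lemma mixture_exists : exists nu : probability T R,
  forall A, measurable A -> nu A = (\sum_(i < m) (p i)%:E * mu i A)%E.
Proof. by exists mix => A _; rewrite -mixE. Qed.

Lemma mean_mixture (nu : probability T R) (f : T -> R) :
  (forall A, measurable A -> nu A = (\sum_(i < m) (p i)%:E * mu i A)%E) ->
  bounded_measurable f -> mean nu f = \sum_i p i * mean (mu i) f.
Proof.
move=> nuE bf; have [mf [C fC]] := bf.
(* The shift by [C] makes the function nonnegative, so that its integral is additive in the measure;
   the constant cancels because the weights sum to 1. *)
pose g y := f y + C.
have bg : bounded_measurable g by apply: bounded_measurableD => //; exact: bounded_measurable_cst.
have g0 y : 0 <= g y by have := fC y; rewrite ler_norml => /andP[h _]; rewrite /g; lra.
have meang (Q : probability T R) : mean Q g = mean Q f + C.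
  by rewrite /g meanD//; [rewrite mean_cst|exact: bounded_measurable_cst].
suff H : mean nu g = \sum_i p i * mean (mu i) g.
  move: H; rewrite meang; under eq_bigr do rewrite meang mulrDr.
  by rewrite big_split/= -mulr_suml p1 mul1r => /addIr.
have mg : measurable_fun setT (EFin \o g) by apply/measurable_EFinP; case: bg.
have intfin (Q : probability T R) : (\int[Q]_x (g x)%:E)%E = (mean Q g)%:E.
  rewrite /mean /Rintegral fineK//; apply: integrable_fin_num => //.
  exact: bounded_measurable_integrable.
apply: EFin_inj; rewrite -intfin.
rewrite (@eq_measure_integral _ _ _ _ (msum part m)) => [|A mA _]; last first.
  exact: etrans (nuE A mA) (esym (mixE A)).
rewrite ge0_integral_measure_sum//; last by move=> y _; rewrite lee_fin.
rewrite -sumEFin; apply: eq_bigr => i _; rewrite part_ord ge0_integral_mscale//.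
  by rewrite intfin EFinM.
by move=> y _; rewrite lee_fin.
Qed.

End mixture.

Lemma big_option (V : nmodType) (I : finType) (F : option I -> V) :
  \sum_v F v = F None + \sum_i F (Some i).
Proof.
rewrite (bigD1 None)//=; congr (_ + _).
rewrite (reindex_omap Some id)/=; last by case.
by apply: eq_bigl => i; rewrite eqxx.
Qed.

Section orbit_union_means.
Context {R : realType} {s : sidedness} (M : rel nat).
Local Notation X := (sequence_space R s nat).
Local Notation sigma := (@shift_map R s nat).
Local Notation Sigma := (markov_shift R s M).
Variables (n b : nat) (J : finType) (psi : J -> X -> R) (C e : R).
Hypotheses (n_gt0 : (0 < n)%N) (e0 : 0 < e) (bpsi : forall j, bounded_measurable (psi j))
  (psiC : forall j y, `|psi j y| <= C).
Variables (m : nat) (W : 'I_m -> seq (seq nat)) (I_ : 'I_m -> J -> R).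
Hypothesis W_loop : forall i w, w \in W i -> loop_at M b w.
Hypothesis W_near : forall i w, w \in W i -> forall j,
  birkhoff_near M (psi j) w (n%:R * I_ i j) (n%:R * e).

Definition union_words := flatten [seq W i | i <- enum 'I_m].

Lemma mem_union_words w : reflect (exists i, w \in W i) (w \in union_words).
Proof.
apply: (iffP flattenP) => [[_ /mapP[i _ ->] wi]|[i wi]]; first by exists i.
by exists (W i) => //; apply/mapP; exists i => //; rewrite mem_enum.
Qed.

Let Delta : set X := horseshoe n union_words.

Lemma orbit_union_compact (D : set X) : compact D -> compact (orbit_union sigma n D).
Proof.
move=> Dc; rewrite /orbit_union bigcup_mkord; apply: bigsetU_compact => t _.
apply: continuous_compact => //; apply: continuous_subspaceT.
exact: continuous_iter_shift.
Qed.

Lemma orbit_union_measurable (D : set X) : compact D -> measurable (orbit_union sigma n D).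
Proof.
move=> /orbit_union_compact Dc; apply: closed_measurable_sequence.
by apply: compact_closed => //; exact: metric_hausdorff.
Qed.

Lemma union_words_loop w : w \in union_words -> loop_at M b w.
Proof. by move=> /mem_union_words[i]; exact: W_loop. Qed.

Lemma block_spells (y : X) : spells (block n y (site_of_nat s 0)) y.
Proof.
move=> l; rewrite size_block => ln; rewrite nth_block// /letter; congr (y _).
by rewrite site_scale_nat// mul0n site_of_nat_add.
Qed.

(** [c i] counts those of the first [K] blocks that are attributed to [W i]; a block in several
    alphabets is attributed to one of them. *)
Lemma birkhoff_blocks (K : nat) y : Delta y ->
  exists c : {ffun 'I_m -> 'I_K.+1}, (\sum_i c i = K)%N /\
    forall j, `|birkhoff (psi j) (K * n) y - \sum_i (c i)%:R * (n%:R * I_ i j)|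
      <= K%:R * (n%:R * e).
Proof.
move=> yD; have /choice[typ typP] : forall t : nat, exists i,
    block n (iter (t * n) sigma y) (site_of_nat s 0) \in W i.
  move=> t; apply/mem_union_words; exact: (horseshoe_iter_shift t yD (site_of_nat s 0)).
have cle i : (\sum_(t < K) (typ t == i) < K.+1)%N.
  rewrite ltnS -[leqRHS]card_ord -sum1_card; apply: leq_sum => t _.
  by case: (_ == _).
exists [ffun i => Ordinal (cle i)]; split.
  under eq_bigr do rewrite ffunE/=.
  rewrite exchange_big/= -[RHS]card_ord -sum1_card; apply: eq_bigr => t _.
  by rewrite (bigD1 (typ t))//= eqxx big1// => i /negPf; rewrite eq_sym => ->.
move=> j; under eq_bigr do rewrite ffunE/=.
have -> : \sum_i (\sum_(t < K) (typ t == i))%N%:R * (n%:R * I_ i j) =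
    \sum_(t < K) n%:R * I_ (typ t) j.
  under eq_bigr do rewrite natr_sum mulr_suml.
  rewrite exchange_big/=; apply: eq_bigr => t _.
  rewrite (bigD1 (typ t))//= eqxx mul1r big1 ?addr0// => i /negPf.
  by rewrite eq_sym => ->; rewrite mul0r.
have yM : Sigma y by exact: (horseshoe_sub_markov n_gt0 union_words_loop).
elim: K {cle} => [|K IH]; first by rewrite /birkhoff !big_ord0 subrr normr0 mul0r.
rewrite mulSnr birkhoffD big_ord_recr/= opprD addrACA -natr1 mulrDl mul1r.
apply: le_trans (ler_normD _ _) _; apply: lerD => //.
have := W_near (typP K) j (markov_shift_iter (K * n) yM) (@block_spells _).
by rewrite size_block.
Qed.

(** A point of the orbit is less than [n] steps away from a point of the horseshoe, and moving the
    segment by these steps exchanges two pieces with sums at most n C each. *)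
Lemma birkhoff_orbit_union (K : nat) z : orbit_union sigma n Delta z ->
  exists c : {ffun 'I_m -> 'I_K.+1}, (\sum_i c i = K)%N /\
    forall j, `|birkhoff (psi j) (K * n) z - \sum_i (c i)%:R * (n%:R * I_ i j)|
      <= K%:R * (n%:R * e) + 2 * (n%:R * C).
Proof.
move=> [t /= tn [y yD <-]]; have [c [cK cP]] := birkhoff_blocks K yD; exists c; split=> // j.
have E : birkhoff (psi j) (K * n) (iter t sigma y) = birkhoff (psi j) (K * n) y +
    (birkhoff (psi j) t (iter (K * n) sigma y) - birkhoff (psi j) t y).
  have := birkhoffD (psi j) t (K * n) y; rewrite addnC birkhoffD => h.
  by rewrite addrA h; ring.
rewrite E addrAC; apply: le_trans (ler_normD _ _) _; apply: lerD; first exact: cP.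
have tC x : `|birkhoff (psi j) t x| <= n%:R * C.
  apply: (le_trans (birkhoff_le _ _ (psiC j))); rewrite ler_wpM2r ?ler_nat ?(ltnW tn)//.
  exact: le_trans (psiC j x).
apply: (le_trans (ler_normB _ _)); have := tC (iter (K * n) sigma y); have := tC y; lra.
Qed.

(** By invariance, integrating the Birkhoff sum over K' n steps gives K' n times the mean; [p i] is
    the expected proportion of blocks of kind [i], the same for all observables. *)
Lemma orbit_union_mean (nu : probability X R) :
  invariant_probabilities sigma (orbit_union sigma n Delta) nu ->
  exists p : 'I_m -> R, [/\ forall i, 0 <= p i, \sum_i p i = 1 &
    forall j, `|\sum_i p i * I_ i j - mean nu (psi j)| <= 2 * e].
Proof.
move=> [nuL nu_inv].
(* For this many blocks the boundary term 2 n C is at most [e] per step, which together with the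
   error of the blocks gives 2 e. *)
have [K Klt] : exists K : nat, 2 * C / e < K%:R by eexists; exact: truncnS_gt.
pose K' := K.+1.
(* Several count vectors may fit the same point; [finite_cells] selects one of them measurably. *)
pose G (c : {ffun 'I_m -> 'I_K'.+1}) : set X := [set z | (\sum_i c i = K')%N /\
  forall j, `|birkhoff (psi j) (K' * n) z - \sum_i (c i)%:R * (n%:R * I_ i j)|
      <= K'%:R * (n%:R * e) + 2 * (n%:R * C)].
have mG c : measurable (G c).
  have [cK|cK] := eqVneq (\sum_i c i)%N K'; last first.
    rewrite (_ : G c = set0)//; apply/seteqP; split=> z // -[/eqP].
    by rewrite (negPf cK).
  rewrite (_ : G c = \bigcap_(j in [set: J]) ((fun z =>
     birkhoff (psi j) (K' * n) z - \sum_i (c i)%:R * (n%:R * I_ i j)) @^-1`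
     [set v | `|v| <= K'%:R * (n%:R * e) + 2 * (n%:R * C)])).
    apply: fin_bigcap_measurable => [|j _]; first exact: finite_finset.
    have -> : [set v : R | `|v| <= K'%:R * (n%:R * e) + 2 * (n%:R * C)] =
        `[- (K'%:R * (n%:R * e) + 2 * (n%:R * C)), K'%:R * (n%:R * e) + 2 * (n%:R * C)]%classic.
      by apply/seteqP; split=> v /=; rewrite in_itv/= ler_norml.
    have mf : measurable_fun setT (fun z => birkhoff (psi j) (K' * n) z -
        \sum_i (c i)%:R * (n%:R * I_ i j)).
      apply: measurable_funB => //.
      exact: (bounded_measurable_birkhoff (K' * n) (bpsi j)).1.
    by rewrite -[X in measurable X]setTI; apply: mf.
  apply/seteqP; split=> [z [_ h] j _|z h]; first exact: h.
  by split=> // j; exact: (h j Logic.I).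
have [cell [mcell cellS cellN _]] := finite_cells mG.
have mL := orbit_union_measurable (@horseshoe_compact R s n n_gt0 union_words).
pose pc c := pr nu (cell @^-1` [set Some c]).
(* On the orbit union, which carries [nu], some count vector always fits; so the trivial bound on
   the cell [None] gets weight 0. *)
have pN : pr nu (cell @^-1` [set None]) = 0.
  apply/eqP; rewrite eq_le pr_ge0 andbT.
  apply: (@le_trans _ _ (pr nu (~` orbit_union sigma n Delta))).
    apply: pr_le => //; first exact: measurableC.
    move=> z /= zN zL; have [c cP] := birkhoff_orbit_union K' zL.
    exact: (cellN _ _ zN cP).
  by rewrite pr_setC// /pr nuL subrr.
have pc0 c : 0 <= pc c by exact: pr_ge0.
have pc1 : \sum_c pc c = 1.
  rewrite -(pr_setT nu) (pr_cells nu mcell measurableT) big_option setTI pN add0r.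
  by apply: eq_bigr => c _; rewrite setTI.
have pcK c : pc c != 0 -> (\sum_i c i = K')%N.
  move=> pcn; have [E|/set0P[z /= /cellS[]//]] := eqVneq (cell @^-1` [set Some c]) set0.
  by move: pcn; rewrite /pc E /pr measure0 eqxx.
have K0 : 0 < K'%:R :> R by [].
exists (fun i => \sum_c pc c * ((c i)%:R / K'%:R)); split.
- by move=> i; apply: sumr_ge0 => c _; rewrite mulr_ge0// divr_ge0.
- rewrite exchange_big/= -[RHS]pc1; apply: eq_bigr => c _.
  rewrite -mulr_sumr -mulr_suml -natr_sum.
  have [->|/pcK ->] := eqVneq (pc c) 0; first by rewrite mul0r.
  by rewrite divff ?mulr1// gt_eqF.
move=> j.
pose g (v : option {ffun 'I_m -> 'I_K'.+1}) :=
  if v is Some c then \sum_i (c i)%:R * (n%:R * I_ i j) else 0.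
pose tau (v : option {ffun 'I_m -> 'I_K'.+1}) :=
  if v is Some c then K'%:R * (n%:R * e) + 2 * (n%:R * C) else (K' * n)%:R * C.
have close z : `|birkhoff (psi j) (K' * n) z - g (cell z)| <= tau (cell z).
  case E : (cell z) => [c|] /=; first by have [_] := cellS _ _ E; apply.
  by rewrite subr0; exact: birkhoff_le.
have := mean_cell_approx nu mcell (bounded_measurable_birkhoff (K' * n) (bpsi j)) close.
rewrite mean_birkhoff// !big_option pN !mul0r !add0r /=.
rewrite -[X in _ <= X]mulr_suml pc1 mul1r.
set S := \sum_c pc c * _; set S' := \sum_i _ * I_ i j.
have -> : S = (K' * n)%:R * S'.
  rewrite /S /S' mulr_sumr.
  under [RHS]eq_bigr => i _ do rewrite mulr_suml mulr_sumr.
  rewrite exchange_big/=; apply: eq_bigr => c _; rewrite mulr_sumr.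
  by apply: eq_bigr => i _; rewrite natrM; field; rewrite gt_eqF.
rewrite -mulrBr normrM ger0_norm// distrC.
have Kn0 : 0 < (K' * n)%:R :> R by rewrite ltr0n muln_gt0.
have Ce : 2 * C <= K'%:R * e.
  by rewrite -ler_pdivrMr// (le_trans (ltW Klt))// ler_nat.
move=> h; rewrite -(ler_pM2l Kn0); apply: le_trans h _.
have : n%:R * (2 * C) <= n%:R * (K'%:R * e) by rewrite ler_wpM2l.
by rewrite natrM; lra.
Qed.

End orbit_union_means.

(** * Assembling the horseshoes *)

(* In the two-sided case the window around the origin has to be moved by [o = k] to
   nonnegative sites, where words are read. *)
Lemma site_window_word s (k : nat) : exists (p0 : site s) (o : nat), (o <= k)%N /\
  forall i : site s, (site_abs i <= k)%N -> exists2 l, (l <= 2 * k)%N &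
    site_add p0 l = i /\ site_add i o = site_of_nat s l.
Proof.
case: s.
  exists 0%N, 0%N; split=> // i ik; exists i; first by rewrite /= in ik; lia.
  by rewrite !site_addE_one/= addn0.
exists (- k%:Z : site TwoSided), k; split=> // i /= ik.
exists (absz (i + k%:Z)); first by lia.
by rewrite !site_addE_two; split=> /=; lia.
Qed.

Section markers.
Context {R : realType} {s : sidedness} (M : rel nat).
Local Notation X := (sequence_space R s nat).
Local Notation sigma := (@shift_map R s nat).
Local Notation Sigma := (markov_shift R s M).
Hypothesis M_transitive : topologically_transitive M.

(** The window of [x] is spelled and bridged back to its first letter, which becomes the base point
    [b] of all loops. [o] moves the origin to the centre of the spelled window. *)
Lemma marker_word (x : X) (eps : R) : Sigma x -> 0 < eps ->
  exists (b : nat) (mk : seq nat) (o : nat), [/\ loop_at M b mk, (o < size mk)%N &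
    forall y : X, spells mk y -> ball x eps (iter o sigma y)].
Proof.
move=> xM eps0; have [k kball] := ball_agree x eps0.
have [p0 [off [offk winP]]] := site_window_word s k.
pose u := [seq x (site_add p0 l) | l <- iota 0 (2 * k).+1].
have u_size : size u = (2 * k).+1 by rewrite size_map size_iota.
have u_nth l : (l < (2 * k).+1)%N -> nth 0%N u l = x (site_add p0 l).
  by move=> lk; rewrite (nth_map 0%N) ?size_iota// nth_iota.
have u_sorted : sorted M u.
  apply/(sortedP 0%N) => l; rewrite u_size => lk.
  by rewrite !u_nth ?(ltnW lk)//; exact: xM.
have [w wM] := bridge M_transitive (last 0%N u) (head 0%N u).
exists (head 0%N u), (u ++ w), off; split.
- case: u u_size u_sorted wM {u_nth} => [//|a u] _ /= au wM.
  by rewrite loop_at_cons rcons_cat cat_path au.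
- by rewrite size_cat u_size; lia.
move=> y /spells_cat[yu _]; apply: kball => i ik.
have [l lk [pl il]] := winP i ik.
rewrite iter_shiftE il -[y _]/(letter y l) yu ?u_size ?ltnS// u_nth ?ltnS//.
by rewrite pl.
Qed.

(** The trivial partition has entropy 0; this excludes -oo, so that finite entropy is a real
    number. *)
Lemma metric_entropy_ge0 (P : probability X R) : (0 <= metric_entropy sigma P)%E.
Proof.
pose xi (i : nat) : set X := if i == 0%N then setT else set0.
have mxi i : measurable (xi i) by rewrite /xi; case: ifP.
have pxi : measurable_partition xi.
  split=> //; last by apply/seteqP; split=> // y _; exists 0%N.
  move=> i j _ _ [y []]; rewrite /xi.
  by case: eqP => // -> _; case: eqP => // ->.
have H0 : partition_entropy P xi = 0%E.
  apply: esum1 => i _; rewrite /xi; case: ifP => _.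
    by rewrite probability_setT/= ln1 mulr0 oppr0.
  by rewrite measure0 /= mul0r oppr0.
apply: (@le_trans _ _ (entropy_wrt sigma P xi)); last first.
  by apply: ereal_sup_ubound; exists xi => //; split=> //; rewrite H0 ltry.
rewrite /entropy_wrt; set v := (fun n => _).
have v0 n : (0 <= v n)%E.
  rewrite /v mule_ge0 ?lee_fin ?invr_ge0//.
  apply: partition_entropy_ge0 => w; apply: measurable_join => //.
  exact: measurable_shift.
have [cv|ncv] := pselect (cvgn v); last by rewrite dvgP.
by apply: lime_ge => //; apply: nearW.
Qed.

Section equalized.
Variables (m : nat) (mu : 'I_m -> probability X R) (J : finType) (psi : J -> X -> R) (C : R).
Hypotheses
  (mu_inv : forall i, invariant_probabilities sigma Sigma (mu i))
  (bpsi : forall j, bounded_measurable (psi j)) (psiC : forall j y, `|psi j y| <= C)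
  (uc : forall j (d : R), 0 < d -> exists r, forall y z, Sigma y -> Sigma z ->
    agree r y z -> `|psi j y - psi j z| < d).

(** Loops for different measures have different lengths [l i]; repeating them P0 / l i times, with
    [P0] the product of the lengths, gives a common length. The marker is put once in front, so its
    cost is fixed while the loops can be made long. *)
Lemma equalized_words (b : nat) (mk : seq nat) (e : R) (c : 'I_m -> R) :
  loop_at M b mk -> 0 < e -> (forall i, ((c i)%:E < metric_entropy sigma (mu i))%E) ->
  exists (n : nat) (W : 'I_m -> seq (seq nat)), (0 < n)%N /\ forall i,
    [/\ uniq (W i), (0 < size (W i))%N, n%:R * (c i - e) <= ln (size (W i))%:R &
    forall w, w \in W i -> [/\ size w = n, loop_at M b w, exists v, w = mk ++ v &
      forall j, birkhoff_near M (psi j) w (n%:R * mean (mu i) (psi j)) (n%:R * e)]].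
Proof.
move=> mk_loop e0 clt; pose e1 := e / 2.
have e10 : 0 < e1 by rewrite divr_gt0.
pose C' := Num.max 0 C.
have C0 : 0 <= C' by rewrite le_max lexx.
have psiC' j y : `|psi j y| <= C' by rewrite le_max psiC orbT.
(* The marker's share: |c i - e1| per letter in the exponent, and 2 C' per letter in Birkhoff sums,
   once for the sum over the marker and once for replacing [P0] by [n] in the centre. *)
pose K i := (size mk)%:R * (2 * C' + `|c i - e1|).
have K0 i : 0 <= K i by rewrite mulr_ge0// addr_ge0// mulr_ge0.
have /choice[mV mVP] : forall i, exists mV : nat * seq (seq nat),
   [/\ K i <= mV.1%:R * e1, (0 < mV.1)%N, uniq mV.2 &
      expR (mV.1%:R * (c i - e1)) <= (size mV.2)%:R] /\
  forall w, w \in mV.2 -> [/\ size w = mV.1, loop_at M b w &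
    forall j, birkhoff_near M (psi j) w (mV.1%:R * mean (mu i) (psi j)) (mV.1%:R * e1)].
  move=> i; have [muS mui] := mu_inv i.
  have [N0 N0P] : exists N0 : nat, K i / e1 < N0%:R by eexists; exact: truncnS_gt.
  have [l [V [[Nl l0 Vu Vexp] VP]]] :=
    loop_words M_transitive mui muS bpsi psiC uc b N0 e10 (clt i).
  exists (l, V); split=> //; split=> //=.
  by rewrite -ler_pdivrMr// (le_trans (ltW N0P))// ler_nat.
pose l i := (mV i).1; pose V i := (mV i).2.
pose P0 := (\prod_i l i)%N.
have l_gt0 i : (0 < l i)%N by have [[]] := mVP i.
have P0_gt0 : (0 < P0)%N by apply: prodn_gt0.
pose r i := (P0 %/ l i)%N.
have rl i : (r i * l i = P0)%N.
  by rewrite divnK// /P0 (bigD1 i)//= dvdn_mulr.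
have r_gt0 i : (0 < r i)%N.
  by rewrite lt0n; apply: contraTneq P0_gt0 => ri; rewrite -(rl i) ri mul0n.
pose n := (size mk + P0)%N.
pose word i (t : (r i).-tuple (seq_sub (V i))) := mk ++ flatten [seq val w | w <- t].
pose W i := [seq word i t | t <- enum {: (r i).-tuple (seq_sub (V i))}].
have V_size i (w : seq_sub (V i)) : size (val w) = l i.
  by have [_ /(_ _ (valP w))[]] := mVP i.
have shape_word i (t : (r i).-tuple (seq_sub (V i))) :
    shape [seq val w | w <- t] = nseq (r i) (l i).
  rewrite /shape -map_comp -[r i in RHS](size_tuple t).
  by elim: (tval t) => //= w t' ->; rewrite V_size.
have word_inj i : injective (word i).
  move=> t t' /eqP; rewrite eqseq_cat// eqxx/= => /eqP.
  move=> /eq_from_flatten_shape; rewrite !shape_word => /(_ erefl) E.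
  by apply: val_inj; apply: (inj_map val_inj).
have sizeW i : size (W i) = (size (V i) ^ r i)%N.
  by rewrite size_map -cardE card_tuple card_seq_sub//; have [[]] := mVP i.
have word_size i t : size (word i t) = n.
  rewrite size_cat size_flatten shape_word; congr (_ + _)%N.
  by rewrite sumn_nseq mulnC rl.
have nP i : (l i <= n)%N.
  by rewrite /n -(rl i); apply: leq_trans (leq_addl _ _); rewrite leq_pmull.
have V_gt0 i : (0 < size (V i))%N.
  by have [[_ _ _ h] _] := mVP i; rewrite -(ltr0n R); apply: lt_le_trans h; exact: expR_gt0.
have Kn i : K i <= n%:R * e1.
  have [[h _ _ _] _] := mVP i; apply: le_trans h _.
  by rewrite ler_wpM2r ?ler_nat ?ltW// nP.
have nR : n%:R = (size mk)%:R + P0%:R :> R by rewrite natrD.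
have ee : e = e1 + e1 by rewrite /e1 -splitr.
exists n, W; split; first by rewrite addn_gt0 P0_gt0 orbT.
move=> i; split.
- by rewrite map_inj_uniq ?enum_uniq//; exact: word_inj.
- by rewrite sizeW expn_gt0 V_gt0.
- rewrite sizeW natrX lnXn ?ltr0n// -[leRHS]mulr_natl.
  have h1 : (l i)%:R * (c i - e1) <= ln (size (V i))%:R.
    have [[_ _ _ h] _] := mVP i.
    by rewrite -[leLHS]expRK ler_ln// posrE ?expR_gt0// ltr0n.
  apply: (@le_trans _ _ ((r i)%:R * ((l i)%:R * (c i - e1)))); last by rewrite ler_wpM2l.
  rewrite mulrA -natrM rl.
  have h2 : (size mk)%:R * (c i - e1) <= n%:R * e1.
    apply: le_trans (Kn i); rewrite /K ler_wpM2l// (le_trans (ler_norm _))// lerDr mulr_ge0//.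
  have h3 : n%:R * e = n%:R * e1 + n%:R * e1 by rewrite ee mulrDr.
  have -> : n%:R * (c i - e) = n%:R * c i - (n%:R * e1 + n%:R * e1) by rewrite mulrBr h3.
  by move: h2; rewrite nR; lra.
move=> _ /mapP[t _ ->]; split.
- exact: word_size.
- apply: loop_at_cat => //; apply: loop_at_flatten; first by rewrite size_map size_tuple.
  by move=> _ /mapP[w _ ->]; have [_ /(_ _ (valP w))[]] := mVP i.
- by eexists.
move=> j.
have nV (w : seq_sub (V i)) : birkhoff_near M (psi j) (val w)
    ((l i)%:R * mean (mu i) (psi j)) ((l i)%:R * e1).
  by have [_ /(_ _ (valP w))[_ _]] := mVP i; apply.
have := birkhoff_near_cat (@birkhoff_near_trivial R s M (psi j) mk C' (psiC' j))
  (@birkhoff_near_flatten R s M (psi j) _ (tval t) val _ _ nV).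
move=> h; apply: (birkhoff_near_le h); rewrite add0r.
rewrite !big_const_seq !count_predT size_tuple !iter_addr_0.
rewrite -[X in _ + (_ + X)]mulr_natl -[X in `|X - _|]mulr_natl.
have rlR a : (r i)%:R * ((l i)%:R * a) = P0%:R * a :> R by rewrite mulrA -natrM rl.
rewrite !rlR -mulrBl.
have -> : P0%:R - n%:R = - (size mk)%:R :> R by rewrite nR; ring.
rewrite normrM normrN (ger0_norm (ler0n R (size mk))).
have h1 : (size mk)%:R * `|mean (mu i) (psi j)| <= (size mk)%:R * C'.
  by rewrite ler_wpM2l// mean_norm_le.
have h2 : (size mk)%:R * (2 * C') <= n%:R * e1.
  by apply: le_trans (Kn i); rewrite /K ler_wpM2l// lerDl.
have h3 : P0%:R * e1 <= n%:R * e1 by rewrite ler_wpM2r ?(ltW e10)// nR lerDr.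
have h4 : n%:R * e = n%:R * e1 + n%:R * e1 by rewrite ee mulrDr.
by lra.
Qed.

End equalized.
End markers.

Theorem theorem3 (R : realType) (s : sidedness) (M : rel nat)
  (Sigma := markov_shift R s M)
  (sigma := @shift_map R s nat)
  (M_transitive : topologically_transitive M)
  (M_nontrivial : nontrivial_shift R s M)
  (m k : nat) (m_gt0 : (0 < m)%N) (k_gt0 : (0 < k)%N)
  (mu : 'I_m -> probability (sequence_space R s nat) R)
  (mu_inv : forall i, invariant_probabilities sigma Sigma (mu i))
  (mu_fin : forall i, (metric_entropy sigma (mu i) < +oo)%E)
  (x : sequence_space R s nat) (Sigma_x : Sigma x)
  (phi : 'I_k -> sequence_space R s nat -> R)
  (phi_bounded : forall j, [bounded phi j y | y in Sigma])
  (phi_uc : forall j, unif_continuous (phi j : subspace Sigma -> R))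
  (eps : R) (eps_gt0 : 0 < eps) :
  exists2 n : nat, (0 < n)%N &
  exists (Delta : set (sequence_space R s nat))
         (Delta_ : 'I_m -> set (sequence_space R s nat)),
  let Lambda := orbit_union sigma n Delta in
  let Lambda_ i := orbit_union sigma n (Delta_ i) in
  [/\ Delta `<=` Sigma, compact Delta & forward_invariant (iter n sigma) Delta]
  /\ forall i : 'I_m,
  [/\ Delta_ i `<=` Delta, compact (Delta_ i) &
      forward_invariant (iter n sigma) (Delta_ i)]
  /\ [/\ conjugate_to_full_shift R s (Delta_ i) (iter n sigma) /\
      conjugate_to_full_shift R s Delta (iter n sigma),
      (top_entropy sigma (Lambda_ i) >=
         (n%:R^-1)%:E * top_entropy (iter n sigma) (Delta_ i))%E /\
      ((n%:R^-1)%:E * top_entropy (iter n sigma) (Delta_ i) >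
         metric_entropy sigma (mu i) - eps%:E)%E,
      (forall nu, invariant_probabilities sigma (Lambda_ i) nu ->
         forall j : 'I_k,
         `| \int[mu i]_(y in Sigma) phi j y - \int[nu]_(y in Sigma) phi j y |
           < eps) /\
      (forall nu, invariant_probabilities sigma Lambda nu ->
         exists2 mu', measure_convex_hull mu mu' &
         forall j : 'I_k,
         `| \int[mu']_(y in Sigma) phi j y - \int[nu]_(y in Sigma) phi j y |
           < eps) &
      forall z, Lambda_ i z \/ Lambda z ->
        exists2 j : nat, (1 <= j <= n)%N &
        forall t : nat, ball x eps (iter (j + t * n) sigma z)].
Proof.
have xM := Sigma_x.
pose psi j := phi j \_ Sigma.
have mS : measurable Sigma by exact: measurable_markov_shift.
have bpsi j : bounded_measurable (psi j).
  by apply: restrict_bounded_measurable.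
have psiE (nu : probability (sequence_space R s nat) R) j :
    \int[nu]_(y in Sigma) phi j y = mean nu (psi j).
  by rewrite Rintegral_mkcond.
have /choice[D DP] : forall j, exists D, forall y, `|psi j y| <= D.
  by move=> j; have [_] := bpsi j.
pose C := \sum_j `|D j|.
have psiC j y : `|psi j y| <= C.
  rewrite /C (bigD1 j)//= (le_trans (DP j y))// (le_trans (ler_norm _))// lerDl.
  by apply: sumr_ge0.
have uc j (d : R) : 0 < d -> exists r, forall y z, Sigma y -> Sigma z ->
    agree r y z -> `|psi j y - psi j z| < d.
  move=> d0; have [r rP] := unif_continuous_agree (phi_uc j) d0.
  by exists r => y z yS zS yz; rewrite /psi !patchE !mem_set//; exact: rP.
(* The entropy loses [e] in [c] and [e] in the words, and the means lose 2 e, all below [eps]. *)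
pose e := eps / 8.
have e0 : 0 < e by rewrite divr_gt0.
have h_ge0 i := metric_entropy_ge0 (mu i).
pose h i := fine (metric_entropy sigma (mu i)).
have hE i : metric_entropy sigma (mu i) = (h i)%:E.
  by rewrite /h fineK// ge0_fin_numE.
pose c i := h i - e.
have clt i : ((c i)%:E < metric_entropy sigma (mu i))%E.
  by rewrite hE lte_fin /c ltrBlDr ltrDl.
have [b [mk [off [mk_loop off_lt mk_ball]]]] := marker_word M_transitive xM eps_gt0.
have [n [W [n0 WP]]] := equalized_words M_transitive mu_inv bpsi psiC uc mk_loop e0 clt.
have W_loop i w : w \in W i -> loop_at M b w.
  by move=> wi; have [_ _ _ /(_ w wi)[]] := WP i.
have W_near i w : w \in W i -> forall j,
    birkhoff_near M (psi j) w (n%:R * mean (mu i) (psi j)) (n%:R * e).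
  by move=> wi; have [_ _ _ /(_ w wi)[]] := WP i.
have W_size i w : w \in W i -> size w = n.
  by move=> wi; have [_ _ _ /(_ w wi)[]] := WP i.
have W_gt0 i : (0 < size (W i))%N by have [] := WP i.
pose WW := union_words W.
have WW_loop w : w \in WW -> loop_at M b w by exact: union_words_loop.
have WiWW i : {subset W i <= WW} by move=> w wi; apply/mem_union_words; exists i.
have WW_gt0 : (0 < size WW)%N.
  have w0 := mem_nth [::] (W_gt0 (Ordinal m_gt0)).
  by have := WiWW _ _ w0; case: (WW).
have WW_size w : w \in WW -> size w = n by move=> /mem_union_words[i]; exact: W_size.
have WW_mk w : w \in WW -> exists v, w = mk ++ v.
  by move=> /mem_union_words[i wi]; have [_ _ _ /(_ w wi)[]] := WP i.
exists n => //; exists (horseshoe n WW), (fun i => horseshoe n (W i)) => Lambda Lambda_.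
have LL i : Lambda_ i `<=` Lambda.
  move=> z [j jn [y yD <-]]; exists j => //; exists y => //.
  exact: horseshoe_le (WiWW i) _ yD.
split.
  split; [exact: (horseshoe_sub_markov n0 WW_loop)|exact: horseshoe_compact|].
  by move=> _ [y yD <-]; exact: horseshoe_shift.
move=> i; split.
  split; [exact: horseshoe_le|exact: horseshoe_compact|].
  by move=> _ [y yD <-]; exact: horseshoe_shift.
have nR : 0 < n%:R :> R by rewrite ltr0n.
split.
- split; first exact: (horseshoe_conjugate n0 (W_size i)).
  exact: (horseshoe_conjugate n0 WW_size).
- split.
    apply: top_entropy_iter => // y yD; exists 0%N => //; by exists y.
  have [Wu _ Wln _] := WP i.
  have := horseshoe_entropy (s := s) n0 (W_size i) Wu (W_gt0 i).
  rewrite hE -EFinB => hW; apply: (@lt_le_trans _ _ ((n%:R^-1)%:E * (ln (size (W i))%:R)%:E)%E).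
    rewrite -EFinM lte_fin -ltr_pdivrMl ?invr_gt0// invrK.
    apply: lt_le_trans Wln; rewrite ltr_pM2l// /c.
    by rewrite /e; lra.
  by apply: lee_wpmul2l; [rewrite lee_fin invr_ge0 ltW|exact: hW].
- split=> nu nuP.
    move=> j; rewrite !psiE.
    (* A single horseshoe is the union for a family of one alphabet; its convex combination has the
       one coefficient 1. *)
    have E : horseshoe n (union_words (fun _ : 'I_1 => W i)) =
        horseshoe n (W i) :> set (sequence_space R s nat).
      apply/seteqP; split; apply: horseshoe_le => w; first by move=> /mem_union_words[].
      by move=> wi; apply/mem_union_words; exists ord0.
    rewrite /Lambda_ -E in nuP.
    have [p [_ p1 pP]] := @orbit_union_mean R s M n b _ psi C e n0 e0 bpsi psiC 1
      (fun=> W i) (fun _ j => mean (mu i) (psi j)) (fun _ => W_loop i) (fun _ => W_near i) nu nuP.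
    apply: le_lt_trans (_ : _ <= 2 * e) _; last by rewrite /e; lra.
    by have := pP j; move: p1; rewrite !big_ord1 => ->; rewrite mul1r.
  have [p [p0 p1 pP]] := orbit_union_mean n0 e0 bpsi psiC W_loop W_near nuP.
  have [mu' mu'E] := mixture_exists mu p0 p1.
  exists mu'; first by exists p; split.
  move=> j; rewrite !psiE (mean_mixture p0 p1 mu'E)//.
  apply: le_lt_trans (pP j) _; rewrite /e; lra.
move=> z zL; have {zL} [j0 /= j0n [y yD <-]] : Lambda z by case: zL => // /LL.
have ballP t : ball x eps (iter (off + t * n) sigma y).
  rewrite iterD; apply: mk_ball.
  have /WW_mk[v E] := horseshoe_iter_shift t yD (site_of_nat s 0).
  have : spells (mk ++ v) (iter (t * n) sigma y) by rewrite -E; exact: block_spells.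
  by move=> /spells_cat[].
have off_n : (off < n)%N.
  have /WW_mk[v E] := yD (site_of_nat s 0).
  by rewrite -(size_block n y (site_of_nat s 0)) E size_cat ltn_addr.
(* [z] lies [j0] steps into a block, and the ball is met at phase [off] of every block. The exponent
   is the gap modulo [n], taken in the range from 1 to [n]: for [j0 = off] it is [n] rather than
   0. *)
have [jo|oj] := ltnP j0 off.
  exists (off - j0)%N; first by lia.
  by move=> t; rewrite -iterD (_ : _ + _ = off + t * n)%N//; lia.
exists (off + n - j0)%N; first by lia.
by move=> t; rewrite -iterD (_ : _ + _ = off + t.+1 * n)%N// mulSn; lia.
Qed.
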